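(* For every fixed $k$, the problem $Q|G=\textit{block graph},\textit{cut}(G)\le k,p_j=1|C_{\max}$ can be solved exactly in time $O(m^{k+2}n^2\log(mn))$: given $m$ uniform machines with speeds $s_1,\dots,s_m\in\mathbb{N}^+$ and $n$ unit-time jobs whose conflict graph $G$ is a block graph with at most $k$ cut-vertices, one can in this time compute a schedule of minimum makespan (or report that no schedule exists).
   Context: Scheduling with a conflict graph: jobs $J=\{J_1,\dots,J_n\}$, machines $M=\{M_1,\dots,M_m\}$, conflict graph $G=(J,E)$; a schedule is a map $\sigma:J\to M$ with adjacent jobs on different machines. On uniform machines ($Q$), machine $M_i$ has speed $s_i$ and a job with processing requirement $p_j$ takes time $p_j/s_i$ on $M_i$; here $p_j=1$ for all jobs. The load of a machine is the total processing time of its jobs and the makespan is the maximum load. A block graph is a graph in which every maximal 2-connected component is a clique; a block is a maximal clique; a cut-vertex is a vertex lying in at least two blocks; $\textit{cut}(G)$ denotes the number of cut-vertices of $G$. *)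

(* Defs.v *)
From mathcomp Require Import all_boot all_order all_algebra.
Set Implicit Arguments. Unset Strict Implicit. Unset Printing Implicit Defensive.
Import Order.TTheory GRing.Theory Num.Theory.

Section Graphs.
Variables (T : finType) (e : rel T).

Definition simple_graph : Prop := symmetric e /\ irreflexive e.

(* the subgraph induced by B is connected (the empty set counts as connected) *)
Definition connected_in (B : {set T}) : bool :=
  [forall x in B, forall y in B,
     connect [rel u v | [&& u \in B, v \in B & e u v]] x y].

Definition nocut (B : {set T}) : bool :=
  [&& B != set0, connected_in B & [forall v in B, connected_in (B :\ v)]].

(* blocks: maximal (vertex sets of) connected subgraphs without cut-vertex,
   i.e. maximal 2-connected components (bridges and isolated vertices included) *)
Definition is_block (B : {set T}) : bool := maxset nocut B.

Definition is_clique (B : {set T}) : bool :=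
  [forall x in B, forall y in B, (x != y) ==> e x y].

Definition block_graph : Prop := forall B, is_block B -> is_clique B.

Definition cut_vertices : {set T} :=
  [set v | [exists B1, exists B2,
     [&& is_block B1, is_block B2, B1 != B2, v \in B1 & v \in B2]]].

Definition cut : nat := #|cut_vertices|.
End Graphs.

Section Sched.
Variables (m n : nat) (s : 'I_m -> nat) (e : rel 'I_n).

Definition proper_schedule (sigma : 'I_n -> 'I_m) : Prop :=
  forall j1 j2, e j1 j2 -> sigma j1 != sigma j2.

Definition load (sigma : 'I_n -> 'I_m) (i : 'I_m) : rat :=
  (#|[set j | sigma j == i]|%:R / (s i)%:R)%R.

Definition makespan (sigma : 'I_n -> 'I_m) : rat :=
  (\big[Num.max/0]_(i < m) load sigma i)%R.
End Sched.

(* Machine model: a unit-cost RAM over natural numbers.               *)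
Inductive instr :=
| IConst of nat & nat
| IAdd of nat & nat & nat
| ISub of nat & nat & nat        (* truncated subtraction                  *)
| IMul of nat & nat & nat
| IDiv of nat & nat & nat        (* R[r] := R[a] %/ R[b] (x %/ 0 = 0)      *)
| ILoad of nat & nat
| IStore of nat & nat
| IJz of nat & nat
| IJmp of nat
| IHalt.

Definition memory := nat -> nat.

Definition upd (M : memory) (a v : nat) : memory :=
  fun x => if x == a then v else M x.

Definition exec_instr (i : instr) (pc : nat) (M : memory) : nat * memory :=
  match i with
  | IConst r c => (pc.+1, upd M r c)
  | IAdd r a b => (pc.+1, upd M r (M a + M b))
  | ISub r a b => (pc.+1, upd M r (M a - M b))
  | IMul r a b => (pc.+1, upd M r (M a * M b))
  | IDiv r a b => (pc.+1, upd M r (M a %/ M b))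
  | ILoad r a => (pc.+1, upd M r (M (M a)))
  | IStore a r => (pc.+1, upd M (M a) (M r))
  | IJz r l => (if M r == 0 then l else pc.+1, M)
  | IJmp l => (l, M)
  | IHalt => (pc, M)
  end.

(* run program P for at most [fuel] steps from (pc, M); Some M' iff it
   reaches a halt (IHalt or pc out of range) within fuel steps *)
Fixpoint run (P : seq instr) (fuel pc : nat) (M : memory) : option memory :=
  match nth IHalt P pc with
  | IHalt => Some M
  | i => match fuel with
         | 0 => None
         | f.+1 => let: (pc', M') := exec_instr i pc M in run P f pc' M'
         end
  end.

(* Input encoding: M[0] = m, M[1] = n, M[2+i] = s_i (i < m),
   M[2+m+j1*n+j2] = 1 if j1 j2 conflict, 0 otherwise; 0 elsewhere. *)
Definition encode_input (m n : nat) (s : 'I_m -> nat) (e : rel 'I_n) : memory :=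
  fun a =>
    if a == 0 then m
    else if a == 1 then n
    else if a < 2 + m then
      (if insub (a - 2) is Some i then s i else 0)
    else if a < 2 + m + n * n then
      let b := a - (2 + m) in
      (if insub (b %/ n) is Some j1 then
         if insub (b %% n) is Some j2 then nat_of_bool (e j1 j2) else 0
       else 0)
    else 0.

(* Output convention: M[0] = 0 means "no feasible schedule";
   otherwise M[1+j] is the (0-based) machine of job j. *)
Definition correct_output (m n : nat) (s : 'I_m -> nat) (e : rel 'I_n)
    (M : memory) : Prop :=
  if M 0 == 0 then forall sigma : 'I_n -> 'I_m, ~ proper_schedule e sigma
  else exists sigma : 'I_n -> 'I_m,
      (forall j : 'I_n, M j.+1 = sigma j) /\ proper_schedule e sigma /\
      forall tau : 'I_n -> 'I_m, proper_schedule e tau ->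
        (makespan s sigma <= makespan s tau)%R.

(* the O(m^{k+2} n^2 log(mn)) bound, with the usual O-slack C*f + C *)
Definition time_bound (k C m n : nat) : nat :=
  C * (m ^ (k + 2) * n ^ 2 * (trunc_log 2 (m * n)).+1) + C.

(* Main.v *)
Require Import Defs.
From mathcomp Require Import all_boot all_order all_algebra.
From mathcomp Require Import zify.
From Stdlib Require Import FunctionalExtensionality.
Set Implicit Arguments. Unset Strict Implicit. Unset Printing Implicit Defensive.
Import Order.TTheory GRing.Theory Num.Theory.

(* In a block graph, a vertex with two non-adjacent neighbours is a
   cut-vertex, so all but k vertices are simplicial.  Enumerate the at most
   m^k placements of the non-simplicial jobs.  For each of them the other jobs
   form disjoint cliques of twins and are placed by a flow argument: starting
   from the enumerated jobs, repeatedly choose the machine i minimising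
   (load i + 1) / s_i and search backwards from i, where y -> x when some
   simplicial job on y has no neighbour on x, for a path from the pool of
   unscheduled jobs.  If there is one, augment along it: only the load of i
   grows.  Otherwise no job can ever enter the visited machines, which are
   declared dead.  By a counting argument on twins, a schedule that extends the
   placement and keeps every live load at most its current value would leave
   no job unscheduled; hence each augmentation stays below the optimum.  After
   n + m rounds of cost O(mn) all machines are dead, which gives O(m^2 n^2) per
   placement, even without the logarithmic factor.

   The RAM program is obtained by compiling a small loop language whose running
   time has a syntactic bound, since every loop is limited by a constant
   variable. *)

(** * Structured code for the RAM *)

(** The counting argument compares the current placement with a schedule [tau] that extends the
    enumerated one. A live job that [tau] sends to a dead machine is barred there by a twin, since
    an enumerated blocker would conflict in [tau] as well; so dead machines already hold at least as
    many jobs as under [tau]. Deadness is never revised: later moves join live machines and the pool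
    only, and leave every blocker of a dead machine in place. Two costs shape the program. Testing
    simpliciality by its definition is cubic in [n], too slow when [m] is small; in a block graph a
    single neighbour of each vertex is enough. And a search must decide in constant time whether a
    job may enter a machine, hence a table counting the neighbours of each job on each machine,
    updated at every move. On the machine side, the input fills the cells from 0 on, so it has to be
    moved away before any register exists, and without losing [m] or [n]. *)

Inductive cmd :=
| Ops of seq instr
| CSeq of cmd & cmd
| CIf of nat & cmd & cmd
| CWhile of nat & cmd.

Definition straight (i : instr) : bool :=
  match i with IJz _ _ | IJmp _ | IHalt => false | _ => true end.

Definition exec1 (M : memory) (i : instr) : memory := (exec_instr i 0 M).2.
Definition exec_ops (l : seq instr) (M : memory) : memory := foldl exec1 M l.

Fixpoint size_cmd (c : cmd) : nat :=
  match c with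
  | Ops l => size l
  | CSeq c1 c2 => size_cmd c1 + size_cmd c2
  | CIf _ c1 c2 => (size_cmd c1 + size_cmd c2).+2
  | CWhile _ c => (size_cmd c).+2
  end.

(* [p] is the absolute address of the first instruction, needed by jumps. *)
Fixpoint assemble (p : nat) (c : cmd) : seq instr :=
  match c with
  | Ops l => l
  | CSeq c1 c2 => assemble p c1 ++ assemble (p + size_cmd c1) c2
  | CIf r c1 c2 =>
      let pe := (p + size_cmd c1).+2 in
      IJz r pe :: assemble p.+1 c1
        ++ IJmp (pe + size_cmd c2) :: assemble pe c2
  | CWhile r c =>
      IJz r (p + size_cmd c).+2 :: assemble p.+1 c ++ [:: IJmp p]
  end.

(** The time counts executed instructions exactly: a conditional taken costs its [IJz] and the
    closing [IJmp], one not taken only the [IJz], and a loop round an [IJz] and the [IJmp] back. *)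
Inductive ev : cmd -> memory -> nat -> memory -> Prop :=
| EvOps l M : all straight l -> ev (Ops l) M (size l) (exec_ops l M)
| EvSeq c1 c2 M M1 M2 t1 t2 :
    ev c1 M t1 M1 -> ev c2 M1 t2 M2 -> ev (CSeq c1 c2) M (t1 + t2) M2
| EvIfT r c1 c2 M M1 t : M r != 0 ->
    ev c1 M t M1 -> ev (CIf r c1 c2) M t.+2 M1
| EvIfF r c1 c2 M M1 t : M r = 0 ->
    ev c2 M t M1 -> ev (CIf r c1 c2) M t.+1 M1
| EvWhile0 r c M : M r = 0 -> ev (CWhile r c) M 1 M
| EvWhileS r c M M1 M2 t1 t2 : M r != 0 ->
    ev c M t1 M1 -> ev (CWhile r c) M1 t2 M2 ->
    ev (CWhile r c) M (t1 + t2).+2 M2.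

Lemma size_assemble p c : size (assemble p c) = size_cmd c.
Proof.
elim: c p => [l|c1 IH1 c2 IH2|r c1 IH1 c2 IH2|r c IH] p //=.
- by rewrite size_cat IH1 IH2.
- by rewrite size_cat /= IH1 IH2; lia.
- by rewrite size_cat /= IH; lia.
Qed.

Lemma run_step P f p M i : nth IHalt P p = i -> i <> IHalt ->
  run P f.+1 p M = run P f (exec_instr i p M).1 (exec_instr i p M).2.
Proof. by move=> /= ->; case: i => //= r l _; case: ifP. Qed.

Lemma run_fuel P f g p M M' : run P f p M = Some M' -> f <= g ->
  run P g p M = Some M'.
Proof.
elim: f g p M => [|f IH] [|g] p M //=; case: (nth IHalt P p) => //= *;
  by apply: IH => //; case: ifP.
Qed.

Lemma run_halt P f p M : nth IHalt P p = IHalt -> run P f p M = Some M.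
Proof. by case: f => [|f] /= ->. Qed.

Arguments run : simpl never.

(** Surrounding code and leftover fuel are arbitrary, so that the induction hypotheses apply to a
    subcommand in place; jump targets fit because [pre] is all the code before [c]. *)
Lemma run_assemble c M t M' : ev c M t M' -> forall pre post f,
  run (pre ++ assemble (size pre) c ++ post) (t + f) (size pre) M =
  run (pre ++ assemble (size pre) c ++ post) f (size pre + size_cmd c) M'.
Proof.
elim=> {c M t M'}.
- move=> l M; elim: l M => [|i l IH] M /=; first by move=> _ pre post f; rewrite addn0.
  case/andP=> si sl pre post f.
  rewrite addSn (@run_step _ _ _ _ i); last 2 first.
  + by rewrite nth_cat ltnn subnn.
  + by case: (i) si.
  (* The executed instruction is shifted into [pre], so the hypothesis resumes at the next
     address. *)
  have := IH (exec1 M i) sl (rcons pre i) post f.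
  rewrite size_rcons cat_rcons addSnnS /= => <-.
  by congr run; case: (i) si.
- move=> c1 c2 M M1 M2 t1 t2 _ IH1 _ IH2 pre post f /=.
  rewrite -addnA -catA IH1 addnA.
  have := IH2 (pre ++ assemble (size pre) c1) post f.
  by rewrite size_cat size_assemble -catA.
- move=> r c1 c2 M M1 t Mr _ IH pre post f /=.
  rewrite -!catA !addSn (@run_step _ _ _ _ (IJz r (size pre + size_cmd c1).+2)) //;
    last by rewrite nth_cat ltnn subnn.
  rewrite /= (negbTE Mr).
  set jz := IJz _ _; set jmp := IJmp _.
  have := IH (rcons pre jz)
    (jmp :: assemble (size pre + size_cmd c1).+2 c2 ++ post) f.+1.
  rewrite size_rcons !cat_rcons => E; rewrite -[(t + f).+1]addnS E.
  rewrite (@run_step _ _ _ _ jmp) //=; first by congr run; lia.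
  rewrite nth_cat ifF; last by lia.
  have -> : (size pre).+1 + size_cmd c1 - size pre = (size_cmd c1).+1 by lia.
  by rewrite /= nth_cat size_assemble ltnn subnn.
- move=> r c1 c2 M M1 t Mr _ IH pre post f /=.
  rewrite -!catA !addSn (@run_step _ _ _ _ (IJz r (size pre + size_cmd c1).+2)) //;
    last by rewrite nth_cat ltnn subnn.
  rewrite /= Mr eqxx.
  set jz := IJz _ _; set jmp := IJmp _.
  have := IH (pre ++ jz :: assemble (size pre).+1 c1 ++ [:: jmp]) post f.
  have -> : size (pre ++ jz :: assemble (size pre).+1 c1 ++ [:: jmp]) =
    (size pre + size_cmd c1).+2.
    by rewrite size_cat /= size_cat size_assemble /=; lia.
  rewrite -!catA /= -!catA /= => ->; congr run; lia.
- move=> r c M Mr pre post f /=.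
  rewrite add1n (@run_step _ _ _ _ (IJz r (size pre + size_cmd c).+2)) //;
    last by rewrite nth_cat ltnn subnn.
  by rewrite /= Mr eqxx; congr run; lia.
- move=> r c M M1 M2 t1 t2 Mr _ IH1 _ IH2 pre post f.
  have := IH2 pre post f => <- /=.
  rewrite -!catA !addSn (@run_step _ _ _ _ (IJz r (size pre + size_cmd c).+2)) //;
    last by rewrite nth_cat ltnn subnn.
  rewrite /= (negbTE Mr).
  set jz := IJz _ _.
  have := IH1 (rcons pre jz) (IJmp (size pre) :: post) (t2 + f).+1.
  rewrite size_rcons !cat_rcons /= => E.
  rewrite -addnA -addnS E (@run_step _ _ _ _ (IJmp (size pre))) //.
  rewrite nth_cat ifF; last by lia.
  have -> : (size pre).+1 + size_cmd c - size pre = (size_cmd c).+1 by lia.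
  by rewrite /= nth_cat size_assemble ltnn subnn.
Qed.

Lemma run_cmd c M t M' T : ev c M t M' -> t <= T ->
  run (assemble 0 c) T 0 M = Some M'.
Proof.
move=> evc; apply: run_fuel.
have := run_assemble evc [::] [::] 0; rewrite cats0 addn0 /= => ->.
by apply: run_halt; rewrite nth_default // size_assemble.
Qed.

(** A total-correctness triple; the time is only bounded, so that branches of different length share
    one [T]. *)
Definition evb (c : cmd) (M : memory) (T : nat) (Q : memory -> Prop) : Prop :=
  exists t M', [/\ ev c M t M', t <= T & Q M'].

Lemma evb_weaken c M T T' (Q Q' : memory -> Prop) :
  evb c M T Q -> T <= T' -> (forall M', Q M' -> Q' M') -> evb c M T' Q'.
Proof.
move=> [t [M' [H1 H2 H3]]] lT QQ; exists t, M'; split=> //; last exact: QQ.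
exact: leq_trans lT.
Qed.

Lemma evb_ops l M T (Q : memory -> Prop) :
  all straight l -> size l <= T -> Q (exec_ops l M) -> evb (Ops l) M T Q.
Proof. by move=> sl lT QM; exists (size l), (exec_ops l M); split=> //; constructor. Qed.

Lemma evb_seq c1 c2 M T1 T2 (Q1 Q2 : memory -> Prop) :
  evb c1 M T1 Q1 -> (forall M', Q1 M' -> evb c2 M' T2 Q2) ->
  evb (CSeq c1 c2) M (T1 + T2) Q2.
Proof.
move=> [t1 [M1 [E1 l1 q1]]] /(_ _ q1) [t2 [M2 [E2 l2 q2]]].
exists (t1 + t2), M2; split=> //; last by lia.
exact: EvSeq E1 E2.
Qed.

(* [r] counts down to the exit of the loop; [I k] holds with [k] rounds to go. *)
Lemma evb_while r c T (I : nat -> memory -> Prop) :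
  (forall k M, I k M -> M r = k) ->
  (forall k M, I k.+1 M -> evb c M T (I k)) ->
  forall k M, I k M -> evb (CWhile r c) M (k * T.+2).+1 (I 0).
Proof.
move=> Ir Ic; elim=> [|k IH] M IM.
  by exists 1, M; split=> //; apply: EvWhile0; apply: Ir.
have [t1 [M1 [E1 l1 q1]]] := Ic _ _ IM.
have [t2 [M2 [E2 l2 q2]]] := IH _ q1.
exists (t1 + t2).+2, M2; split=> //; last by rewrite mulSn; lia.
by apply: EvWhileS E1 E2; rewrite (Ir _ _ IM).
Qed.

(** * A loop language with variables and infinite two-dimensional arrays *)

Inductive expr :=
| Num of nat
| Var of nat
| EAdd of expr & expr
| ESub of expr & expr
| EMul of expr & expr
| EDiv of expr & expr
| Rd of nat & expr & expr.

Inductive prog :=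
| Set_ of nat & expr
| Put of nat & expr & expr & expr
| Seq of prog & prog
| If of expr & prog & prog
| For of nat & nat & prog.

Record st := St { rg : nat -> nat; ar : nat -> nat -> nat -> nat }.

Definition setr (s : st) v x := St (upd (rg s) v x) (ar s).
Definition upd2 (f : nat -> nat -> nat) x y z : nat -> nat -> nat :=
  fun x' y' => if (x' == x) && (y' == y) then z else f x' y'.
Definition seta (s : st) q x y z :=
  St (rg s) (fun q' => if q' == q then upd2 (ar s q) x y z else ar s q').

Fixpoint eval (e : expr) (s : st) : nat :=
  match e with
  | Num c => c
  | Var v => rg s v
  | EAdd a b => eval a s + eval b s
  | ESub a b => eval a s - eval b s
  | EMul a b => eval a s * eval b s
  | EDiv a b => eval a s %/ eval b s
  | Rd q a b => ar s q (eval a s) (eval b s)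
  end.

(* [For v lim c] runs [c] for [v = 0, ..., lim - 1], with [lim] a variable
   read on entry. *)
Fixpoint sem (c : prog) (s : st) : st :=
  match c with
  | Set_ v e => setr s v (eval e s)
  | Put q a b e => seta s q (eval a s) (eval b s) (eval e s)
  | Seq c1 c2 => sem c2 (sem c1 s)
  | If e c1 c2 => if eval e s == 0 then sem c2 s else sem c1 s
  | For v lim c =>
      iter (rg s lim) (fun s => let s' := sem c s in setr s' v (rg s' v).+1)
        (setr s v 0)
  end.

(* Injective, as [(x + y)^2 <= pair2 x y < (x + y + 1)^2]. *)
Definition pair2 x y := (x + y) * (x + y) + x.
Definition cell q x y := pair2 q (pair2 x y).

Lemma pair2_inj x y x' y' : pair2 x y = pair2 x' y' -> x = x' /\ y = y'.
Proof.
rewrite /pair2 => E.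
suff E1 : x + y = x' + y' by rewrite E1 in E; lia.
have aux a b a' b' : (a + b) * (a + b) + a = (a' + b') * (a' + b') + a' ->
    ~ a + b < a' + b'.
  move=> Eab lt.
  have : (a + b).+1 * (a + b).+1 <= (a' + b') * (a' + b') by rewrite leq_mul.
  by rewrite mulSn mulnS; lia.
by case: (ltngtP (x + y) (x' + y')) => // lt; case: (aux _ _ _ _ _ lt).
Qed.

Lemma cell_inj q x y q' x' y' :
  cell q x y = cell q' x' y' -> [/\ q = q', x = x' & y = y'].
Proof. by case/pair2_inj => -> /pair2_inj [-> ->]. Qed.

(** * Compilation of the loop language *)

(* Cell 0 holds the base address of the arrays, cell [v.+1] the variable [v],
   the cells above [nv] temporaries; arrays live above cell [nr]. *)
Definition nv := 40.
Definition nr := 64.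

(* Turns cells [d] and [d.+1], holding [x] and [y], into the address of entry
   [(x, y)] of array [q]. *)
Definition addr_code q d : seq instr :=
  [:: IAdd d.+1 d d.+1; IMul d.+1 d.+1 d.+1; IAdd d d.+1 d;
      IConst d.+1 q; IAdd d d d.+1; IMul d d d; IAdd d d d.+1;
      IAdd d d 0; IConst d.+1 1; IAdd d d d.+1].

(** Stack discipline: the value ends in cell [d], and no cell below [d] is touched. *)
Fixpoint tr_e (d : nat) (e : expr) : seq instr :=
  match e with
  | Num c => [:: IConst d c]
  | Var v => [:: IConst d 0; IAdd d d v.+1]
  | EAdd a b => tr_e d a ++ tr_e d.+1 b ++ [:: IAdd d d d.+1]
  | ESub a b => tr_e d a ++ tr_e d.+1 b ++ [:: ISub d d d.+1]
  | EMul a b => tr_e d a ++ tr_e d.+1 b ++ [:: IMul d d d.+1]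
  | EDiv a b => tr_e d a ++ tr_e d.+1 b ++ [:: IDiv d d d.+1]
  | Rd q a b => tr_e d a ++ tr_e d.+1 b ++ addr_code q d ++ [:: ILoad d d]
  end.

Fixpoint wf_e (d : nat) (e : expr) : bool :=
  match e with
  | Num _ => d.+1 < nr
  | Var v => (v < nv) && (d.+1 < nr)
  | EAdd a b | ESub a b | EMul a b | EDiv a b | Rd _ a b =>
      wf_e d a && wf_e d.+1 b
  end.

(** A loop keeps its own countdown in the temporary [d], invisible to the source program; the number
    of rounds is thus fixed on entry, as [sem] prescribes. *)
Fixpoint tr (d : nat) (c : prog) : cmd :=
  match c with
  | Set_ v e => Ops (tr_e d e ++ [:: IConst d.+1 0; IAdd v.+1 d d.+1])
  | Put q a b e =>
      Ops (tr_e d a ++ tr_e d.+1 b ++ tr_e d.+2 e ++ addr_code q d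
             ++ [:: IStore d d.+2])
  | Seq c1 c2 => CSeq (tr d c1) (tr d c2)
  | If e c1 c2 => CSeq (Ops (tr_e d e)) (CIf d (tr d c1) (tr d c2))
  | For v lim c =>
      CSeq (Ops [:: IConst d 0; IAdd d d lim.+1; IConst v.+1 0])
        (CWhile d (CSeq (tr d.+1 c)
          (Ops [:: IConst d.+1 1; IAdd v.+1 v.+1 d.+1; ISub d d d.+1])))
  end.

Fixpoint wf (d : nat) (c : prog) : bool :=
  match c with
  | Set_ v e => [&& v < nv, d.+1 < nr & wf_e d e]
  | Put q a b e => [&& wf_e d a, wf_e d.+1 b & wf_e d.+2 e]
  | Seq c1 c2 => wf d c1 && wf d c2
  | If e c1 c2 => [&& wf_e d e, wf d c1 & wf d c2]
  | For v lim c => [&& v < nv, lim < nv, d.+2 < nr & wf d.+1 c]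
  end.

Fixpoint wvars (c : prog) : seq nat :=
  match c with
  | Set_ v _ => [:: v]
  | Put _ _ _ _ => [::]
  | Seq c1 c2 | If _ c1 c2 => wvars c1 ++ wvars c2
  | For v _ c => v :: wvars c
  end.

Fixpoint warrs (c : prog) : seq nat :=
  match c with
  | Set_ _ _ => [::]
  | Put q _ _ _ => [:: q]
  | Seq c1 c2 | If _ c1 c2 => warrs c1 ++ warrs c2
  | For _ _ c => warrs c
  end.

Fixpoint limits (c : prog) : seq nat :=
  match c with
  | Set_ _ _ | Put _ _ _ _ => [::]
  | Seq c1 c2 | If _ c1 c2 => limits c1 ++ limits c2
  | For _ lim c => lim :: limits c
  end.

(* Both branches of a conditional are counted; [rho] gives the loop limits,
   which must not change during the run. *)
Fixpoint tbound (rho : nat -> nat) (d : nat) (c : prog) : nat :=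
  match c with
  | Set_ _ e => size (tr_e d e) + 2
  | Put _ a b e =>
      size (tr_e d a) + size (tr_e d.+1 b) + size (tr_e d.+2 e) + 11
  | Seq c1 c2 => tbound rho d c1 + tbound rho d c2
  | If e c1 c2 => size (tr_e d e) + tbound rho d c1 + tbound rho d c2 + 2
  | For _ lim c => rho lim * (tbound rho d.+1 c + 5) + 4
  end.

Definition same (W A : seq nat) (s s' : st) : Prop :=
  (forall r, r \notin W -> rg s' r = rg s r) /\
  (forall q, q \notin A -> ar s' q = ar s q).

Lemma same_trans W A s1 s2 s3 : same W A s1 s2 -> same W A s2 s3 ->
  same W A s1 s3.
Proof. by move=> [r12 a12] [r23 a23]; split=> x xn; rewrite ?r23 ?a23 ?r12 ?a12. Qed.

Lemma same_sub W W' A A' s s' : {subset W <= W'} -> {subset A <= A'} ->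
  same W A s s' -> same W' A' s s'.
Proof. by move=> sW sA [r a]; split=> x xn; [apply: r|apply: a]; apply: contra xn; [exact: sW|exact: sA]. Qed.

Lemma same_setr W A s s' v x : v \in W -> same W A s s' ->
  same W A s (setr s' v x).
Proof.
move=> vW [r a]; split=> // u uW; rewrite /= /upd.
by case: eqP uW => [->|_]; [rewrite vW|exact: r].
Qed.

Lemma semP c s : same (wvars c) (warrs c) s (sem c s).
Proof.
elim: c s => [v e|q a b e|c1 IH1 c2 IH2|e c1 IH1 c2 IH2|v lim c IH] s /=.
- by apply: same_setr; rewrite ?inE.
- by split=> //= q'; rewrite inE => /negbTE ->.
- apply: same_trans (same_sub _ _ (IH1 s)) (same_sub _ _ (IH2 _));
    by move=> x; rewrite mem_cat => ->; rewrite ?orbT.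
- case: ifP => _; [move: (IH2 s)|move: (IH1 s)]; apply: same_sub;
    by move=> x; rewrite mem_cat => ->; rewrite ?orbT.
- elim: (rg s lim) => [|k IHk] /=; first by apply: same_setr; rewrite ?inE ?eqxx.
  apply: same_setr; first by rewrite inE eqxx.
  apply: same_trans IHk (same_sub _ _ (IH _)) => // x xW.
  by rewrite inE xW orbT.
Qed.

(** Invariant rule in which the framing comes for free: at each round, everything that the body does
    not write still has its value from the entry of the loop. *)
Lemma for_ind (I : nat -> st -> Prop) v lim c s :
  v \notin wvars c ->
  I 0 (setr s v 0) ->
  (forall i s', i < rg s lim -> rg s' v = i ->
     same (v :: wvars c) (warrs c) s s' -> I i s' ->
     I i.+1 (setr (sem c s') v i.+1)) ->
  I (rg s lim) (sem (For v lim c) s).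
Proof.
move=> vc I0 IS /=; set k := rg s lim.
set F := fun _ => _; suff: forall i, i <= k ->
  [/\ rg (iter i F (setr s v 0)) v = i,
      same (v :: wvars c) (warrs c) s (iter i F (setr s v 0)) &
      I i (iter i F (setr s v 0))] by move=> /(_ k (leqnn k)) [].
elim=> [|i IH] ik.
  by split=> //=; [rewrite /upd eqxx | apply: same_setr; rewrite ?inE ?eqxx].
have [vi si Ii] := IH (ltnW ik); rewrite iterS; set s' := iter i F _ in vi si Ii *.
have E : rg (sem c s') v = i by rewrite (proj1 (semP c s')).
rewrite /F E; split; first by rewrite /= /upd eqxx.
  apply: same_setr; first by rewrite inE eqxx.
  apply: same_trans si (same_sub _ _ (semP c s')) => // x xW.
  by rewrite inE xW orbT.
exact: IS.
Qed.

Definition rep (base : nat) (s : st) (M : memory) : Prop :=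
  [/\ M 0 = base, nr <= base, (forall v, v < nv -> M v.+1 = rg s v) &
      forall q x y, M (base + cell q x y).+1 = ar s q x y].

Lemma exec_cat l1 l2 M : exec_ops (l1 ++ l2) M = exec_ops l2 (exec_ops l1 M).
Proof. exact: foldl_cat. Qed.

Definition tmp_eq (d : nat) (M M' : memory) : Prop :=
  forall a, (a < d) || (nr <= a) -> M' a = M a.

Lemma tmp_rep base s d M M' : nv < d -> rep base s M -> tmp_eq d M M' ->
  rep base s M'.
Proof.
move=> nvd [M0 lb Mv Ma] E.
split=> // [|v lv|q x y]; rewrite E //.
- by rewrite (leq_ltn_trans _ nvd).
- by rewrite Mv.
- by rewrite (leq_ltn_trans lv).
- by rewrite (leq_trans lb) ?orbT // -addnS leq_addr.
Qed.

Lemma tmp_trans d d' M1 M2 M3 : d <= d' -> tmp_eq d M1 M2 -> tmp_eq d' M2 M3 ->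
  tmp_eq d M1 M3.
Proof.
move=> dd E1 E2 a Ha; rewrite E2 ?E1 //.
by case/orP: Ha => [/leq_trans-> //|->]; rewrite orbT.
Qed.

Lemma tmp_upd d a v M : d <= a < nr -> tmp_eq d M (upd M a v).
Proof. by move=> da b Hb; rewrite /upd; case: eqP => // E; lia. Qed.

Ltac upd_simpl := rewrite /= /exec1 /= /upd ?eqxx;
  repeat (match goal with |- context [?a == ?b] =>
    (have -> : (a == b) = true by apply/eqP; lia) ||
    (have -> : (a == b) = false by apply/eqP; lia) end; rewrite /=).

(** The last clause protects cell [d.+2], in which [Put] keeps the value to be stored. *)
Lemma addr_codeP base q d M : M 0 = base -> 0 < d -> d.+1 < nr ->
  let M' := exec_ops (addr_code q d) M in
  tmp_eq d M M' /\ M' d = (base + cell q (M d) (M d.+1)).+1 /\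
  forall a, d.+1 < a -> M' a = M a.
Proof.
move=> M0 d0 dn M'; split; last split.
- by move=> a Ha; rewrite /M' /addr_code; upd_simpl.
- rewrite /M' /addr_code; upd_simpl.
  by rewrite M0 /cell /pair2; lia.
- by move=> a Ha; rewrite /M' /addr_code; upd_simpl.
Qed.

Lemma wf_e_lt d e : wf_e d e -> d < nr.
Proof.
by elim: e d => [c|v|a IHa b _|a IHa b _|a IHa b _|a IHa b _|q a IHa b _] d /=;
  try (by case/andP=> /IHa); move: nr => ?; lia.
Qed.

Lemma tr_eP base s e d M : nv < d -> wf_e d e -> rep base s M ->
  [/\ all straight (tr_e d e), tmp_eq d M (exec_ops (tr_e d e) M) &
      exec_ops (tr_e d e) M d = eval e s].
Proof.
have dtmp a b d' M' : nv < d' -> rep base s M' -> tmp_eq d' M' (exec_ops (tr_e d' a) M') ->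
   exec_ops (tr_e d' a) M' d' = eval a s ->
   tmp_eq d'.+1 (exec_ops (tr_e d' a) M') (exec_ops (tr_e d'.+1 b) (exec_ops (tr_e d' a) M')) ->
   tmp_eq d' M' (exec_ops (tr_e d'.+1 b) (exec_ops (tr_e d' a) M')) /\
   exec_ops (tr_e d'.+1 b) (exec_ops (tr_e d' a) M') d' = eval a s.
  move=> nvd' R E1 V1 E2; split; first by apply: tmp_trans E1 E2.
  by rewrite E2 // ltnS leqnn.
(* One proof for the four arithmetic operators, parametrised by the final instruction. *)
have bin op (f : nat -> nat -> nat) a b :
   (forall d M, exec1 M (op d) = upd M d (f (M d) (M d.+1))) ->
   (forall d, straight (op d)) ->
   (forall d M, nv < d -> wf_e d a -> rep base s M ->
     [/\ all straight (tr_e d a), tmp_eq d M (exec_ops (tr_e d a) M) &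
      exec_ops (tr_e d a) M d = eval a s]) ->
   (forall d M, nv < d -> wf_e d b -> rep base s M ->
     [/\ all straight (tr_e d b), tmp_eq d M (exec_ops (tr_e d b) M) &
      exec_ops (tr_e d b) M d = eval b s]) ->
   forall d M, nv < d -> wf_e d a && wf_e d.+1 b -> rep base s M ->
   [/\ all straight (tr_e d a ++ tr_e d.+1 b ++ [:: op d]),
     tmp_eq d M (exec_ops (tr_e d a ++ tr_e d.+1 b ++ [:: op d]) M) &
     exec_ops (tr_e d a ++ tr_e d.+1 b ++ [:: op d]) M d = f (eval a s) (eval b s)].
  move=> opE opS IHa IHb {}d {}M nvd /andP[wa wb] R.
  have [sa ea va] := IHa _ _ nvd wa R.
  have R1 := tmp_rep nvd R ea.
  have [sb eb vb] := IHb _ _ (leqW nvd) wb R1.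
  have [e2 v2] := dtmp a b _ _ nvd R ea va eb.
  have dn := wf_e_lt wa.
  rewrite !all_cat !exec_cat sa sb /= opS opE vb v2; split=> //.
    by apply: tmp_trans (leqnn d) e2 _; apply: tmp_upd; rewrite leqnn.
  by rewrite /upd eqxx.
elim: e d M => [c|v|a IHa b IHb|a IHa b IHb|a IHa b IHb|a IHa b IHb|q a IHa b IHb] d M nvd /=.
- move=> dn R; split=> //; last by upd_simpl.
  by apply: tmp_upd; lia.
- case/andP=> vn dn R; split=> //.
    by move=> x Hx; upd_simpl.
  by case: R => _ _ + _ => /(_ v vn); upd_simpl.
- exact: (bin (fun d => IAdd d d d.+1) addn).
- exact: (bin (fun d => ISub d d d.+1) subn).
- exact: (bin (fun d => IMul d d d.+1) muln).
- exact: (bin (fun d => IDiv d d d.+1) divn).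
case/andP=> wa wb R.
have [sa ea va] := IHa _ _ nvd wa R.
have R1 := tmp_rep nvd R ea.
have [sb eb vb] := IHb _ _ (leqW nvd) wb R1.
have [e2 v2] := dtmp a b _ _ nvd R ea va eb.
have dn := wf_e_lt wb.
have R2 := tmp_rep nvd R e2.
rewrite -[IAdd d.+1 d d.+1 :: _]/(addr_code q d ++ [:: ILoad d d]).
rewrite !all_cat !exec_cat sa sb; split=> //.
all: set M2 := exec_ops (tr_e d.+1 b) _ in eb vb e2 v2 R2 *.
all: have [e3 [v3 _]] := addr_codeP q (let: And4 x _ _ _ := R2 in x) (leq_ltn_trans (leq0n _) nvd) dn.
all: set M3 := exec_ops (addr_code q d) M2 in e3 v3 *.
  apply: tmp_trans (leqnn d) e2 _; apply: tmp_trans (leqnn d) e3 _.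
  by apply: tmp_upd; rewrite leqnn ltnW.
rewrite /= /exec1 /= /upd eqxx v3 v2 vb.
by case: (tmp_rep nvd R2 e3) => _ _ _ ->.
Qed.

Lemma rep_upd_var base s M v x : v < nv -> rep base s M ->
  rep base (setr s v x) (upd M v.+1 x).
Proof.
move=> vn [M0 lb Mv Ma]; split=> // [u un|q x' y'].
  by rewrite /= /upd eqSS; case: eqP => // _; rewrite Mv.
by rewrite /upd ifF ?Ma //; move: vn lb; rewrite /nv /nr; lia.
Qed.

Lemma rep_upd_arr base s M q x y z : rep base s M ->
  rep base (seta s q x y z) (upd M (base + cell q x y).+1 z).
Proof.
move=> [M0 lb Mv Ma]; split=> //.
- by move=> u un; rewrite /upd ifF ?Mv //; move: un lb; rewrite /nv /nr; lia.
- move=> q' x' y'; rewrite /= /upd /upd2 eqSS eqn_add2l.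
  case: (altP (q' =P q)) => [->|nq].
    case: (altP (x' =P x)) => [->|nx] /=.
      case: (altP (y' =P y)) => [->|ny]; first by rewrite eqxx.
      by rewrite ifF //; apply/negP => /eqP /cell_inj [_ _ /eqP]; apply/negP.
    by rewrite ifF //; apply/negP => /eqP /cell_inj [_ /eqP]; rewrite (negbTE nx).
  by rewrite ifF //; apply/negP => /eqP /cell_inj [/eqP]; rewrite (negbTE nq).
Qed.

(** As [W] covers all variables written by the whole program, the limits keep their values, and a
    bound computed from [rho] beforehand stays valid throughout. *)
Definition limits_ok (rho : nat -> nat) (s : st) (c : prog) (W : seq nat) :=
  {in limits c, forall l, rho l = rg s l /\ l \notin W}.

(** The cells strictly between [nv] and [d] hold the countdowns of the enclosing loops, hence the
    second half of the postcondition. *)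
Theorem trP rho base c d s M (W : seq nat) : nv < d -> wf d c ->
  rep base s M -> {subset wvars c <= W} -> limits_ok rho s c W ->
  evb (tr d c) M (tbound rho d c) (fun M' =>
    rep base (sem c s) M' /\ forall a, nv < a < d -> M' a = M a).
Proof.
elim: c d s M => [v e|q a b e|c1 IH1 c2 IH2|e c1 IH1 c2 IH2|v lim c IH] d s M nvd /=.
- case/and3P=> vn dn we R _ _.
  have [se te ve] := tr_eP nvd we R.
  apply: evb_ops; first by rewrite all_cat se.
    by rewrite size_cat.
  rewrite exec_cat; set M1 := exec_ops (tr_e d e) M in te ve *.
  have -> : exec_ops [:: IConst d.+1 0; IAdd v.+1 d d.+1] M1 =
      upd (upd M1 d.+1 0) v.+1 (eval e s).
    by rewrite /= /exec1 /= -ve; congr upd; upd_simpl; rewrite addn0.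
  split.
    apply: rep_upd_var => //; apply: (@tmp_rep _ _ d M1) => //.
      exact: tmp_rep te.
    by apply: tmp_upd; lia.
  move=> a ad; rewrite /upd !ifF; [|lia..].
  by apply: te; lia.
- case/and3P=> wa wb we R _ _.
  have [sa ta va] := tr_eP nvd wa R.
  have Ra := tmp_rep nvd R ta.
  have [sb tb vb] := tr_eP (leqW nvd) wb Ra.
  have Rb := tmp_rep (leqW nvd) Ra tb.
  have [se te ve] := tr_eP (leqW (leqW nvd)) we Rb.
  have Re := tmp_rep (leqW (leqW nvd)) Rb te.
  have dn := wf_e_lt we.
  rewrite -[IAdd d.+1 d d.+1 :: _]/(addr_code q d ++ [:: IStore d d.+2]).
  apply: evb_ops; first by rewrite !all_cat sa sb se.
    by rewrite !size_cat /=; lia.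
  rewrite !exec_cat; set M1 := exec_ops (tr_e d a) M in ta va Ra tb vb Rb te ve Re *.
  set M2 := exec_ops (tr_e d.+1 b) M1 in tb vb Rb te ve Re *.
  set M3 := exec_ops (tr_e d.+2 e) M2 in te ve Re *.
  have [t4 [v4 u4]] := addr_codeP q (let: And4 x _ _ _ := Re in x)
     (leq_ltn_trans (leq0n _) nvd) (ltnW dn).
  set M4 := exec_ops (addr_code q d) M3 in t4 v4 u4 *.
  have v1 : M3 d = eval a s by rewrite te ?tb ?va //; lia.
  have v2 : M3 d.+1 = eval b s by rewrite te ?vb //; lia.
  rewrite /= /exec1 /= v4 u4 // ve v1 v2; split.
    by apply: rep_upd_arr; apply: tmp_rep t4.
  move=> c cd; rewrite /upd ifF; last by case: R => _; lia.
  by rewrite t4 ?te ?tb ?ta //; lia.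
- case/andP=> w1 w2 R sW lim_ok.
  have sW1 : {subset wvars c1 <= W} by move=> x xc; apply: sW; rewrite mem_cat xc.
  have sW2 : {subset wvars c2 <= W} by move=> x xc; apply: sW; rewrite mem_cat xc orbT.
  have l1 : limits_ok rho s c1 W by move=> l lc; apply: lim_ok; rewrite mem_cat lc.
  have l2 : limits_ok rho (sem c1 s) c2 W.
    move=> l lc; have [|-> lW] := lim_ok l; first by rewrite mem_cat lc orbT.
    split=> //; rewrite (proj1 (semP c1 s)) //; exact: contra (@sW1 l) lW.
  apply: evb_seq (IH1 d s M nvd w1 R sW1 l1) _ => M1 [R1 E1].
  apply: evb_weaken (IH2 d _ M1 nvd w2 R1 sW2 l2) (leqnn _) _ => M2 [R2 E2].
  by split=> // a ad; rewrite E2 ?E1.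
- case/and3P=> we w1 w2 R sW lim_ok.
  have sW1 : {subset wvars c1 <= W} by move=> x xc; apply: sW; rewrite mem_cat xc.
  have sW2 : {subset wvars c2 <= W} by move=> x xc; apply: sW; rewrite mem_cat xc orbT.
  have l1 : limits_ok rho s c1 W by move=> l lc; apply: lim_ok; rewrite mem_cat lc.
  have l2 : limits_ok rho s c2 W by move=> l lc; apply: lim_ok; rewrite mem_cat lc orbT.
  have [se te ve] := tr_eP nvd we R.
  have Re := tmp_rep nvd R te.
  rewrite -!addnA; apply: (evb_seq (Q1 := fun M' => M' = exec_ops (tr_e d e) M)).
    exact: evb_ops.
  move=> _ ->; set M1 := exec_ops _ _ in te ve Re *.
  have post c M' : rep base (sem c s) M' /\ (forall a, nv < a < d -> M' a = M1 a) ->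
     rep base (sem c s) M' /\ (forall a, nv < a < d -> M' a = M a).
    by case=> RM' E; split=> // a ad; rewrite E ?te //; lia.
  case: eqP => [e0|/eqP e0].
    have [t [M' [E lt Q]]] := IH2 d s M1 nvd w2 Re sW2 l2.
    exists t.+1, M'; split; [|lia|exact: post].
    by apply: EvIfF => //; rewrite ve.
  have [t [M' [E lt Q]]] := IH1 d s M1 nvd w1 Re sW1 l1.
  exists t.+2, M'; split; [|lia|exact: post].
  by apply: EvIfT => //; rewrite ve.
- case/and4P=> vn ln dn wc R sW lim_ok.
  have [rhol limW] := lim_ok lim (mem_head _ _).
  have vW : v \in W by apply: sW; rewrite mem_head.
  have sWc : {subset wvars c <= W} by move=> x xc; apply: sW; rewrite inE xc orbT.
  set F := fun s0 => setr (sem c s0) v (rg (sem c s0) v).+1.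
  set L := rg s lim; pose S j := iter j F (setr s v 0).
  have Sok j : same W (warrs c) s (S j).
    elim: j => [|j IHj] /=; first exact: same_setr.
    apply: same_setr => //; apply: same_trans IHj _.
    by apply: same_sub (semP c _).
  (* With [k] rounds left on the countdown, the memory represents the state after [L - k] rounds. *)
  pose I k M' := [/\ k <= L, rep base (S (L - k)) M', M' d = k &
     forall a, nv < a < d -> M' a = M a].
  have I0 : I L (exec_ops [:: IConst d 0; IAdd d d lim.+1; IConst v.+1 0] M).
    have [M0 nb Mv Ma] := R.
    have -> : exec_ops [:: IConst d 0; IAdd d d lim.+1; IConst v.+1 0] M =
       upd (upd (upd M d 0) d L) v.+1 0.
      rewrite /= /exec1 /= /L -Mv //; congr upd; congr upd.
      by upd_simpl.
    rewrite /I subnn; split=> //.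
    + apply: rep_upd_var => //; apply: (@tmp_rep _ _ d M) => //.
      by apply: tmp_trans (leqnn d) _ _; apply: tmp_upd; lia.
    + by upd_simpl.
    + by move=> a ad; upd_simpl.
  have step k M' : I k.+1 M' -> evb (CSeq (tr d.+1 c)
      (Ops [:: IConst d.+1 1; IAdd v.+1 v.+1 d.+1; ISub d d d.+1])) M'
      (tbound rho d.+1 c + 3) (I k).
    case=> kL R' Md E'.
    apply: evb_seq (IH d.+1 _ M' (leqW nvd) wc R' sWc _) _.
      move=> l lc; have [|-> lW] := lim_ok l; first by rewrite inE lc orbT.
      by split=> //; rewrite (proj1 (Sok _)).
    move=> M1 [R1 E1]; apply: evb_ops => //.
    set s1 := sem c _ in R1.
    have [M0 nb Mv Ma] := R1.
    have -> : exec_ops [:: IConst d.+1 1; IAdd v.+1 v.+1 d.+1; ISub d d d.+1] M1 =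
       upd (upd (upd M1 d.+1 1) v.+1 (rg s1 v).+1) d k.
      rewrite /= /exec1 /= -Mv //.
      have -> : upd M1 d.+1 1 v.+1 + upd M1 d.+1 1 d.+1 = (M1 v.+1).+1.
        by upd_simpl; rewrite addn1.
      congr upd; upd_simpl; rewrite E1 ?Md; lia.
    split.
    + exact: ltnW.
    + have -> : L - k = (L - k.+1).+1 by lia.
      apply: (@tmp_rep _ _ d (upd (upd M1 d.+1 1) v.+1 (rg s1 v).+1)) => //; last first.
        by apply: tmp_upd; lia.
      apply: rep_upd_var => //; apply: (@tmp_rep _ _ d M1) => //.
      by apply: tmp_upd; lia.
    + by upd_simpl.
    + by move=> a ad; upd_simpl; rewrite E1 ?E' //; lia.
  have -> : rho lim * (tbound rho d.+1 c + 5) + 4 = 3 + (L * (tbound rho d.+1 c + 3).+2).+1.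
    by rewrite rhol /L; lia.
  apply: (evb_seq (Q1 := I L)); first exact: evb_ops.
  move=> M1 IM1.
  apply: evb_weaken (evb_while (I := I) _ step IM1) (leqnn _) _.
    by move=> k M' [].
  by move=> M' [_ + _ E]; rewrite subn0.
Qed.

(** * Placements and augmentation *)

Definition jload (n : nat) (a : 'I_n -> nat) (x : nat) : nat :=
  \sum_(j < n) (a j == x).

Definition reassign (n : nat) (a : 'I_n -> nat) (j : 'I_n) (x : nat) : 'I_n -> nat :=
  fun w => if w == j then x else a w.

Definition free (n : nat) (e : rel 'I_n) (a : 'I_n -> nat) (j : 'I_n) x : bool :=
  [forall w, e j w ==> (a w != x)].

Definition simplicial (n : nat) (e : rel 'I_n) (v : 'I_n) : Prop :=
  forall a b, e v a -> e v b -> a != b -> e a b.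

Section Placement.
Variables (m n : nat) (e : rel 'I_n) (F : pred 'I_n).
Hypotheses (e_sym : symmetric e) (e_irr : irreflexive e).
Hypothesis F_simp : forall v, ~~ F v -> simplicial e v.

(* A placement sends the jobs not yet scheduled to [m]; the jobs of [F] never
   move, and [D] is a set of machines that no job outside [D] can enter. *)
Definition proper_upto (a : 'I_n -> nat) : Prop :=
  forall j w, e j w -> a j = a w -> a j = m.

Definition entry_free (D : pred nat) (a : 'I_n -> nat) : Prop :=
  forall j x, ~~ F j -> D x -> ~~ D (a j) -> ~~ free e a j x.

Definition total_proper (tau : 'I_n -> nat) : Prop :=
  (forall j, tau j < m) /\ forall j w, e j w -> tau j != tau w.

(* Injection: [tau] maps [j] into [D]; if a twin of [j] lies outside [D] under
   [a], that twin is kept out of [tau j] by a twin placed on [tau j]. *)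
Lemma dead_count (D : pred nat) (a tau : 'I_n -> nat) :
  entry_free D a -> total_proper tau -> (forall j, F j -> a j = tau j) ->
  #|[set j | D (tau j)]| <= #|[set j | D (a j)]|.
Proof.
move=> Da [_ tau_p] Fa.
pose cl j y := (j == y) || e j y.
have cl_sym j y : cl j y = cl y j by rewrite /cl e_sym eq_sym.
(* Closed adjacency is transitive through a simplicial vertex: this is what makes the jobs outside
   [F] fall into cliques of twins. *)
have cl_tr j y z : ~~ F y -> cl j y -> cl y z -> cl j z.
  move=> Fy; rewrite /cl => /orP[/eqP->//|jy] /orP[/eqP<-|yz]; first by rewrite jy orbT.
  case: eqP => //= /eqP jz; apply: (F_simp Fy) => //; by rewrite e_sym.
pose inD j := [forall y, ~~ F y ==> cl j y ==> D (a y)].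
have inD_cl j y : ~~ F j -> ~~ F y -> cl j y -> inD j = inD y.
  move=> Fj Fy jy; apply/forallP/forallP => H z; apply/implyP => Fz; apply/implyP => cz.
    by move: (H z); rewrite Fz (cl_tr _ y).
  by move: (H z); rewrite Fz (cl_tr _ j) // cl_sym.
pose twin j := [pick y | [&& ~~ F y, cl j y & a y == tau j]].
pose f j := if F j || inD j then j else odflt j (twin j).
have fP j : D (tau j) -> ~~ F j -> ~~ inD j ->
    [/\ ~~ F (f j), cl j (f j) & a (f j) = tau j].
  move=> Dj Fj Ij; rewrite /f (negbTE Fj) (negbTE Ij) /= /twin.
  case: pickP => [y /and3P[-> -> /eqP->] //|none].
  case/forallPn: Ij => y; rewrite !negb_imply => /and3P[Fy jy Dy].
  case/forallPn: (Da y (tau j) Fy Dj Dy) => w; rewrite negb_imply negbK => /andP[yw /eqP aw].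
  have jw : cl j w by apply: cl_tr Fy jy _; rewrite /cl yw orbT.
  (* The blocker is not in [F]: otherwise [tau] would leave it on the machine [tau j], next to its
     neighbour [j]. *)
  case Fw: (F w); last by have := none w; rewrite Fw jw aw eqxx.
  move: jw; rewrite /cl => /orP[/eqP E|jw]; first by rewrite E Fw in Fj.
  by have := tau_p _ _ jw; rewrite -(Fa _ Fw) aw eqxx.
have fid j : F j || inD j -> f j = j by rewrite /f => ->.
have f_inj : {in [set j | D (tau j)] &, injective f}.
  (* Two jobs charged to the same twin are equal or adjacent, and [tau] puts both on the machine of
     that twin. *)
  have main j1 j2 : D (tau j1) -> D (tau j2) -> f j1 = f j2 ->
      ~~ (F j1 || inD j1) -> j1 = j2.
    move=> D1 D2 E; rewrite negb_or => /andP[F1 I1].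
    have [Ff1 c1 a1] := fP _ D1 F1 I1.
    have If1 : ~~ inD (f j1) by rewrite -(inD_cl j1).
    case b2: (F j2 || inD j2).
      by have := b2; rewrite -(fid _ b2) -E (negbTE Ff1) (negbTE If1).
    move: b2 => /norP[F2 I2]; have [Ff2 c2 a2] := fP _ D2 F2 I2.
    have /orP[/eqP//|j12] : cl j1 j2 by apply: cl_tr Ff1 c1 _; rewrite E cl_sym.
    by have := tau_p _ _ j12; rewrite -a1 -a2 E eqxx.
  move=> j1 j2; rewrite !inE => D1 D2 E.
  case b1: (F j1 || inD j1); last by apply: main; rewrite ?b1.
  case b2: (F j2 || inD j2); last by apply/esym; apply: main; rewrite ?b2.
  by rewrite -(fid _ b1) -(fid _ b2).
rewrite -(card_in_imset f_inj); apply: subset_leq_card.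
apply/subsetP => _ /imsetP[j + ->]; rewrite !inE => Dj.
case b: (F j || inD j).
  rewrite fid //; case/orP: b => [Fj|/forallP/(_ j)]; first by rewrite Fa.
  rewrite /cl eqxx /=; case Fj: (F j) => //=; by rewrite Fa.
by move/norP: b => [Fj Ij]; have [_ _ ->] := fP _ Dj Fj Ij.
Qed.

Lemma sum_jload (D : pred nat) (a : 'I_n -> nat) k : (forall j, a j < k) ->
  \sum_(x < k | D x) jload a x = #|[set j | D (a j)]|.
Proof.
move=> ak; rewrite exchange_big /= cardsE -sum1_card.
rewrite [RHS]big_mkcond; apply: eq_bigr => j _.
rewrite big_mkcond (bigD1 (Ordinal (ak j))) //= eqxx unfold_in /=.
rewrite big1 ?addn0; first by case: (D _).
move=> x nx; case: ifP => // _; case: eqP => // E.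
by move/eqP: nx => []; apply: val_inj.
Qed.

(** Jobs are counted in three groups: on [D], on live machines, in the pool. [tau] has an empty pool
    and at most as many jobs as [a] in the other two groups; both totals are [n], so the pool of [a]
    is empty. *)
Lemma no_augment (D : pred nat) (a tau : 'I_n -> nat) :
  ~~ D m -> (forall j, a j <= m) -> entry_free D a -> total_proper tau ->
  (forall j, F j -> a j = tau j) ->
  (forall x, x < m -> ~~ D x -> jload tau x <= jload a x) ->
  jload a m = 0.
Proof.
move=> Dm am Da tp Fa le.
have dc := dead_count Da tp Fa.
have taum j : tau j < m.+1 by apply: ltnW; case: tp => + _ => /(_ j).
have am1 j : a j < m.+1 by rewrite ltnS.
have total (b : 'I_n -> nat) : (forall j, b j < m.+1) ->
    n = #|[set j | D (b j)]| + (\sum_(x < m | ~~ D x) jload b x + jload b m).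
  move=> bm.
  rewrite -(sum_jload D bm).
  have -> : \sum_(x < m | ~~ D x) jload b x + jload b m =
      \sum_(x < m.+1 | ~~ D x) jload b x.
    by rewrite [RHS]big_mkcond big_ord_recr /= Dm -big_mkcond.
  rewrite [X in _ = X](_ : _ = \sum_(x < m.+1) jload b x); last first.
    by rewrite [RHS](bigID (fun x : 'I_m.+1 => D x)).
  rewrite (sum_jload predT bm).
  have -> : [set j | predT (b j)] = setT by apply/setP => j; rewrite !inE.
  by rewrite cardsT card_ord.
have ta := total _ taum; have aa := total _ am1.
have tm0 : jload tau m = 0.
  rewrite /jload big1 // => j _; case: eqP => // E.
  by case: tp => /(_ j); rewrite E ltnn.
have : \sum_(x < m | ~~ D x) jload tau x <= \sum_(x < m | ~~ D x) jload a x.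
  by apply: leq_sum => x; apply: le.
lia.
Qed.

Lemma reassign_proper_upto (a : 'I_n -> nat) j x : proper_upto a -> free e a j x ->
  proper_upto (reassign a j x).
Proof.
move=> ap /forallP fr u w uw; rewrite /reassign.
case: (altP (u =P j)) => [Eu|nu]; case: (altP (w =P j)) => [Ew|nw].
- by rewrite Eu Ew e_irr in uw.
- by move=> xw; move: (fr w); rewrite -Eu uw -xw eqxx.
- by move=> ux; move: (fr u); rewrite -Ew e_sym uw ux eqxx.
- exact: ap.
Qed.

(** A job that blocks entry into [D] sits inside [D], so a move of a job outside [D] does not
    displace it. *)
Lemma reassign_entry_free D (a : 'I_n -> nat) j x : entry_free D a -> ~~ D (a j) -> ~~ D x ->
  entry_free D (reassign a j x).
Proof.
move=> Da Dj Dx w z Fw Dz; rewrite /reassign => Dw.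
have /(Da w z Fw Dz) : ~~ D (a w) by case: eqP Dw => [->|].
case/forallPn => u; rewrite negb_imply negbK => /andP[wu /eqP Eu].
apply/forallPn; exists u; rewrite negb_imply wu negbK /=.
by case: (altP (u =P j)) => [E|_]; [rewrite -Eu E (negbTE Dj) in Dz|apply/eqP].
Qed.

(** Stated additively to avoid truncated subtraction. *)
Lemma reassign_jload (a : 'I_n -> nat) j x z : x != a j ->
  jload (reassign a j x) z + (z == a j) = jload a z + (z == x).
Proof.
move=> nx; rewrite /jload (bigD1 j) //= [in RHS](bigD1 j) //=.
rewrite {1}/reassign eqxx (eq_bigr (fun w => (a w == z) : nat)); last first.
  by move=> w /negbTE nw; rewrite /reassign nw.
rewrite ![_ == z]eq_sym; lia.
Qed.

End Placement.

(** * Comparing makespans *)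

(* Cross-multiplied form of "the makespan of [a] is at most that of [b]". *)
Definition mle (m n : nat) (s : nat -> nat) (a b : 'I_n -> nat) : Prop :=
  forall x, x < m -> exists2 y, y < m & jload a x * s y <= jload b y * s x.

Lemma mle_trans m n s (a b c : 'I_n -> nat) : (forall x, x < m -> 0 < s x) ->
  mle m s a b -> mle m s b c -> mle m s a c.
Proof.
move=> s0 ab bc x xm; have [y ym l1] := ab x xm; have [z zm l2] := bc y ym.
exists z => //; rewrite -(leq_pmul2r (s0 y ym)).
rewrite mulnAC (leq_trans (leq_mul l1 (leqnn (s z)))) //.
by rewrite mulnAC (leq_trans (leq_mul l2 (leqnn (s x)))) // mulnAC.
Qed.

Lemma mle_makespan m n (s : 'I_m -> nat) (s' : nat -> nat)
    (sg tau : 'I_n -> 'I_m) :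
  (forall i, 0 < s i) -> (forall i : 'I_m, s' i = s i) ->
  mle m s' (fun j => sg j) (fun j => tau j) ->
  (makespan s sg <= makespan s tau)%R.
Proof.
move=> s0 ss le; rewrite /makespan.
have ld (f : 'I_n -> 'I_m) (i : 'I_m) : #|[set j | f j == i]| = jload (fun j => f j) i.
  by rewrite /jload -sum1dep_card big_mkcond.
have ms0 : (0 <= \big[Num.max/0]_(i < m) load s tau i)%R.
  apply: (big_ind (fun x => 0 <= x)%R) => //.
    by move=> x y x0 _; rewrite le_max x0.
  by move=> i _; rewrite /load divr_ge0 ?ler0n.
apply: (big_ind (fun x => x <= _)%R) => //.
  by move=> x y; rewrite ge_max => -> ->.
move=> i _; have [y ym ly] := le i (ltn_ord i).
apply: (@le_trans _ _ (load s tau (Ordinal ym))).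
  rewrite /load !ld ler_pdivrMr ?ltr0n // mulrAC ler_pdivlMr ?ltr0n //.
  by rewrite -!natrM ler_nat -!ss.
exact: (le_bigmax _ (load s tau)).
Qed.

(** * Block graphs *)

Section BlockGraph.
Variables (T : finType) (e : rel T).
Hypotheses (sg : simple_graph e) (bg : block_graph e).

Lemma connected_inP (B : {set T}) :
  (exists2 c, c \in B & {in B, forall x, x != c -> e x c}) -> connected_in e B.
Proof.
case=> c cB star; apply/forall_inP => x xB; apply/forall_inP => y yB.
set r := (X in connect X).
have [e_sym _] := sg.
have xc : connect r x c.
  case: (altP (x =P c)) => [->|nx]; first exact: connect0.
  by apply: connect1; rewrite /r /= xB cB star.
apply: connect_trans xc _.
case: (altP (y =P c)) => [->|ny]; first exact: connect0.
by apply: connect1; rewrite /r /= yB cB e_sym star.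
Qed.

Lemma connected_in1 (B : {set T}) : #|B| <= 1 -> connected_in e B.
Proof.
move/card_le1_eqP => B1; apply/forall_inP => x xB; apply/forall_inP => y yB.
by rewrite (B1 x y) // connect0.
Qed.

Lemma nocut_edge u v : e u v -> nocut e [set u; v].
Proof.
move=> uv; have [e_sym e_irr] := sg.
apply/and3P; split.
- by apply/set0Pn; exists u; rewrite !inE eqxx.
- apply: connected_inP; exists u; first by rewrite !inE eqxx.
  by move=> x; rewrite !inE => /orP[]/eqP->; rewrite ?eqxx // e_sym.
apply/forall_inP => x xB; apply: connected_in1.
have : #|[set u; v] :\ x| < #|[set u; v]| by rewrite [in X in _ < X](cardsD1 x) xB.
by rewrite cards2; case: (u != v); lia.
Qed.

(* The diamond: [u] is adjacent to [v], [a] and [b], so [{v, a, u, b}] is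
   2-connected. *)
Lemma diamond u v a b : e v a -> e v b -> e v u -> e u a -> e u b ->
  a != b -> e a b.
Proof.
move=> va vb vu ua ub nab; have [e_sym e_irr] := sg.
pose B := [set u; v; a; b].
have nB : nocut e B.
  apply/and3P; split.
  - by apply/set0Pn; exists u; rewrite !inE eqxx.
  - apply: connected_inP; exists u; first by rewrite !inE eqxx.
    by move=> x; rewrite !inE -!orbA => /or4P[]/eqP->; rewrite ?eqxx // e_sym.
  apply/forall_inP => x xB; apply: connected_inP.
  (* Both [u] and [v] are adjacent to all other vertices of the diamond, so one of them remains as
     the centre of a star. *)
  case: (altP (x =P u)) => [->|nx].
    exists v; first by rewrite !inE eqxx (contraTneq _ vu) ?orbT // => ->; rewrite e_irr.
    move=> y; rewrite !inE -!orbA => /andP[nyu /or4P[]/eqP Ey]; rewrite Ey ?eqxx // in nyu *.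
      by rewrite e_sym.
    by rewrite e_sym.
  exists u; first by rewrite !inE eqxx eq_sym nx.
  by move=> y; rewrite !inE -!orbA => /andP[_ /or4P[]/eqP->]; rewrite ?eqxx // e_sym.
have [B' B'm BB'] := maxset_exists nB.
have := bg B'm => /forall_inP/(_ a) H.
have aB : a \in B' by apply: (subsetP BB'); rewrite !inE eqxx !orbT.
have bB : b \in B' by apply: (subsetP BB'); rewrite !inE eqxx !orbT.
by move: (H aB) => /forall_inP/(_ b bB); rewrite nab.
Qed.

(** Each of the edges [va] and [vb] extends to a block; as blocks are cliques, a common block would
    make [a] and [b] adjacent. *)
Lemma nonsimplicial_cut v a b : e v a -> e v b -> a != b -> ~~ e a b ->
  v \in cut_vertices e.
Proof.
move=> va vb nab eab; rewrite inE.
have [A Am sA] := maxset_exists (nocut_edge va).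
have [B Bm sB] := maxset_exists (nocut_edge vb).
have vA : v \in A by apply: (subsetP sA); rewrite !inE eqxx.
have vB : v \in B by apply: (subsetP sB); rewrite !inE eqxx.
have aA : a \in A by apply: (subsetP sA); rewrite !inE eqxx orbT.
have bB : b \in B by apply: (subsetP sB); rewrite !inE eqxx orbT.
apply/existsP; exists A; apply/existsP; exists B.
rewrite /is_block Am Bm vA vB !andbT /=.
apply: contraNneq eab => AB.
have := bg Am => /forall_inP/(_ a aA)/forall_inP/(_ b).
by rewrite AB bB nab; apply.
Qed.

End BlockGraph.

(** * The search for an augmenting path *)

Section Search.
Variables (m n : nat) (e : rel 'I_n) (F : pred 'I_n).
Hypotheses (e_sym : symmetric e) (e_irr : irreflexive e).

(* Machine [x] is the successor of [y] in the search forest: job [J y] may go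
   from [y] to [x = X y].  The value [m] stands for "not scheduled". *)
Definition link (a : 'I_n -> nat) (X J : nat -> nat) (y x : nat) : Prop :=
  X y = x /\ exists j : 'I_n, [/\ J y = j, ~~ F j, a j = y & free e a j x].

(** [V0] marks the machines that were dead before the search, [V] also those reached since; [Q] is
    the queue, of length [t], with root [i]. The pool [m] may be reached and linked, but it never
    enters the queue. *)
Record bfs_inv (a : 'I_n -> nat) (V0 : nat -> nat) (i : nat)
    (V Q X J : nat -> nat) (t : nat) : Prop := BfsInv {
  bfs_pos : 0 < t;
  bfs_root : Q 0 = i;
  bfs_queue : forall k, k < t -> [/\ Q k < m, V (Q k) != 0 & V0 (Q k) = 0];
  bfs_inj : forall k k', k < t -> k' < t -> Q k = Q k' -> k = k';
  bfs_mono : forall y, V0 y != 0 -> V y != 0;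
  bfs_new : forall y, y < m -> V y != 0 -> V0 y = 0 -> exists2 k, k < t & y = Q k;
  bfs_link : forall k, 0 < k < t -> exists2 k', k' < k & link a X J (Q k) (Q k');
  bfs_last : V m != 0 -> exists2 k', k' < t & link a X J m (Q k')
}.

Lemma bfs_start (a : 'I_n -> nat) V0 i Q X J : i < m -> V0 i = 0 -> V0 m = 0 ->
  bfs_inv a V0 i (upd V0 i 1) (upd Q 0 i) X J 1.
Proof.
move=> im Vi Vm; split=> //.
- by case=> [|[]] // _; rewrite /upd !eqxx; split.
- by case=> [|k] [|k'].
- by move=> y; rewrite /upd; case: (y =P i).
- move=> y ym; rewrite /upd; case: (y =P i) => [-> _ _|_ /negbTE + /eqP]; last by move=> ->.
  by exists 0.
- by case=> [|[]].
- by rewrite /upd (gtn_eqF im) Vm.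
Qed.

Lemma bfs_size (a : 'I_n -> nat) V0 i V Q X J t :
  bfs_inv a V0 i V Q X J t -> t <= m.
Proof.
move=> I.
have u : uniq [seq Q k | k <- iota 0 t].
  rewrite map_inj_in_uniq ?iota_uniq // => k k'.
  by rewrite !mem_iota /= => *; apply: (bfs_inj I).
rewrite -[t](size_iota 0) -(size_map Q) -(size_iota 0 m).
apply: uniq_leq_size => // _ /mapP[k + ->]; rewrite !mem_iota /= => kt.
by have [] := bfs_queue I kt.
Qed.

Lemma link_upd (a : 'I_n -> nat) X J y x z u v : z != y ->
  link a X J y x -> link a (upd X z u) (upd J z v) y x.
Proof. by move=> zy; rewrite /link /upd eq_sym (negbTE zy). Qed.

Lemma bfs_step (a : 'I_n -> nat) V0 i V Q X J t (j : 'I_n) k :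
  bfs_inv a V0 i V Q X J t -> ~~ F j -> V (a j) = 0 -> k < t ->
  free e a j (Q k) ->
  let V' := upd V (a j) 1 in
  let X' := upd X (a j) (Q k) in
  let J' := upd J (a j) j in
  (a j < m -> bfs_inv a V0 i V' (upd Q t (a j)) X' J' t.+1) /\
  (a j = m -> bfs_inv a V0 i V' Q X' J' t).
Proof.
move=> I Fj Vj kt fr V' X' J'.
have new l : l < t -> a j != Q l.
  by move=> lt; apply: contra_eq_neq Vj => ->; have [] := bfs_queue I lt.
have lnew : link a X' J' (a j) (Q k).
  by rewrite /link /X' /J' /upd eqxx; split=> //; exists j.
have V'1 y : V y != 0 -> V' y != 0 by rewrite /V' /upd; case: ifP.
have queue l : l < t -> [/\ Q l < m, V' (Q l) != 0 & V0 (Q l) = 0].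
  by move=> lt; have [? ? ?] := bfs_queue I lt; split=> //; apply: V'1.
have lnk l : 0 < l < t -> exists2 k', k' < l & link a X' J' (Q l) (Q k').
  case/andP=> l0 lt; have [k' k'l lk] := bfs_link I (introT andP (conj l0 lt)).
  by exists k' => //; apply: link_upd lk; apply: new.
split=> ajm.
  have Qn l : l < t -> upd Q t (a j) l = Q l by rewrite /upd; case: eqP => // ->; rewrite ltnn.
  have Qt : upd Q t (a j) t = a j by rewrite /upd eqxx.
  split.
  - by [].
  - by rewrite Qn ?(bfs_root I) //; apply: bfs_pos I.
  - move=> l; rewrite ltnS leq_eqVlt => /predU1P[->|lt]; last by rewrite Qn //; apply: queue.
    rewrite Qt; split=> //; first by rewrite /V' /upd eqxx.
    by apply/eqP; apply: contraT => /(bfs_mono I); rewrite Vj.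
  - move=> l l'; rewrite !ltnS (leq_eqVlt l) (leq_eqVlt l') => /predU1P[->|lt] /predU1P[->|lt'] //.
    + by rewrite Qt Qn // => E; move: (new _ lt'); rewrite E eqxx.
    + by rewrite Qt Qn // => E; move: (new _ lt); rewrite E eqxx.
    + by rewrite !Qn //; apply: bfs_inj I _ _ _ _.
  - by move=> y /(bfs_mono I); apply: V'1.
  - move=> y ym; rewrite /V' {1}/upd; case: (y =P a j) => [-> _ _|_ Vy V0y].
      by exists t => //; rewrite Qt.
    have [l lt ->] := bfs_new I ym Vy V0y.
    by exists l; [apply: ltnW|rewrite Qn].
  - move=> l /andP[l0]; rewrite ltnS leq_eqVlt => /predU1P[->|lt].
      by exists k => //; rewrite Qt Qn.
    have [|k' k'l lk] := lnk l; first by rewrite l0.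
    by exists k' => //; rewrite !Qn // (ltn_trans k'l).
  - rewrite /V' {1}/upd (gtn_eqF ajm) => /(bfs_last I) [k' k't lk].
    exists k'; first exact: ltnW.
    by rewrite Qn //; apply: link_upd lk; rewrite ltn_eqF.
split=> //.
- exact: bfs_pos I.
- exact: bfs_root I.
- exact: bfs_inj I.
- by move=> y /(bfs_mono I); apply: V'1.
- move=> y ym; rewrite /V' /upd ajm (ltn_eqF ym); apply: bfs_new I _ ym.
- by move=> _; exists k => //; rewrite -ajm.
Qed.

Definition entry (V : nat -> nat) : pred nat := fun x => (x < m) && (V x != 0).

(** A job that could enter a newly reached machine would have had its own machine marked by the
    scan. An unmarked job is also outside the old dead set, which it could not enter before
    either. *)
Lemma bfs_fail (a : 'I_n -> nat) V0 i V Q X J t :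
  (forall j, a j <= m) -> bfs_inv a V0 i V Q X J t -> V m = 0 -> entry_free e F (entry V0) a ->
  (forall k j, k < t -> ~~ F j -> V (a j) = 0 -> ~~ free e a j (Q k)) ->
  entry_free e F (entry V) a.
Proof.
move=> am I Vm0 Da scan j x Fj /andP[xm Vx] Daj.
have Vaj : V (a j) = 0.
  move: Daj; rewrite /entry; case: (ltngtP (a j) m) (am j) => //= [_ _|-> _ _]; last exact: Vm0.
  by rewrite negbK => /eqP.
case: (altP (V0 x =P 0)) => [V0x|V0x].
  by have [k kt ->] := bfs_new I xm Vx V0x; apply: scan.
apply: Da => //; first by rewrite /entry xm.
rewrite /entry negb_and negbK; apply/orP; right.
by apply: contraT => /(bfs_mono I); rewrite Vaj.
Qed.

(* [y] is the endpoint reached so far and [r] its rank in the queue ([t] for the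
   start [m]); machines of smaller rank still hold their jobs. *)
Record aug_inv (a0 : 'I_n -> nat) (D : pred nat) (Q : nat -> nat) (t r y : nat)
    (a : 'I_n -> nat) : Prop := AugInv {
  aug_end : (r < t /\ y = Q r) \/ (r = t /\ y = m);
  aug_le : forall j, a j <= m;
  aug_proper : proper_upto m e a;
  aug_entry : entry_free e F D a;
  aug_fixed : forall j, F j -> a j = a0 j;
  aug_load : forall z, jload a z + (z == m) = jload a0 z + (z == y);
  aug_low : forall k j, k < r -> (a j == Q k) = (a0 j == Q k);
  aug_here : forall j, a0 j = y -> a j = y
}.

Lemma aug_start (a : 'I_n -> nat) D Q t : (forall j, a j <= m) -> proper_upto m e a ->
  entry_free e F D a -> aug_inv a D Q t t m a.
Proof. by move=> *; split=> //; right. Qed.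

(** The links were recorded for [a0], before any move. They remain usable because the walk descends
    in queue rank: the target still holds exactly its old jobs, and the job to be moved has not left
    [y]. *)
Lemma aug_step (a0 : 'I_n -> nat) V0 i V Q X J t r y a :
  bfs_inv a0 V0 i V Q X J t -> V m != 0 -> V0 m = 0 ->
  aug_inv a0 (entry V0) Q t r y a -> y != i ->
  exists (j : 'I_n) r', [/\ J y = j, a j = y, X y != y, X y < m & r' < r /\
     aug_inv a0 (entry V0) Q t r' (X y) (reassign a j (X y))].
Proof.
move=> I Vm V0m A yi.
have [k' k'r [Xy [j [Jy Fj ajy fr]]]] : exists2 k', k' < r & link a0 X J y (Q k').
  case: (aug_end A) => [[rt yQ]|[-> ->]]; last exact: bfs_last I Vm.
  rewrite yQ; apply: (bfs_link I); rewrite rt andbT lt0n.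
  by apply: contraNneq yi => r0; rewrite yQ r0 (bfs_root I).
have k't : k' < t by case: (aug_end A) => -[]; lia.
have [Qm VQ V0Q] := bfs_queue I k't.
have Qy k : k < r -> y != Q k.
  move=> kr; case: (aug_end A) => -[rt ->]; last first.
    by rewrite gtn_eqF //; case: (bfs_queue I (_ : k < t)) => //; rewrite -rt.
  by apply/eqP => /(bfs_inj I rt (ltn_trans kr rt)) E; rewrite E ltnn in kr.
have ndy : ~~ entry V0 y.
  rewrite /entry; case: (aug_end A) => -[rt ->]; last by rewrite ltnn.
  by have [_ _ ->] := bfs_queue I rt; rewrite eqxx andbF.
have aj := aug_here A ajy.
have fra : free e a j (Q k').
  apply/forallP => w; apply/implyP => jw; rewrite (aug_low A) //.
  by move/forallP/(_ w): fr; rewrite jw.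
exists j, k'; rewrite Xy; split=> //; first by rewrite eq_sym Qy.
split=> //; split.
- by left.
- by move=> w; rewrite /reassign; case: ifP => _; [apply: ltnW|apply: aug_le A _].
- exact: reassign_proper_upto (aug_proper A) fra.
- by apply: reassign_entry_free (aug_entry A) _ _; rewrite ?aj // /entry V0Q eqxx andbF.
- move=> w Fw; rewrite /reassign; case: eqP => [E|_]; last exact: aug_fixed A _ Fw.
  by rewrite E (negbTE Fj) in Fw.
- move=> z; have := @reassign_jload _ a j (Q k') z; rewrite aj eq_sym => /(_ (Qy _ k'r)).
  by have := aug_load A z; lia.
- move=> k w kk; rewrite /reassign; case: (altP (w =P j)) => [->|_]; last by apply: (aug_low A); lia.
  rewrite ajy (negbTE (Qy _ _)); last by lia.
  by apply/negbTE/eqP => /(bfs_inj I k't (ltn_trans kk k't)) E; rewrite E ltnn in kk.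
- move=> w a0w; rewrite /reassign; case: ifP => // _.
  by apply/eqP; rewrite (aug_low A) // a0w.
Qed.

(** Each move lowers the rank, which starts at [t]; after [t] rounds it is 0, the rank of the
    root. *)
Lemma aug_done (a0 : 'I_n -> nat) D i Q t r y a k :
  aug_inv a0 D Q t r y a -> Q 0 = i -> 0 < t -> r + k <= t \/ y = i -> t <= k -> y = i.
Proof.
move=> A Q0 t0 [rk tk|//].
by case: (aug_end A) => -[rt ->]; [rewrite (_ : r = 0) //; lia|lia].
Qed.

(* Otherwise no live machine is more loaded under [tau] than under [a], and
   [no_augment] applies. *)
Lemma augment_mle (s : nat -> nat) (a a' tau : 'I_n -> nat) V i :
  (forall v, ~~ F v -> simplicial e v) -> (forall x, x < m -> 0 < s x) ->
  (forall j, a j <= m) -> entry_free e F (entry V) a -> total_proper m e tau ->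
  (forall j, F j -> a j = tau j) -> jload a m != 0 ->
  i < m ->
  (forall x, x < m -> V x = 0 -> (jload a i).+1 * s x <= (jload a x).+1 * s i) ->
  (forall z, jload a' z + (z == m) = jload a z + (z == i)) ->
  mle m s a tau -> mle m s a' tau.
Proof.
move=> Fs s0 am Da tp Fa un im best ld le x xm.
have := ld x; rewrite (ltn_eqF xm) addn0 => ->.
case: (altP (x =P i)) => [->|_] /=; last by rewrite addn0; apply: le.
rewrite addn1.
(* Either some machine under [tau] takes at least as long as [i] will after the augmentation, or
   every live [y] satisfies [jload tau y * s i < (jload a i).+1 * s y <= (jload a y).+1 * s i] by
   the choice of [i]. *)
have [/existsP[y Hy]|/existsPn none] :=
   boolP [exists y : 'I_m, (jload a i).+1 * s y <= jload tau y * s i].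
  by exists y.
case/eqP: un; apply: (no_augment e_sym Fs _ am Da tp Fa); first by rewrite /entry ltnn.
move=> y ym; rewrite /entry ym /= negbK => /eqP Vy.
have := none (Ordinal ym); rewrite -ltnNge /= => lt.
have := leq_trans lt (best y ym Vy).
by rewrite ltn_pmul2r ?s0.
Qed.

End Search.

(** * The scheduling algorithm *)

(** Tests evaluate to 0 or 1 by truncated subtraction; [EMul] then serves as conjunction and [EAdd],
    read as nonzero, as disjunction. *)
Definition Not e := ESub (Num 1) e.
Definition Neq a b := Not (Not (EAdd (ESub a b) (ESub b a))).
Definition Lt a b := Not (Not (ESub b a)).
Definition Rd1 q e := Rd q e (Num 0).
Definition Skip := Set_ 39 (Num 0).

Fixpoint Block (l : seq prog) : prog :=
  match l with
  | [::] => Skip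
  | [:: c] => c
  | c :: l => Seq c (Block l)
  end.

Notation vN := 0 (only parsing).
Notation vM := 1 (only parsing).
Notation vNM := 2 (only parsing).
Notation vTot := 3 (only parsing).
Notation vJ := 4 (only parsing).
Notation vW := 5 (only parsing).
Notation vX := 6 (only parsing).
Notation vU := 7 (only parsing).
Notation vBad := 8 (only parsing).
Notation vC := 9 (only parsing).
Notation vRest := 10 (only parsing).
Notation vOk := 11 (only parsing).
Notation vI := 12 (only parsing).
Notation vTail := 13 (only parsing).
Notation vH := 14 (only parsing).
Notation vY := 15 (only parsing).
Notation vIt := 16 (only parsing).
Notation vNum := 17 (only parsing).
Notation vDen := 18 (only parsing).
Notation vBest := 19 (only parsing).
Notation vBNum := 20 (only parsing).
Notation vBDen := 21 (only parsing).
Notation vK := 22 (only parsing).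
Notation vJob := 23 (only parsing).

(** The arrays hold, in this order: the input, the flags of the jobs to enumerate, the placement,
    the number of neighbours of a job on a machine, the loads, the dead or visited marks, the queue,
    the successor and the job of a link, and the best schedule so far. *)
Notation aI := 0 (only parsing).
Notation aF := 1 (only parsing).
Notation aA := 2 (only parsing).
Notation aC := 3 (only parsing).
Notation aL := 4 (only parsing).
Notation aV := 5 (only parsing).
Notation aQ := 6 (only parsing).
Notation aX := 7 (only parsing).
Notation aJ := 8 (only parsing).
Notation aB := 9 (only parsing).

Definition Edge j w :=
  Rd1 aI (EAdd (EAdd (EAdd (Num 2) (Var vM)) (EMul j (Var vN))) w).
Definition Speed i := Rd1 aI (EAdd (Num 2) i).
Definition Put1 q a e := Put q a (Num 0) e.

(* In a block graph a vertex [v] is simplicial as soon as one of its neighbours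
   is adjacent to all the others. *)
Definition p_neighbour :=
  For vW vN (If (Edge (Var vJ) (Var vW)) (Set_ vU (Var vW)) Skip).
Definition p_check :=
  For vW vN
    (If (EMul (Edge (Var vJ) (Var vW))
          (EMul (Neq (Var vU) (Var vW)) (Not (Edge (Var vU) (Var vW)))))
       (Set_ vBad (Num 1)) Skip).
Definition p_flags :=
  Seq (Set_ vTot (Num 1))
    (For vJ vN (Block [:: Set_ vU (Var vN); p_neighbour; Set_ vBad (Num 0);
       p_check; Put1 aF (Var vJ) (Var vBad);
       If (Var vBad) (Set_ vTot (EMul (Var vTot) (Var vM))) Skip])).

(** The case number is read in base [m], one digit for each flagged job; all other jobs start in the
    pool. *)
Definition p_decode :=
  Seq (Set_ vRest (Var vC))
    (For vJ vN
      (If (Rd1 aF (Var vJ))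
        (Seq (Put1 aA (Var vJ) (ESub (Var vRest)
               (EMul (EDiv (Var vRest) (Var vM)) (Var vM))))
             (Set_ vRest (EDiv (Var vRest) (Var vM))))
        (Put1 aA (Var vJ) (Var vM)))).

Definition p_zero_mach :=
  Seq (For vX vM (Seq (Put1 aL (Var vX) (Num 0)) (Put1 aV (Var vX) (Num 0))))
    (Seq (Put1 aL (Var vM) (Num 0)) (Put1 aV (Var vM) (Num 0))).
Definition p_zero_count :=
  For vJ vN
    (Seq (For vX vM (Put aC (Var vJ) (Var vX) (Num 0)))
         (Put aC (Var vJ) (Var vM) (Num 0))).

Definition p_loads :=
  For vJ vN (Put1 aL (Rd1 aA (Var vJ)) (EAdd (Rd1 aL (Rd1 aA (Var vJ))) (Num 1))).

(** An entry 0 in [aC] means that the job may enter the machine, so the search tests this in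
    constant time. The same pass clears [vOk] if two adjacent jobs share a machine. *)
Definition p_count_row :=
  For vW vN
    (If (Edge (Var vJ) (Var vW))
      (Seq (Put aC (Var vJ) (Rd1 aA (Var vW))
             (EAdd (Rd aC (Var vJ) (Rd1 aA (Var vW))) (Num 1)))
           (If (EMul (Not (Neq (Rd1 aA (Var vJ)) (Rd1 aA (Var vW))))
                     (Neq (Rd1 aA (Var vJ)) (Var vM)))
             (Set_ vOk (Num 0)) Skip)) Skip).
Definition p_count := Seq (Set_ vOk (Num 1)) (For vJ vN p_count_row).

(** [vI = m] stands for no live machine found yet; the speed read at that index is meaningless, but
    the disjunction is already true. *)
Definition p_choose :=
  Seq (Set_ vI (Var vM))
    (For vX vM
      (If (Not (Rd1 aV (Var vX)))
        (If (EAdd (Not (Neq (Var vI) (Var vM)))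
               (Lt (EMul (EAdd (Rd1 aL (Var vX)) (Num 1)) (Speed (Var vI)))
                   (EMul (EAdd (Rd1 aL (Var vI)) (Num 1)) (Speed (Var vX)))))
          (Set_ vI (Var vX)) Skip) Skip)).

Definition p_scan :=
  For vJ vN
    (If (EMul (Not (Rd1 aF (Var vJ)))
          (EMul (Not (Rd1 aV (Rd1 aA (Var vJ)))) (Not (Rd aC (Var vJ) (Var vX)))))
      (Block [:: Set_ vY (Rd1 aA (Var vJ));
         Put1 aV (Var vY) (Num 1);
         Put1 aX (Var vY) (Var vX);
         Put1 aJ (Var vY) (Var vJ);
         If (Lt (Var vY) (Var vM))
           (Seq (Put1 aQ (Var vTail) (Var vY))
                (Set_ vTail (EAdd (Var vTail) (Num 1)))) Skip]) Skip).
(** The queue has at most [m] entries, so a counted loop over [m] heads that skips those past the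
    tail replaces a loop of unknown length. *)
Definition p_search :=
  Block [:: Put1 aQ (Num 0) (Var vI); Put1 aV (Var vI) (Num 1);
    Set_ vTail (Num 1);
    For vH vM (If (Lt (Var vH) (Var vTail))
      (Seq (Set_ vX (Rd1 aQ (Var vH))) p_scan) Skip)].

Definition p_recount :=
  For vW vN
    (If (Edge (Var vJob) (Var vW))
      (Seq (Put aC (Var vW) (Var vY) (ESub (Rd aC (Var vW) (Var vY)) (Num 1)))
           (Put aC (Var vW) (Var vX) (EAdd (Rd aC (Var vW) (Var vX)) (Num 1))))
      Skip).
Definition p_move :=
  Block [:: p_recount;
    Put1 aL (Var vY) (ESub (Rd1 aL (Var vY)) (Num 1));
    Put1 aL (Var vX) (EAdd (Rd1 aL (Var vX)) (Num 1));
    Put1 aA (Var vJob) (Var vX)].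
Definition p_walk :=
  Seq (Set_ vY (Var vM))
    (For vK vM (If (Neq (Var vY) (Var vI))
      (Block [:: Set_ vX (Rd1 aX (Var vY)); Set_ vJob (Rd1 aJ (Var vY)); p_move;
         Set_ vY (Var vX)]) Skip)).
(** Run only after a success. It unmarks what this search reached, and older dead machines are never
    queued; after a failure the marks stay and become the new dead machines. *)
Definition p_reset :=
  Seq (For vK vM (If (Lt (Var vK) (Var vTail))
        (Put1 aV (Rd1 aQ (Var vK)) (Num 0)) Skip))
      (Put1 aV (Var vM) (Num 0)).

Definition p_round :=
  Seq p_choose
    (If (Lt (Var vI) (Var vM))
      (Seq p_search (If (Rd1 aV (Var vM)) (Seq p_walk p_reset) Skip)) Skip).
Definition p_solve := For vIt vNM p_round.

Definition p_value :=
  Block [:: Set_ vNum (Rd1 aL (Num 0)); Set_ vDen (Speed (Num 0));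
    For vX vM (If (Lt (EMul (Var vNum) (Speed (Var vX)))
                      (EMul (Rd1 aL (Var vX)) (Var vDen)))
      (Seq (Set_ vNum (Rd1 aL (Var vX))) (Set_ vDen (Speed (Var vX)))) Skip)].
Definition p_copy := For vJ vN (Put1 aB (Var vJ) (Rd1 aA (Var vJ))).
Definition p_record :=
  If (EMul (Var vOk) (Not (Rd1 aL (Var vM))))
    (Seq p_value
      (If (EAdd (Not (Var vBest))
                (Lt (EMul (Var vNum) (Var vBDen)) (EMul (Var vBNum) (Var vDen))))
        (Block [:: Set_ vBest (Num 1); Set_ vBNum (Var vNum); Set_ vBDen (Var vDen);
           p_copy]) Skip)) Skip.

Definition p_prepare :=
  Block [:: p_decode; p_zero_mach; p_zero_count; p_loads; p_count].

Definition p_case := Block [:: p_prepare; p_solve; p_record].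
Definition p_cases := Seq (Set_ vBest (Num 0)) (For vC vTot p_case).
Definition p_init := Seq (Set_ vNM (EAdd (Var vN) (Var vM))) p_flags.

(** * Symbolic execution and framing *)

Arguments sem : simpl never.
Arguments eval : simpl never.

Lemma sem_set v e s : sem (Set_ v e) s = setr s v (eval e s). Proof. by []. Qed.
Lemma sem_put q a b e s :
  sem (Put q a b e) s = seta s q (eval a s) (eval b s) (eval e s). Proof. by []. Qed.
Lemma sem_put1 q a e s :
  sem (Put1 q a e) s = seta s q (eval a s) 0 (eval e s). Proof. by []. Qed.
Lemma sem_seq c1 c2 s : sem (Seq c1 c2) s = sem c2 (sem c1 s). Proof. by []. Qed.
Lemma sem_if e c1 c2 s :
  sem (If e c1 c2) s = if eval e s == 0 then sem c2 s else sem c1 s.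
Proof. by []. Qed.
Lemma sem_block1 c : Block [:: c] = c. Proof. by []. Qed.
Lemma sem_block c c' l : Block [:: c, c' & l] = Seq c (Block (c' :: l)).
Proof. by []. Qed.

Definition col (s : st) q x := ar s q x 0.

Arguments col : simpl never.
Arguments setr : simpl never.
Arguments seta : simpl never.
Arguments upd : simpl never.
Arguments upd2 : simpl never.

Lemma eval_num c s : eval (Num c) s = c. Proof. by []. Qed.
Lemma eval_var v s : eval (Var v) s = rg s v. Proof. by []. Qed.
Lemma eval_add a b s : eval (EAdd a b) s = eval a s + eval b s. Proof. by []. Qed.
Lemma eval_sub a b s : eval (ESub a b) s = eval a s - eval b s. Proof. by []. Qed.
Lemma eval_mul a b s : eval (EMul a b) s = eval a s * eval b s. Proof. by []. Qed.
Lemma eval_div a b s : eval (EDiv a b) s = eval a s %/ eval b s. Proof. by []. Qed.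
Lemma eval_rd q a b s : eval (Rd q a b) s = ar s q (eval a s) (eval b s).
Proof. by []. Qed.
Lemma eval_rd1 q a s : eval (Rd1 q a) s = col s q (eval a s). Proof. by []. Qed.
Lemma eval_not a s : eval (Not a) s = (eval a s == 0).
Proof. by rewrite /Not eval_sub eval_num; case: (eval a s). Qed.
Lemma eval_neq a b s : eval (Neq a b) s = (eval a s != eval b s).
Proof. by rewrite /Neq !eval_not eval_add !eval_sub; case: eqP; lia. Qed.
Lemma eval_lt a b s : eval (Lt a b) s = (eval a s < eval b s).
Proof. by rewrite /Lt !eval_not eval_sub; case: leqP; lia. Qed.
Lemma rg_setr s v x u : rg (setr s v x) u = if u == v then x else rg s u.
Proof. by []. Qed.
Lemma rg_seta s q x y z : rg (seta s q x y z) = rg s. Proof. by []. Qed.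
Lemma ar_setr s v x : ar (setr s v x) = ar s. Proof. by []. Qed.
Lemma ar_seta s q x y z q' :
  ar (seta s q x y z) q' = if q' == q then upd2 (ar s q) x y z else ar s q'.
Proof. by []. Qed.
Lemma col_setr s v x : col (setr s v x) = col s. Proof. by []. Qed.
Lemma col_seta s q x z q' :
  col (seta s q x 0 z) q' = if q' == q then upd (col s q) x z else col s q'.
Proof.
apply: functional_extensionality => x'; rewrite /col ar_seta.
by case: (q' == q) => //; rewrite /upd2 /upd andbT.
Qed.
Lemma col_put s q x y z q' : q' != q -> col (seta s q x y z) q' = col s q'.
Proof. by move=> nq; rewrite /col ar_seta (negbTE nq). Qed.
Lemma updx (f : memory) x v : upd f x v x = v.
Proof. by rewrite /upd eqxx. Qed.
Lemma updn (f : memory) x v y : y != x -> upd f x v y = f y.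
Proof. by rewrite /upd => /negbTE ->. Qed.

Lemma frame_r c s r : r \notin wvars c -> rg (sem c s) r = rg s r.
Proof. exact: (proj1 (semP c s)). Qed.
Lemma frame_a c s q : q \notin warrs c -> ar (sem c s) q = ar s q.
Proof. exact: (proj2 (semP c s)). Qed.
Lemma frame_c c s q : q \notin warrs c -> col (sem c s) q = col s q.
Proof. by move=> /frame_a E; rewrite /col E. Qed.
Lemma same_col W A s s' q : same W A s s' -> q \notin A -> col s' q = col s q.
Proof. by move=> [_ E] /E E'; rewrite /col E'. Qed.

(* The matching is syntactic, so that named subprograms stay folded. *)
Ltac exec1 :=
  match goal with
  | |- context [sem (Set_ ?v ?e) ?s] => rewrite (sem_set v e s)
  | |- context [sem (Put1 ?q ?a ?e) ?s] => rewrite (sem_put1 q a e s)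
  | |- context [sem (Put ?q ?a ?b ?e) ?s] => rewrite (sem_put q a b e s)
  | |- context [sem (Block [:: ?a]) ?s] => rewrite (sem_block1 a)
  | |- context [sem (Block [:: ?a, ?b & ?l]) ?s] => rewrite (sem_block a b l)
  | |- context [sem (Seq ?a ?b) ?s] => rewrite (sem_seq a b s)
  | |- context [sem (If ?e ?a ?b) ?s] => rewrite (sem_if e a b s)
  | |- context [sem Skip ?s] => rewrite (sem_set 39 (Num 0) s)
  | |- context [eval (Num ?c) ?s] => rewrite (eval_num c s)
  | |- context [eval (Var ?c) ?s] => rewrite (eval_var c s)
  | |- context [eval (EAdd ?a ?b) ?s] => rewrite (eval_add a b s)
  | |- context [eval (ESub ?a ?b) ?s] => rewrite (eval_sub a b s)
  | |- context [eval (EMul ?a ?b) ?s] => rewrite (eval_mul a b s)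
  | |- context [eval (EDiv ?a ?b) ?s] => rewrite (eval_div a b s)
  | |- context [eval (Rd1 ?q ?a) ?s] => rewrite (eval_rd1 q a s)
  | |- context [eval (Rd ?q ?a ?b) ?s] => rewrite (eval_rd q a b s)
  | |- context [eval (Not ?a) ?s] => rewrite (eval_not a s)
  | |- context [eval (Neq ?a ?b) ?s] => rewrite (eval_neq a b s)
  | |- context [eval (Lt ?a ?b) ?s] => rewrite (eval_lt a b s)
  end.
Ltac st1 :=
  match goal with
  | |- context [rg (setr ?s ?v ?x) ?u] => rewrite (rg_setr s v x u) /=
  | |- context [upd (rg ?s) ?v ?x ?u] => change (upd (rg s) v x u) with (if u == v then x else rg s u); rewrite /=
  | |- context [rg (seta ?s ?q ?x ?y ?z)] => rewrite (rg_seta s q x y z)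
  | |- context [ar (setr ?s ?v ?x)] => rewrite (ar_setr s v x)
  | |- context [ar (seta ?s ?q ?x ?y ?z) ?r] => rewrite (ar_seta s q x y z r) /=
  | |- context [col (setr ?s ?v ?x)] => rewrite (col_setr s v x)
  | |- context [col (seta ?s ?q ?x 0 ?z) ?r] => rewrite (col_seta s q x z r) /=
  | |- context [col (seta ?s ?q ?x ?y ?z) ?r] => rewrite (@col_put s q x y z r isT)
  end.
Ltac exec := repeat exec1; repeat st1.

Section Algorithm.
Variables (m n : nat) (e : rel 'I_n) (sp : nat -> nat).
Hypotheses (m_gt0 : 0 < m) (n_gt0 : 0 < n).
Hypotheses (e_sym : symmetric e) (e_irr : irreflexive e).
Hypothesis sp_gt0 : forall x, x < m -> 0 < sp x.

Record ctx (s : st) : Prop := Ctx {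
  ctx_n : rg s vN = n;
  ctx_m : rg s vM = m;
  ctx_e : forall j w : 'I_n, col s aI (2 + m + j * n + w) = e j w;
  ctx_s : forall x, x < m -> col s aI (2 + x) = sp x
}.

Lemma ctx_same W A s s' : same W A s s' -> vN \notin W -> vM \notin W ->
  aI \notin A -> ctx s -> ctx s'.
Proof.
move=> [Hr Ha] nW mW iA [cn cm ce cs].
by split=> [||j w|x xm]; rewrite ?Hr // /col Ha // -?(ce j w) -?(cs x xm).
Qed.

Lemma ctx_setr s v x : v != vN -> v != vM -> ctx s -> ctx (setr s v x).
Proof.
move=> /negbTE nN /negbTE nM [? ? ? ?].
by split; rewrite ?rg_setr ?(eq_sym _ v) ?nN ?nM.
Qed.

Lemma edge_cell s u w : ctx s ->
  eval (Edge (Var u) (Var w)) s = col s aI (2 + m + rg s u * n + rg s w).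
Proof. by move=> [cn cm _ _]; rewrite /Edge; exec; rewrite cn cm. Qed.

Lemma edgeE s u w (j i : 'I_n) : ctx s -> rg s u = j -> rg s w = i ->
  eval (Edge (Var u) (Var w)) s = e j i.
Proof. by move=> cs uj wi; rewrite edge_cell // uj wi (ctx_e cs). Qed.

Lemma speed_cell s a : eval (Speed a) s = col s aI (2 + eval a s).
Proof. by rewrite /Speed; exec. Qed.

Lemma ctx_sem c s : vN \notin wvars c -> vM \notin wvars c ->
  aI \notin warrs c -> ctx s -> ctx (sem c s).
Proof. by move=> *; apply: ctx_same (semP c s) _ _ _ _. Qed.

(** * Detection of the jobs to enumerate *)

Variable F : pred 'I_n.
Hypothesis F_nbr : forall v u, e v u ->
  F v = [exists w, [&& e v w, u != w & ~~ e u w]].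
Hypothesis F_iso : forall v, (forall u, ~~ e v u) -> ~~ F v.

Definition Fn (j : nat) : bool := if insub j is Some i then F i else false.
(** For a flagged job [k] this is the position of its digit in the case number. *)
Definition Fcount k := \sum_(0 <= j < k) Fn j.

Lemma FnE (j : 'I_n) : Fn j = F j.
Proof. by rewrite /Fn valK. Qed.

Lemma FcountS k : Fcount k.+1 = Fcount k + Fn k.
Proof. by rewrite /Fcount big_nat_recr. Qed.

Lemma Fcount_card : Fcount n = #|F|.
Proof.
rewrite /Fcount big_mkord -sum1_card [RHS]big_mkcond; apply: eq_bigr => j _.
by rewrite FnE unfold_in; case: (F j).
Qed.

Lemma neighbourP s (j : 'I_n) : ctx s -> rg s vJ = j -> rg s vU = n ->
  let u := rg (sem p_neighbour s) vU in
  (exists2 u' : 'I_n, u = u' & e j u') \/ (forall w, ~~ e j w).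
Proof.
move=> cs sj su; pose I k s' :=
  (exists2 u' : 'I_n, rg s' vU = u' & e j u') \/
  (forall w : 'I_n, w < k -> ~~ e j w).
have : I (rg s vN) (sem p_neighbour s).
  apply: for_ind => //; first by right.
  move=> k s' kn s'k sm Is'; rewrite (ctx_n cs) in kn.
  pose w := Ordinal kn.
  have cs' : ctx s' by apply: ctx_same sm _ _ _ cs.
  have s'j : rg s' vJ = j by rewrite (proj1 sm).
  exec; rewrite (edgeE (i := w) cs' s'j s'k).
  case ejw: (e j w) => /=; exec.
    by left; exists w.
  case: Is' => [[u' su' eu']|no]; [left|right]; first by exists u'.
  move=> v; rewrite ltnS leq_eqVlt => /predU1P[vk|]; last exact: no.
  by rewrite (_ : v = w) ?ejw //; apply: val_inj.
by rewrite (ctx_n cs) => -[|no]; [left|right => w; apply: no].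
Qed.

Lemma checkP s (j : 'I_n) : ctx s -> rg s vJ = j -> rg s vBad = 0 ->
  (exists2 u : 'I_n, rg s vU = u & e j u) \/ (forall w, ~~ e j w) ->
  rg (sem p_check s) vBad = F j.
Proof.
move=> cs sj sb su.
(* The raw array entry replaces the adjacency to [vU], which need not be a job when [j] is isolated;
   the factor [e j w] then decides the test. *)
pose I k s' := rg s' vBad = [exists w : 'I_n, [&& w < k, e j w, rg s vU != w &
   col s aI (2 + m + rg s vU * n + w) == 0]] :> nat.
have : I (rg s vN) (sem p_check s).
  apply: for_ind => //.
    rewrite /I; exec; rewrite sb; by case: existsP => // -[].
  move=> k s' kn s'k sm Is'; rewrite (ctx_n cs) in kn.
  pose w := Ordinal kn.
  have cs' : ctx s' by apply: ctx_same sm _ _ _ cs.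
  have s'j : rg s' vJ = j by rewrite (proj1 sm).
  have s'u : rg s' vU = rg s vU by rewrite (proj1 sm).
  rewrite /I in Is' *; exec; rewrite (edgeE (i := w) cs' s'j s'k).
  rewrite edge_cell // s'u s'k (same_col sm) //.
  rewrite !mulnb eqb0.
  set b := [&& e j w, _ & _].
  case Eb: b => /=; exec.
    by case: existsP => // -[]; exists w; rewrite ltnSn.
  rewrite Is'; congr nat_of_bool; apply/existsP/existsP => -[v].
    by case/andP=> vk Hv; exists v; rewrite ltnS ltnW.
  case/andP; rewrite ltnS leq_eqVlt => /predU1P[vk|vk] Hv; last by exists v; rewrite vk.
  have E : v = w by apply: val_inj.
  by move: Hv Eb; rewrite E /b /= => ->.
rewrite /I (ctx_n cs) => ->; congr nat_of_bool.
case: su => [[u su eu]|no].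
  rewrite (F_nbr eu) su; apply/eq_existsb => w; rewrite ltn_ord /=.
  by rewrite (ctx_e cs) eqb0 -val_eqE.
apply/idP/idP => [/existsP[w /and3P[_]]|Fj]; first by rewrite (negbTE (no w)).
by rewrite (negbTE (F_iso no)) in Fj.
Qed.

Definition flags s := forall j, j < n -> (col s aF j != 0) = Fn j.

Lemma flagsP s : ctx s ->
  flags (sem p_flags s) /\ rg (sem p_flags s) vTot = m ^ #|F|.
Proof.
move=> cs; rewrite /p_flags sem_seq; set s1 := sem _ s.
have cs1 : ctx s1 by apply: ctx_sem.
pose I k s' := (forall j, j < k -> (col s' aF j != 0) = Fn j) /\
   rg s' vTot = m ^ Fcount k.
set body := Block _; suff : I (rg s1 vN) (sem (For vJ vN body) s1).
  by rewrite (ctx_n cs1) -Fcount_card; apply.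
apply: (@for_ind I) => //.
  by split=> //; rewrite /Fcount big_nil expn0 /s1; exec.
move=> k s' kn s'k sm [Is' It]; rewrite (ctx_n cs1) in kn.
pose j := Ordinal kn.
have cs' : ctx s' by apply: ctx_same sm _ _ _ cs1.
rewrite {}/body in sm *; exec; set s2 := setr s' vU _.
have cs2 : ctx s2 by apply: ctx_setr.
have nb := @neighbourP s2 j cs2; have {}nb := nb s'k (ctx_n cs').
set s3 := setr (sem p_neighbour s2) vBad 0.
have cs3 : ctx s3 by apply: ctx_setr => //; apply: ctx_sem.
have s3j : rg s3 vJ = j by rewrite /s3; exec; rewrite frame_r.
have bad := checkP cs3 s3j erefl nb.
set s4 := sem p_check s3 in bad *.
have cs4 : ctx s4 by apply: ctx_sem.
have s4j : rg s4 vJ = j by rewrite /s4 frame_r.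
have s4t : rg s4 vTot = m ^ Fcount k by rewrite /s4 frame_r // /s3; exec; rewrite frame_r.
have s4F : col s4 aF = col s' aF by rewrite /s4 frame_c // /s3; exec; rewrite frame_c.
rewrite bad s4j s4t (ctx_m cs4).
split.
  move=> i; rewrite ltnS leq_eqVlt => ik; case: ifP => _; exec; rewrite s4F;
  by case/predU1P: ik => [->|ik]; rewrite ?updx ?updn ?Is' ?(ltn_eqF ik) // -?(FnE j) ?eqb0 ?negbK.
by rewrite FcountS (FnE j); case: (F j); exec; rewrite ?addn0 // addn1 expnSr.
Qed.

(** * Initialisation of a case *)

Definition place (c j : nat) : nat :=
  if Fn j then (c %/ m ^ Fcount j) %% m else m.

Lemma place_le c j : place c j <= m.
Proof. by rewrite /place; case: ifP => // _; rewrite ltnW // ltn_mod. Qed.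

Lemma decodeP s : ctx s -> flags s -> forall j, j < n ->
  col (sem p_decode s) aA j = place (rg s vC) j.
Proof.
move=> cs fs; rewrite /p_decode; exec; set s1 := setr s _ _.
have cs1 : ctx s1 by apply: ctx_setr.
set body := If _ _ _.
pose I k s' := (forall j, j < k -> col s' aA j = place (rg s vC) j) /\
   rg s' vRest = rg s vC %/ m ^ Fcount k.
suff : I (rg s1 vN) (sem (For vJ vN body) s1) by rewrite (ctx_n cs1); case.
apply: (@for_ind I) => //.
  by split=> //; rewrite /Fcount big_nil expn0 divn1.
move=> k s' kn s'k sm [IA Ir]; rewrite (ctx_n cs1) in kn.
have cs' : ctx s' by apply: ctx_same sm _ _ _ cs1.
have fk : (col s' aF k == 0) = ~~ Fn k.
  by rewrite -fs // negbK (same_col sm).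
rewrite /body; exec; rewrite s'k fk; case Fk: (Fn k) => /=; exec; split=> //.
- move=> j; exec; rewrite ltnS leq_eqVlt => /predU1P[->|jk]; last by rewrite ?s'k updn ?IA // ltn_eqF.
  rewrite ?s'k updx /place Fk Ir (ctx_m cs') {1}(divn_eq (_ %/ m ^ _) m).
  by rewrite addKn.
- by rewrite /=; exec; rewrite Ir (ctx_m cs') FcountS Fk addn1 expnSr divnMA.
- move=> j; exec; rewrite ltnS leq_eqVlt => /predU1P[->|jk]; last by rewrite ?s'k updn ?IA // ltn_eqF.
  by rewrite ?s'k updx (ctx_m cs') /place Fk.
- by exec; rewrite FcountS Fk addn0.
Qed.

Lemma zero_machP s : ctx s -> forall x, x <= m ->
  col (sem p_zero_mach s) aL x = 0 /\ col (sem p_zero_mach s) aV x = 0.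
Proof.
move=> cs x xm; rewrite /p_zero_mach; exec; set body := Seq _ _.
pose I k s' := forall x, x < k -> col s' aL x = 0 /\ col s' aV x = 0.
have H : I (rg s vM) (sem (For vX vM body) s).
  apply: (@for_ind I) => // k s' kn s'k sm Is'.
  rewrite /body; exec => y; exec; rewrite s'k ltnS leq_eqVlt => /predU1P[->|yk].
    by rewrite !updx.
  by rewrite !updn ?ltn_eqF //; apply: Is'.
rewrite (ctx_m cs) in H; rewrite frame_r // (ctx_m cs).
move: xm; rewrite leq_eqVlt => /predU1P[->|xm]; first by rewrite !updx.
by rewrite !updn ?ltn_eqF //; apply: H.
Qed.

Lemma zero_countP s : ctx s -> forall j x, j < n -> x <= m ->
  ar (sem p_zero_count s) aC j x = 0.
Proof.
move=> cs.
pose I k s' := forall j x, j < k -> x <= m -> ar s' aC j x = 0.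
suff : I (rg s vN) (sem p_zero_count s) by rewrite (ctx_n cs).
apply: (@for_ind I) => // k s' kn s'k sm Is'.
have cs' : ctx s' by apply: ctx_same sm _ _ _ cs.
exec; set row := Put _ _ _ _.
pose I2 l s2 := (forall j x, j < k -> x <= m -> ar s2 aC j x = 0) /\
  forall x, x < l -> ar s2 aC k x = 0.
have : I2 (rg s' vM) (sem (For vX vM row) s').
  apply: (@for_ind I2) => // l s2 lm s2l sm2 [I2a I2b].
  have s2k : rg s2 vJ = k by rewrite (proj1 sm2).
  rewrite /row; exec; split => [j x jk xm|x xl]; exec; rewrite s2k s2l /upd2.
    by case: ifP => // _; apply: I2a.
  case: ifP => // /negbT; rewrite eqxx /= => xl'; apply: I2b.
  by rewrite ltn_neqAle xl' -ltnS.
rewrite (ctx_m cs') => -[Ha Hb] j x; exec; rewrite ltnS => jk xm.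
rewrite /upd2 !frame_r // s'k (ctx_m cs'); case: ifP => // /negbT.
rewrite negb_and; move: jk; rewrite leq_eqVlt => /predU1P[->|jk _]; last exact: Ha.
by rewrite eqxx /= => xm'; apply: Hb; rewrite ltn_neqAle xm'.
Qed.

Definition eN (j w : nat) : bool :=
  if insub j is Some j' then if insub w is Some w' then e j' w' else false
  else false.

Lemma eNE (j w : 'I_n) : eN j w = e j w.
Proof. by rewrite /eN !valK. Qed.

Lemma edgeN s u w : ctx s -> rg s u < n -> rg s w < n ->
  eval (Edge (Var u) (Var w)) s = eN (rg s u) (rg s w).
Proof.
by move=> cs un wn; rewrite (@edgeE _ _ _ (Ordinal un) (Ordinal wn)) // -eNE.
Qed.

Definition nbr (a : 'I_n -> nat) (j : 'I_n) x := \sum_(w < n) (e j w && (a w == x)).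

Lemma nbr_free a j x : (nbr a j x == 0) = free e a j x.
Proof.
rewrite /nbr sum_nat_eq0; apply: eq_forallb => w.
by rewrite /= eqb0 negb_and; case: (e j w).
Qed.

Record cons (s : st) (a : 'I_n -> nat) : Prop := Cons {
  cons_a : forall j : 'I_n, col s aA j = a j;
  cons_l : forall x, x <= m -> col s aL x = jload a x;
  cons_c : forall (j : 'I_n) x, x <= m -> ar s aC j x = nbr a j x
}.

Lemma loadsP s : ctx s -> (forall x, x <= m -> col s aL x = 0) ->
  forall x, x <= m ->
  col (sem p_loads s) aL x = jload (fun j : 'I_n => col s aA j) x.
Proof.
move=> cs L0.
pose I k s' := forall x, x <= m -> col s' aL x = \sum_(0 <= j < k) (col s aA j == x).
have : I (rg s vN) (sem p_loads s).
  apply: (@for_ind I) => //.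
    by move=> x xm; exec; rewrite big_nil L0.
  move=> k s' kn s'k sm Is'; exec => x xm; exec.
  rewrite s'k (same_col (q := aA) sm) // big_nat_recr //=.
  case: (altP (x =P col s aA k)) => [E|nx]; first by rewrite -E updx eqxx Is'.
  by rewrite updn // Is' // eq_sym (negbTE nx) addn0.
by rewrite (ctx_n cs) => H x xm; rewrite H // big_mkord.
Qed.

Lemma count_rowP s : ctx s -> rg s vJ < n ->
  let s' := sem p_count_row s in let j := rg s vJ in
  (forall x, ar s' aC j x = ar s aC j x + \sum_(0 <= w < n) (eN j w && (col s aA w == x))) /\
  (forall i x, i != j -> ar s' aC i x = ar s aC i x) /\
  (rg s' vOk != 0 <-> rg s vOk != 0 /\ forall w, w < n -> eN j w ->
     col s aA j = col s aA w -> col s aA j = m).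
Proof.
move=> cs jn s' j.
pose I k s' :=
  (forall x, ar s' aC j x = ar s aC j x + \sum_(0 <= w < k) (eN j w && (col s aA w == x))) /\
  (forall i x, i != j -> ar s' aC i x = ar s aC i x) /\
  (rg s' vOk != 0 <-> rg s vOk != 0 /\ forall w, w < k -> eN j w ->
     col s aA j = col s aA w -> col s aA j = m).
suff : I (rg s vN) s' by rewrite (ctx_n cs).
apply: (@for_ind I) => //.
  split=> [x|]; first by exec; rewrite big_nil addn0.
  by split=> //; exec; split=> [|[]].
move=> k s1 kn s1k sm [Ia [Ib Ic]]; rewrite (ctx_n cs) in kn.
have cs1 : ctx s1 by apply: ctx_same sm _ _ _ cs.
have s1j : rg s1 vJ = j by rewrite (proj1 sm).
have A1 : col s1 aA = col s aA by rewrite (same_col sm).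
rewrite sem_if edgeN ?s1j ?s1k // eqb0.
case ek: (eN j k) => /=; last first.
  exec; split=> [x|]; first by exec; rewrite big_nat_recr //= ek addn0.
  split; first by move=> i x ij; exec; apply: Ib.
  exec; rewrite Ic; split=> -[ok H]; split=> // w; last by move/leqW; apply: H.
  by rewrite ltnS leq_eqVlt => /predU1P[->|]; [rewrite ek|apply: H].
set s2 := seta s1 aC j (col s aA k) (ar s1 aC j (col s aA k) + 1).
have E2 : sem (Put aC (Var vJ) (Rd1 aA (Var vW))
             (EAdd (Rd aC (Var vJ) (Rd1 aA (Var vW))) (Num 1))) s1 = s2.
  by exec; rewrite s1j s1k A1.
have C2a x : ar s2 aC j x =
    ar s aC j x + \sum_(0 <= w < k.+1) (eN j w && (col s aA w == x)).
  rewrite /s2; exec; rewrite /upd2 eqxx big_nat_recr //= ek Ia.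
  by rewrite (eq_sym x); case: eqP => [->|_]; rewrite ?Ia ?addn0 ?addnA.
have C2b i x : i != j -> ar s2 aC i x = ar s aC i x.
  by move=> ij; rewrite /s2; exec; rewrite /upd2 (negbTE ij) /= Ib //.
exec1; rewrite E2; exec.
have -> : rg s2 = rg s1 by [].
have -> : col s2 aA = col s aA by rewrite -A1.
rewrite s1j s1k (ctx_m cs1) mulnb eqb0 eqb0 negbK.
case: ifP => b; exec; split=> //; split=> //; exec.
  rewrite Ic; split=> -[ok H]; split=> // w; last by move/leqW; apply: H.
  rewrite ltnS leq_eqVlt => /predU1P[-> _ Ak|]; last exact: H.
  by move: b; rewrite Ak eqxx /= negbK => /eqP.
split=> // -[_ /(_ k (ltnSn k) ek)]; move: b; case: eqP => // -> /=.
by case: eqP => // nm _ /(_ erefl).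
Qed.

Lemma countP s : ctx s -> (forall j x, j < n -> x <= m -> ar s aC j x = 0) ->
  let s' := sem p_count s in let a := fun j : 'I_n => col s aA j in
  (forall (j : 'I_n) x, x <= m -> ar s' aC j x = nbr a j x) /\
  (rg s' vOk != 0 <-> proper_upto m e a).
Proof.
move=> cs C0; rewrite /p_count; exec; set s1 := setr s _ _.
have cs1 : ctx s1 by apply: ctx_setr.
pose I k s' :=
  (forall j x, j < n -> x <= m -> ar s' aC j x =
      if j < k then \sum_(0 <= w < n) (eN j w && (col s aA w == x)) else 0) /\
  (rg s' vOk != 0 <-> forall j w, j < k -> w < n -> eN j w ->
     col s aA j = col s aA w -> col s aA j = m).
have : I (rg s1 vN) (sem (For vJ vN p_count_row) s1).
  apply: (@for_ind I) => //.
  move=> k s' kn s'k sm [Ia Ib]; rewrite (ctx_n cs1) in kn.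
  have cs' : ctx s' by apply: ctx_same sm _ _ _ cs1.
  have s'j : rg s' vJ < n by rewrite s'k.
  have A' : col s' aA = col s aA by rewrite (same_col sm).
  have [Ca [Cb Cc]] := count_rowP cs' s'j; rewrite s'k A' in Ca Cb Cc.
  split=> [j x jn xm|]; exec.
    case: (ltngtP j k) => jk; rewrite ltnS.
    - by rewrite Cb ?ltn_eqF // Ia // jk ltnW.
    - by rewrite Cb ?gtn_eqF // Ia // ltnNge (ltnW jk) /= leqNgt jk.
    - by rewrite jk Ca Ia -?jk // ltnn leqnn.
  rewrite Cc Ib; split=> [[H Hk] j w|H].
    by rewrite ltnS leq_eqVlt => /predU1P[->|jk]; [apply: Hk|apply: H].
  by split=> [j w jk|w]; apply: H => //; apply: ltnW.
rewrite (ctx_n cs1) => -[Ha Hb]; split.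
  move=> j x xm; rewrite Ha // ltn_ord big_mkord; apply: eq_bigr => w _.
  by rewrite eNE.
rewrite Hb; split=> [H j w jw|H j w jn wn].
  by apply: H => //; rewrite eNE.
rewrite -[j]/(val (Ordinal jn)) -[w]/(val (Ordinal wn)) eNE; exact: H.
Qed.

Lemma prepareP s : ctx s -> flags s ->
  let s' := sem p_prepare s in
  let a := fun j : 'I_n => place (rg s vC) j in
  [/\ cons s' a, (forall x, x <= m -> col s' aV x = 0) &
      (rg s' vOk != 0 <-> proper_upto m e a)].
Proof.
move=> cs fs s' a; rewrite /s' /p_prepare; exec.
set s1 := sem p_decode s; have cs1 : ctx s1 by apply: ctx_sem.
have A1 j : j < n -> col s1 aA j = place (rg s vC) j by apply: decodeP.
set s2 := sem p_zero_mach s1; have cs2 : ctx s2 by apply: ctx_sem.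
have Z2 := zero_machP cs1; rewrite -/s2 in Z2.
set s3 := sem p_zero_count s2; have cs3 : ctx s3 by apply: ctx_sem.
have Z3 := zero_countP cs2; rewrite -/s3 in Z3.
set s4 := sem p_loads s3; have cs4 : ctx s4 by apply: ctx_sem.
have L3 x : x <= m -> col s3 aL x = 0 by rewrite /s3 frame_c // => /Z2[].
have L4 := loadsP cs3 L3; rewrite -/s4 in L4.
have C4 j x : j < n -> x <= m -> ar s4 aC j x = 0 by rewrite /s4 frame_a //; apply: Z3.
have [C5 ok5] := countP cs4 C4.
have E4 : (fun j : 'I_n => col s4 aA j) = a.
  by apply: functional_extensionality => j; rewrite /s4 frame_c // /s3 frame_c // /s2 frame_c // A1.
have E3 : (fun j : 'I_n => col s3 aA j) = a by rewrite -E4 /s4 frame_c.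
rewrite E4 in C5 ok5; rewrite E3 in L4.
split=> //; last by move=> x xm; rewrite frame_c // /s4 frame_c // /s3 frame_c //; case: (Z2 x xm).
split=> //.
- by move=> j; rewrite frame_c // -(congr1 (fun f => f j) E4).
- by move=> x xm; rewrite frame_c // L4.
Qed.

(** * One round of the algorithm *)

Lemma chooseP s : ctx s -> let i := rg (sem p_choose s) vI in
  (i = m /\ forall x, x < m -> col s aV x != 0) \/
  [/\ i < m, col s aV i = 0 & forall x, x < m -> col s aV x = 0 ->
     (col s aL i).+1 * sp x <= (col s aL x).+1 * sp i].
Proof.
move=> cs; rewrite /p_choose; exec; set s1 := setr s _ _.
have cs1 : ctx s1 by apply: ctx_setr.
set body := If _ _ _.
pose I k s' := (rg s' vI = m /\ forall x, x < k -> col s aV x != 0) \/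
  [/\ rg s' vI < m, col s aV (rg s' vI) = 0 & forall x, x < k -> col s aV x = 0 ->
     (col s aL (rg s' vI)).+1 * sp x <= (col s aL x).+1 * sp (rg s' vI)].
suff : I (rg s1 vM) (sem (For vX vM body) s1) by rewrite (ctx_m cs1).
apply: (@for_ind I) => //.
  by left; rewrite /s1; exec; rewrite (ctx_m cs).
move=> k s' kn s'k sm Is'; rewrite (ctx_m cs1) in kn.
have cs' : ctx s' by apply: ctx_same sm _ _ _ cs1.
rewrite /I /body; exec; rewrite !speed_cell; exec.
have V1 : col s' aV = col s aV by rewrite (same_col sm).
have L1 : col s' aL = col s aL by rewrite (same_col sm).
rewrite s'k (ctx_m cs') V1 L1 (ctx_s cs' kn) eqb0.
have keep : col s aV k != 0 -> I k.+1 s'.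
  move=> Vk;   case: Is' => [[im Hx]|[im Vi Hx]]; [left|right]; split=> // x;
    rewrite ltnS leq_eqVlt => /predU1P[->|xk] //.
  - exact: Hx.
  - by move/eqP; rewrite (negbTE Vk).
  - exact: Hx.
case: eqP => Vk /=; exec; last by apply: keep; apply/eqP.
rewrite addn_eq0 !eqb0 !negbK addn1.
case: Is' => [[im Hx]|[im Vi Hx]].
  rewrite im eqxx /=; exec; right; split=> // x; rewrite ltnS leq_eqVlt => /predU1P[->|xk] //.
  by move/eqP; rewrite (negbTE (Hx _ xk)).
rewrite (ltn_eqF im) (ctx_s cs' im) addn1 /= -leqNgt.
set j := rg s' vI in im Vi Hx *.
case: (leqP ((col s aL j).+1 * sp k)) => lt; exec; right; split=> // x; rewrite ltnS leq_eqVlt => /predU1P[->|xk] // Vx.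
- exact: Hx.
have := Hx _ xk Vx => le.
rewrite -(leq_pmul2r (sp_gt0 im)).
rewrite mulnAC (leq_trans (leq_mul (ltnW lt) (leqnn (sp x)))) //.
by rewrite mulnAC (leq_trans (leq_mul le (leqnn (sp k)))) // mulnAC.
Qed.

Definition bfs_state (a : 'I_n -> nat) V0 i (s : st) : Prop :=
  bfs_inv m e F a V0 i (col s aV) (col s aQ) (col s aX) (col s aJ) (rg s vTail).

Definition extends (s s' : st) : Prop :=
  [/\ rg s vTail <= rg s' vTail,
      forall k, k < rg s vTail -> col s' aQ k = col s aQ k &
      forall y, col s aV y != 0 -> col s' aV y != 0].

Lemma scanP s a V0 i h : ctx s -> flags s -> cons s a ->
  (forall j, a j <= m) ->
  bfs_state a V0 i s -> h < rg s vTail -> rg s vX = col s aQ h ->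
  let s' := sem p_scan s in
  [/\ bfs_state a V0 i s', extends s s' &
      forall j, ~~ F j -> col s' aV (a j) = 0 -> ~~ free e a j (col s aQ h)].
Proof.
move=> cs fs co am Bs ht sx s'.
have [xm _ _] := bfs_queue Bs ht.
pose I k s2 := [/\ bfs_state a V0 i s2, extends s s2 &
   forall j : 'I_n, j < k -> ~~ F j -> col s2 aV (a j) = 0 -> ~~ free e a j (col s aQ h)].
suff : I (rg s vN) s'.
  by rewrite (ctx_n cs) => -[? ? H]; split=> // j; apply: H.
apply: (@for_ind I) => //.
move=> k s2 kn s2k sm [B2 E2 S2]; rewrite (ctx_n cs) in kn.
pose j := Ordinal kn.
have cs2 : ctx s2 by apply: ctx_same sm _ _ _ cs.
have A2 : col s2 aA k = a j by rewrite (same_col sm) // (cons_a co j).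
have X2 : rg s2 vX = col s aQ h by rewrite (proj1 sm).
have C2 : ar s2 aC k (col s aQ h) = nbr a j (col s aQ h).
  by rewrite (proj2 sm) // (cons_c co j) // ltnW.
have F2 : (col s2 aF k == 0) = ~~ F j by rewrite -(FnE j) -fs // negbK (same_col sm).
have [t2 q2 v2] := E2.
rewrite /I; exec; rewrite /bfs_state /extends; exec.
rewrite s2k A2 X2 C2 F2 nbr_free (ctx_m cs2).
rewrite !mulnb eqb0.
case: ifP => [/negP b|/negbFE/and3P[Fj /eqP Vj fr]]; exec.
  split=> // j'; rewrite ltnS leq_eqVlt => /predU1P[j'k|]; last exact: S2.
  have -> : j' = j by apply: val_inj.
  by move=> Fj /eqP Vj; apply/negP => fr; apply: b; rewrite Fj Vj.
have ht2 : h < rg s2 vTail by apply: leq_trans t2.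
have fr2 : free e a j (col s2 aQ h) by rewrite q2.
have [st_lt st_eq] := bfs_step B2 Fj Vj ht2 fr2.
rewrite -(q2 h ht) in st_lt st_eq *.
have mono y : col s aV y != 0 -> upd (col s2 aV) (a j) 1 y != 0.
  by move=> Vy; rewrite /upd; case: ifP => // _; apply: v2.
have scanned (j' : 'I_n) : j' < k.+1 -> ~~ F j' -> upd (col s2 aV) (a j) 1 (a j') = 0 ->
    ~~ free e a j' (col s2 aQ h).
  rewrite ltnS leq_eqVlt => /predU1P[j'k|j'k] Fj'.
    by have -> : j' = j; [apply: val_inj|rewrite updx].
  rewrite /upd q2 //; case: ifP => // _; exact: S2.
rewrite eqb0; case: ifP => lt; exec.
  split=> //; apply: st_eq; apply/eqP; rewrite eqn_leq am leqNgt; exact: lt.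
rewrite addn1; split=> //; first by apply: st_lt; apply: negbFE.
split=> //; first exact: leqW.
move=> l lt'; rewrite updn; first exact: q2.
by rewrite neq_ltn (leq_trans lt').
Qed.

Lemma searchP s a : ctx s -> flags s -> cons s a -> (forall j, a j <= m) ->
  rg s vI < m -> col s aV (rg s vI) = 0 -> col s aV m = 0 ->
  let s' := sem p_search s in
  bfs_state a (col s aV) (rg s vI) s' /\
  forall k j, k < rg s' vTail -> ~~ F j -> col s' aV (a j) = 0 ->
     ~~ free e a j (col s' aQ k).
Proof.
move=> cs fs co am im Vi Vm; rewrite /p_search; exec; set s1 := setr _ _ _.
have cs1 : ctx s1 by case: cs => ? ? ? ?; split.
have B1 : bfs_state a (col s aV) (rg s vI) s1.
  rewrite /bfs_state /s1; exec; exact: bfs_start.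
set body := If _ _ _.
pose I h s2 := bfs_state a (col s aV) (rg s vI) s2 /\
  forall k j, k < h -> k < rg s2 vTail -> ~~ F j -> col s2 aV (a j) = 0 ->
     ~~ free e a j (col s2 aQ k).
have : I (rg s1 vM) (sem (For vH vM body) s1).
  apply: (@for_ind I) => // h s2 hm s2h sm [B2 S2].
  have cs2 : ctx s2 by apply: ctx_same sm _ _ _ cs1.
  rewrite /body sem_if; exec; rewrite s2h eqb0.
  case: ltnP => ht /=; exec; last first.
    split=> // k j; rewrite ltnS leq_eqVlt => /predU1P[->|]; exec; last exact: S2.
    by rewrite ltnNge ht.
  set s3 := setr s2 vX (col s2 aQ h).
  have cs3 : ctx s3 by apply: ctx_setr.
  have same_c q : q \in [:: aA; aL; aF] -> col s3 q = col s q.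
    move=> Hq; rewrite /s3; exec; rewrite (same_col sm) ?/s1; last first.
      by move: Hq; rewrite !inE => /or3P[] /eqP->.
    by move: Hq; rewrite !inE => /or3P[] /eqP->; exec.
  have fs3 : flags s3 by move=> j jn; rewrite same_c //; apply: fs.
  have co3 : cons s3 a.
    case: co => c1 c2 c3; split=> [j|x xm|j x xm]; [by rewrite same_c|by rewrite same_c // c2|].
    by rewrite /s3; exec; rewrite (proj2 sm) // /s1; exec; apply: c3.
  have B3 : bfs_state a (col s aV) (rg s vI) s3 by [].
  have [B4 [t4 q4 v4] S4] := scanP cs3 fs3 co3 am B3 ht erefl.
  split; first exact: B4.
  move=> k j; exec; rewrite ltnS leq_eqVlt => /predU1P[-> _ Fj Vj|kh kt Fj Vj].
    by rewrite q4 //; apply: S4.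
  have kt2 : k < rg s2 vTail by apply: ltn_trans ht.
  rewrite q4 //; apply: S2 => //; apply/eqP; apply: contraT => /v4.
  by rewrite Vj.
(* By [bfs_size] the tail is at most [m], so the [m] rounds have scanned the whole queue. *)
rewrite (ctx_m cs1) => -[B S]; split=> // k j kt.
by apply: S => //; apply: leq_trans (bfs_size B).
Qed.

Lemma reassign_nbr (a : 'I_n -> nat) j x w z : x != a j ->
  nbr (reassign a j x) w z + (e w j && (z == a j)) = nbr a w z + (e w j && (z == x)).
Proof.
move=> nx; rewrite /nbr (bigD1 j) //= [in RHS](bigD1 j) //=.
rewrite {1}/reassign eqxx (eq_bigr (fun u => (e w u && (a u == z)) : nat)); last first.
  by move=> u /negbTE nu; rewrite /reassign nu.
by rewrite (eq_sym x) (eq_sym (a j)); case: (e w j) => /=; lia.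
Qed.

Lemma recountP s a (jb : 'I_n) x : ctx s -> cons s a -> rg s vJob = jb ->
  rg s vY = a jb -> rg s vX = x -> x <= m -> a jb <= m -> x != a jb ->
  forall (w : 'I_n) z, z <= m ->
    ar (sem p_recount s) aC w z = nbr (reassign a jb x) w z.
Proof.
move=> cs co sj sy sx xm ym nx.
pose I k s' := forall (w : 'I_n) z, z <= m ->
   ar s' aC w z = if w < k then nbr (reassign a jb x) w z else nbr a w z.
have : I (rg s vN) (sem p_recount s).
  apply: (@for_ind I) => //.
    by move=> w z zm; apply: cons_c co _ _ _.
  move=> k s' kn s'k sm Is'; rewrite (ctx_n cs) in kn.
  pose u := Ordinal kn.
  have cs' : ctx s' by apply: ctx_same sm _ _ _ cs.
  have s'j : rg s' vJob = jb by rewrite (proj1 sm).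
  have s'x : rg s' vX = x by rewrite (proj1 sm).
  have s'y : rg s' vY = a jb by rewrite (proj1 sm).
  have Ek w z : ~~ e u jb \/ w != u -> z <= m ->
      (if w < k.+1 then nbr (reassign a jb x) w z else nbr a w z) =
      (if w < k then nbr (reassign a jb x) w z else nbr a w z).
    move=> uw zm; rewrite ltnS leq_eqVlt; case: (altP (val w =P k)) => [wk|] //=.
    have wu : w = u by apply: val_inj.
    rewrite wu ltnn; have := reassign_nbr u z nx; case: uw; last by rewrite wu eqxx.
    by move/negbTE ->; rewrite !addn0.
  rewrite /I sem_if (edgeE (i := u) cs' s'j s'k) e_sym.
  case eu: (e u jb); exec; move=> w z zm; exec; last by rewrite Ek ?eu ?Is' //; left.
  rewrite s'k s'x s'y /upd2.
  case: (altP (val w =P k)) => [wk|wk] /=; last first.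
    by rewrite Ek ?Is' //; right; rewrite -val_eqE.
  have wu : w = u by apply: val_inj.
  have k1 : k < k.+1 by [].
  rewrite wu k1 eqxx /=; have := reassign_nbr u z nx; rewrite eu /=.
  have Iu z' : z' <= m -> ar s' aC k z' = nbr a u z'.
    by move=> z'm; have := Is' u z' z'm; rewrite ltnn.
  (* The job [jb] is itself counted, so the truncated decrement is exact. *)
  have pos : 0 < nbr a u (a jb) by rewrite /nbr (bigD1 jb) //= eu eqxx.
  rewrite (negbTE nx) Iu // Iu // Iu //.
  case: (altP (z =P x)) => [->|zx]; first by rewrite (negbTE nx); lia.
  by case: (altP (z =P a jb)) => [->|zy]; lia.
by rewrite (ctx_n cs) => H w z zm; rewrite H // ltn_ord.
Qed.

Lemma moveP s a (jb : 'I_n) x : ctx s -> cons s a -> rg s vJob = jb ->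
  rg s vY = a jb -> rg s vX = x -> x <= m -> a jb <= m -> x != a jb ->
  cons (sem p_move s) (reassign a jb x).
Proof.
move=> cs co sj sy sx xm ym nx; rewrite /p_move; exec.
set s1 := sem p_recount s.
have C1 := recountP cs co sj sy sx xm ym nx.
split.
- move=> j; exec; rewrite /s1 !frame_r // frame_c // sj sx /upd /reassign.
  by rewrite -val_eqE /=; case: ifP => // _; apply: cons_a co j.
- move=> z zm; exec; rewrite /s1 !frame_r // frame_c // sx sy.
  have := reassign_jload z nx.
  have pos : 0 < jload a (a jb) by rewrite /jload (bigD1 jb) //= eqxx.
  rewrite !(cons_l co) // /upd (negbTE nx) !(cons_l co) //.
  case: (altP (z =P x)) => [->|zx]; first by rewrite (negbTE nx); lia.
  by case: (altP (z =P a jb)) => [->|zy]; lia.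
- by move=> w z zm; exec; rewrite C1.
Qed.

Lemma walkP s a V0 : ctx s -> cons s a -> (forall j, a j <= m) ->
  bfs_state a V0 (rg s vI) s -> col s aV m != 0 -> V0 m = 0 ->
  proper_upto m e a -> entry_free e F (entry m V0) a ->
  exists r a', aug_inv m e F a (entry m V0) (col s aQ) (rg s vTail) r (rg s vI) a' /\
     cons (sem p_walk s) a'.
Proof.
move=> cs co am Bs Vm V0m ap ae; rewrite /p_walk; exec; set s1 := setr _ _ _.
have cs1 : ctx s1 by apply: ctx_setr.
set body := If _ _ _.
pose I k s' := exists r a', [/\ aug_inv m e F a (entry m V0) (col s aQ) (rg s vTail) r (rg s' vY) a',
   cons s' a' & r + k <= rg s vTail \/ rg s' vY = rg s vI].
have : I (rg s1 vM) (sem (For vK vM body) s1).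
  apply: (@for_ind I) => //.
    exists (rg s vTail), a; rewrite /s1; exec; rewrite (ctx_m cs) addn0; split.
    - exact: aug_start.
    - by case: co => c1 c2 c3; split.
    - by left.
  move=> k s' km s'k sm [r [a' [Au co' rk]]].
  have cs' : ctx s' by apply: ctx_same sm _ _ _ cs1.
  have s'i : rg s' vI = rg s vI by rewrite (proj1 sm).
  have X' : col s' aX = col s aX by rewrite (same_col sm).
  have J' : col s' aJ = col s aJ by rewrite (same_col sm).
  rewrite /body sem_if; exec; rewrite s'i eqb0 negbK.
  case: eqP => [yi|/eqP yi]; exec.
    exists r, a'; split; exec => //; last by right.
    by case: co' => c1 c2 c3; split.
  have [j [r' [Jy ajy nx xm [r'r Au']]]] := aug_step e_sym e_irr Bs Vm V0m Au yi.
  rewrite X' J' Jy; set s2 := setr (setr s' vX _) vJob _.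
  have cs2 : ctx s2 by case: cs' => ? ? ? ?; split.
  have co2 : cons s2 a' by case: co' => c1 c2 c3; split.
  have co3 : cons (sem p_move s2) (reassign a' j (col s aX (rg s' vY))).
    apply: moveP => //.
    - exact: ltnW.
    - exact: aug_le Au _.
    - by rewrite ajy.
  exists r', (reassign a' j (col s aX (rg s' vY))); exec.
  rewrite frame_r //; rewrite /s2; exec; split=> //.
  - by case: co3 => c1 c2 c3; split.
  - by left; case: rk => [|E]; [lia|rewrite E eqxx in yi].
rewrite (ctx_m cs1) => -[r [a' [Au co' rk]]]; exists r, a'; split=> //.
rewrite -[X in aug_inv _ _ _ _ _ _ _ _ X _](aug_done Au (bfs_root Bs) (bfs_pos Bs) rk) //.
exact: bfs_size Bs.
Qed.

Lemma resetP s a V0 : ctx s -> bfs_state a V0 (rg s vI) s -> V0 m = 0 ->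
  forall y, y <= m -> (col (sem p_reset s) aV y == 0) = (V0 y == 0).
Proof.
move=> cs Bs V0m; rewrite /p_reset; exec.
set body := If _ _ _.
pose I k s' := [/\ forall k', k' < k -> k' < rg s vTail -> col s' aV (col s aQ k') = 0,
   forall y, col s aV y = 0 -> col s' aV y = 0 &
   forall y, (forall k', k' < rg s vTail -> y <> col s aQ k') -> col s' aV y = col s aV y].
have : I (rg s vM) (sem (For vK vM body) s).
  apply: (@for_ind I) => //.
  move=> k s' km s'k sm [Ia Ib Ic].
  have t' : rg s' vTail = rg s vTail by rewrite (proj1 sm).
  have Q' : col s' aQ = col s aQ by rewrite (same_col sm).
  rewrite /I /body; exec; rewrite t' Q' s'k eqb0.
  case: ltnP => kt /=; exec.
    split=> [k'||y ny].
    - rewrite ltnS leq_eqVlt => /predU1P[->|k'k] k't; first by rewrite updx.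
      by rewrite /upd; case: ifP => // _; apply: Ia.
    - by move=> y Vy; rewrite /upd; case: ifP => // _; apply: Ib.
    - by rewrite updn ?Ic //; apply/eqP; apply: ny.
  split=> // k'; rewrite ltnS leq_eqVlt => /predU1P[->|]; last exact: Ia.
  by rewrite ltnNge kt.
rewrite (ctx_m cs) => -[Ia Ib Ic] y ym.
rewrite frame_r // (ctx_m cs).
move: ym; rewrite leq_eqVlt => /predU1P[->|ym]; first by rewrite updx V0m eqxx.
rewrite updn ?(ltn_eqF ym) //.
case: (altP (V0 y =P 0)) => V0y.
  case: (altP (col s aV y =P 0)) => [/Ib ->//|Vy].
  have [k kt ->] := bfs_new Bs ym Vy V0y.
  by rewrite Ia ?eqxx // (leq_trans kt) // (bfs_size Bs).
rewrite Ic; first by rewrite (negbTE (bfs_mono Bs V0y)).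
by move=> k kt E; have [_ _] := bfs_queue Bs kt; rewrite -E => /eqP; rewrite (negbTE V0y).
Qed.

(** * Invariant and termination of the rounds *)

Hypothesis F_simp : forall v, ~~ F v -> simplicial e v.

Definition agrees c (tau : 'I_n -> nat) := forall j, F j -> place c j = tau j.

(** The last field carries optimality: already the partial placement costs no more than any schedule
    that extends case [c], so a complete one is the best of the case. *)
Record solve_inv c (s : st) (a : 'I_n -> nat) : Prop := SolveInv {
  sv_ctx : ctx s;
  sv_flags : flags s;
  sv_cons : cons s a;
  sv_le : forall j, a j <= m;
  sv_Vm : col s aV m = 0;
  sv_proper : proper_upto m e a;
  sv_entry : entry_free e F (entry m (col s aV)) a;
  sv_fixed : forall j : 'I_n, F j -> a j = place c j;
  sv_mle : forall tau, total_proper m e tau -> agrees c tau -> mle m sp a tau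
}.

Definition all_dead (s : st) := forall x, x < m -> col s aV x != 0.
(** Live machines plus unscheduled jobs: a failed search lowers the first summand, a successful one
    the second. *)
Definition measure (s : st) (a : 'I_n -> nat) :=
  \sum_(x < m) (col s aV x == 0) + jload a m.

Lemma cons_same W A s s' a : same W A s s' -> aA \notin A -> aL \notin A ->
  aC \notin A -> cons s a -> cons s' a.
Proof.
move=> sm nA nL nC [c1 c2 c3]; split=> [j|x xm|j x xm].
- by rewrite (same_col sm).
- by rewrite (same_col sm) ?c2.
- by rewrite (proj2 sm) ?c3.
Qed.

Lemma flags_same W A s s' : same W A s s' -> aF \notin A -> flags s -> flags s'.
Proof. by move=> sm nF fs j jn; rewrite (same_col sm) // fs. Qed.

Lemma roundP c s a : solve_inv c s a ->
  exists a', solve_inv c (sem p_round s) a' /\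
    (all_dead (sem p_round s) \/
     ~ all_dead s /\ measure (sem p_round s) a' < measure s a).
Proof.
move=> S; have [cs fs co am Vm ap ae af amle] := S.
have csr : ctx (sem p_round s) by apply: ctx_sem.
have fsr : flags (sem p_round s) by apply: flags_same (semP _ _) _ _.
move: csr fsr; rewrite /p_round sem_seq; set s1 := sem p_choose s.
have cs1 : ctx s1 by apply: ctx_sem.
have fs1 : flags s1 by apply: flags_same (semP _ _) _ _.
have co1 : cons s1 a by apply: cons_same (semP _ _) _ _ _ _.
have V1 : col s1 aV = col s aV by rewrite /s1 frame_c.
have Ch := chooseP cs; rewrite -/s1 in Ch.
rewrite sem_if; exec; rewrite (ctx_m cs1) eqb0.
case: Ch => [[im dead]|[im Vi best]].
  rewrite im ltnn /=; set s2 := setr s1 _ _ => cs2 fs2.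
  exists a; split; last by left=> x; rewrite /s2; exec; rewrite V1; apply: dead.
  by split=> //; rewrite /s2; exec; rewrite ?V1 //; case: co1 => c1 c2 c3; split.
rewrite im /=; set s2 := sem p_search s1.
have cs2 : ctx s2 by apply: ctx_sem.
have co2 : cons s2 a by apply: cons_same (semP _ _) _ _ _ _.
have Vi1 : col s1 aV (rg s1 vI) = 0 by rewrite V1.
have Vm1 : col s1 aV m = 0 by rewrite V1.
have [B2 scan] := searchP cs1 fs1 co1 am im Vi1 Vm1; rewrite -/s2 V1 in B2 scan.
have i2 : rg s2 vI = rg s1 vI by rewrite /s2 frame_r.
set i := rg s1 vI in im Vi best Vi1 B2 i2 *.
have Bi : col s2 aV i != 0.
  by have [_ + _] := bfs_queue B2 (bfs_pos B2); rewrite (bfs_root B2).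
have nd : ~ all_dead s by move/(_ i im); rewrite Vi.
rewrite (ctx_m cs2); case: eqP => [V2m|/eqP V2m].
  set s3 := setr s2 _ _ => cs3 fs3; exists a; split.
    split=> //.
    - by case: co2 => c1 c2 c3; split.
    - exact: bfs_fail am B2 V2m ae scan.
  right; split=> //; rewrite /measure /s3; exec; rewrite ltn_add2r.
  (* The root [i] was live and is now dead, which makes the decrease strict. *)
  rewrite (bigD1 (Ordinal im)) //= [in X in _ < X](bigD1 (Ordinal im)) //=.
  rewrite (negbTE Bi) Vi eqxx ltnS; apply: leq_sum => x _.
  case: (altP (col s aV x =P 0)) => [_|/(bfs_mono B2)/negbTE ->] //.
  by case: (_ == 0).
rewrite sem_seq; set s3 := sem p_walk s2; set s4 := sem p_reset s3 => cs4 fs4.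
have := @walkP s2 a (col s aV) cs2 co2 am; rewrite i2 => /(_ B2 V2m Vm ap ae).
case=> r [a' [Au co3]]; rewrite -/s3 in co3.
have B3 : bfs_state a (col s aV) (rg s3 vI) s3.
  have E3 q : q \in [:: aV; aQ; aX; aJ] -> col s3 q = col s2 q.
    by rewrite !inE => /or4P[] /eqP->; rewrite /s3 frame_c.
  have -> : rg s3 vI = i by rewrite /s3 frame_r.
  have t3 : rg s3 vTail = rg s2 vTail by rewrite /s3 frame_r.
  by rewrite /bfs_state !E3 // t3.
have cs3 : ctx s3 by apply: ctx_sem.
have R4 := resetP cs3 B3 Vm; rewrite -/s4 in R4.
(* The link out of the pool names an unscheduled job. *)
have un : jload a m != 0.
  have [k' _ [_ [j [_ _ ajm _]]]] := bfs_last B2 V2m.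
  by rewrite /jload (bigD1 j) //= ajm eqxx.
exists a'; split.
  split=> //.
  - exact: (cons_same (semP p_reset s3) isT isT isT co3).
  - exact: aug_le Au.
  - by apply/eqP; rewrite R4 // Vm.
  - exact: aug_proper Au.
  - have <- : entry m (col s aV) = entry m (col s4 aV); last exact: aug_entry Au.
    apply: functional_extensionality => x; rewrite /entry; case: ltnP => //= xm.
    by rewrite R4 // ltnW.
  - by move=> j Fj; rewrite (aug_fixed Au) // af.
  - move=> tau tp ag.
    have best' x : x < m -> col s aV x = 0 ->
        (jload a i).+1 * sp x <= (jload a x).+1 * sp i.
      by move=> xm Vx; rewrite -(cons_l co (ltnW im)) -(cons_l co (ltnW xm)); apply: best.
    apply: (augment_mle e_sym F_simp sp_gt0 am ae tp _ un im best').
    + by move=> j Fj; rewrite af // ag.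
    + exact: aug_load Au.
    + exact: amle.
right; split=> //; rewrite /measure.
have -> : \sum_(x < m) (col s4 aV x == 0) = \sum_(x < m) (col s aV x == 0).
  by apply: eq_bigr => x _; rewrite R4 // ltnW.
rewrite ltn_add2l; have := aug_load Au m; rewrite eqxx (gtn_eqF im); lia.
Qed.

Lemma solveP c s a : solve_inv c s a -> rg s vNM = n + m -> measure s a <= n + m ->
  exists a', solve_inv c (sem p_solve s) a' /\ all_dead (sem p_solve s).
Proof.
move=> S nm le.
pose I k s' := exists a', solve_inv c s' a' /\
   (all_dead s' \/ measure s' a' + k <= n + m).
have : I (rg s vNM) (sem p_solve s).
  apply: (@for_ind I) => //.
    exists a; split; last by right; rewrite addn0.
    by case: S => cs ? co *; split=> //; [apply: ctx_setr|case: co => *; split].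
  move=> k s' kn s'k sm [a' [S' D']].
  have [a2 [S2 D2]] := roundP S'; exists a2; split.
    by case: S2 => cs ? co *; split=> //; [apply: ctx_setr|case: co => *; split].
  (* Once all machines are dead they remain so: the second alternative of [roundP] requires a live
     machine before the round. *)
  have D3 : all_dead (sem p_round s') \/ measure (sem p_round s') a2 + k.+1 <= n + m.
    case: D2 => [|[nd lt]]; first by left.
    by case: D' => [//|le']; right; rewrite addnS (leq_trans _ le') // ltn_add2r.
  by case: D3; [left|right].
rewrite nm => -[a' [S' D']]; exists a'; split=> //.
case: D' => // D' x xm.
have : \sum_(x < m) (col (sem p_solve s) aV x == 0) = 0.
  by move: D'; rewrite /measure; lia.
by rewrite (bigD1 (Ordinal xm)) //=; case: (_ == 0).
Qed.

(** * Recording the best case *)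

(* [num / den] is the makespan of [b]. *)
Definition value_of (b : 'I_n -> nat) num den : Prop :=
  (exists y, [/\ y < m, num = jload b y & den = sp y]) /\
  forall x, x < m -> jload b x * den <= num * sp x.

Lemma value_mle a b n1 d1 n2 d2 : value_of a n1 d1 -> value_of b n2 d2 ->
  n1 * d2 <= n2 * d1 -> mle m sp a b.
Proof.
move=> [[z [zm _ ->]] Ha] [[y [ym -> ->]] _] le x xm; exists y => //.
rewrite -(leq_pmul2r (sp_gt0 zm)) mulnAC.
rewrite (leq_trans (leq_mul (Ha x xm) (leqnn (sp y)))) // mulnAC.
by rewrite (leq_trans (leq_mul le (leqnn (sp x)))) // mulnAC.
Qed.

Lemma valueP s a : ctx s -> cons s a ->
  value_of a (rg (sem p_value s) vNum) (rg (sem p_value s) vDen).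
Proof.
move=> cs co; rewrite /p_value; exec; rewrite !speed_cell; exec.
set s1 := setr _ _ _; set body := If _ _ _.
have cs1 : ctx s1 by case: cs => ? ? ? ?; split.
pose I k s' := (exists y, [/\ y < m, rg s' vNum = jload a y & rg s' vDen = sp y]) /\
  forall x, x < k -> jload a x * rg s' vDen <= rg s' vNum * sp x.
suff : I (rg s1 vM) (sem (For vX vM body) s1) by rewrite (ctx_m cs1).
apply: (@for_ind I) => //.
  split=> //; exists 0; rewrite /s1; exec; split=> //; first exact: cons_l co _ _.
  exact: ctx_s cs _ m_gt0.
move=> k s' km s'k sm [Ia Ib]; rewrite (ctx_m cs1) in km.
have cs' : ctx s' by apply: ctx_same sm _ _ _ cs1.
have L1 : col s' aL = col s aL by rewrite (same_col sm).
have L' : col s' aL k = jload a k by rewrite L1 (cons_l co (ltnW km)).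
rewrite /I /body; exec; rewrite !speed_cell; exec.
rewrite s'k L' (ctx_s cs' km) eqb0.
case: (leqP (jload a k * _)) => lt; exec.
  split=> // x; rewrite ltnS leq_eqVlt => /predU1P[->|] //; exact: Ib.
split; first by exists k.
move=> x; rewrite ltnS leq_eqVlt => /predU1P[->|xk]; first by rewrite mulnC.
have den0 : 0 < rg s' vDen by case: Ia => y [ym _ ->]; apply: sp_gt0.
rewrite -(leq_pmul2r den0) mulnAC (leq_trans (leq_mul (Ib x xk) (leqnn (sp k)))) //.
by rewrite mulnAC (leq_trans (leq_mul (ltnW lt) (leqnn (sp x)))) // mulnAC.
Qed.

Definition best_inv c (s : st) : Prop :=
  if rg s vBest == 0 then
    forall c' tau, c' < c -> total_proper m e tau -> ~ agrees c' tau
  else let b := fun j : 'I_n => col s aB j in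
    [/\ total_proper m e b, value_of b (rg s vBNum) (rg s vBDen) &
      forall c' tau, c' < c -> total_proper m e tau -> agrees c' tau -> mle m sp b tau].

Lemma copyP s (a : 'I_n -> nat) : ctx s -> (forall j : 'I_n, col s aA j = a j) ->
  forall j : 'I_n, col (sem p_copy s) aB j = a j.
Proof.
move=> cs Aa.
pose I k s' := forall j : 'I_n, j < k -> col s' aB j = a j.
have : I (rg s vN) (sem p_copy s).
  apply: (@for_ind I) => // k s' kn s'k sm Is'; rewrite (ctx_n cs) in kn.
  move=> j; exec; rewrite s'k (same_col (q := aA) sm) // ltnS leq_eqVlt.
  case/predU1P => [jk|jk]; first by rewrite -jk updx Aa.
  by rewrite updn ?(ltn_eqF jk) //; apply: Is'.
by rewrite (ctx_n cs) => H j; apply: H.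
Qed.

Lemma best_inv_eq c s s' : rg s' vBest = rg s vBest -> rg s' vBNum = rg s vBNum ->
  rg s' vBDen = rg s vBDen -> col s' aB = col s aB -> best_inv c s -> best_inv c s'.
Proof. by rewrite /best_inv => -> -> -> ->. Qed.

Lemma best_skip c s : best_inv c s ->
  (forall tau, total_proper m e tau -> ~ agrees c tau) -> best_inv c.+1 s.
Proof.
rewrite /best_inv; case: ifP => _.
  move=> H none c' tau; rewrite ltnS leq_eqVlt => /predU1P[->|]; [exact: none|exact: H].
case=> tp val H none; split=> // c' tau; rewrite ltnS leq_eqVlt => /predU1P[->|].
  by move=> tpt /(none _ tpt).
exact: H.
Qed.

Lemma recordP c s a : solve_inv c s a -> all_dead s -> rg s vOk != 0 ->
  best_inv c s -> best_inv c.+1 (sem p_record s).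
Proof.
move=> S dead ok best; have [cs fs co am Vm ap ae af amle] := S.
rewrite /p_record sem_if; exec; rewrite (ctx_m cs) (cons_l co) //.
rewrite muln_eq0 (negbTE ok) eqb0 /=.
case: eqP => [un|/eqP un] /=; last first.
  apply: best_skip.
    by apply: best_inv_eq best; exec.
  (* With every machine dead the load hypothesis of [no_augment] is vacuous, so a job left in the
     pool rules out any extension of the case. *)
  move=> tau tp ag; case/eqP: un.
  apply: (no_augment e_sym F_simp _ am ae tp).
  - by rewrite /entry ltnn.
  - by move=> j Fj; rewrite af // ag.
  - by move=> x xm; rewrite /entry xm dead.
set s1 := sem p_value s.
have cs1 : ctx s1 by apply: ctx_sem.
have co1 : cons s1 a by apply: cons_same (semP _ _) _ _ _ _.
have val := valueP cs co; rewrite -/s1 in val.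
have best1 : best_inv c s1.
  by apply: best_inv_eq best; rewrite /s1 ?frame_r ?frame_c.
have lt_am j : a j < m.
  rewrite ltn_neqAle am andbT; apply/eqP => ajm.
  by move: un; rewrite /jload (bigD1 j) //= ajm eqxx.
have tpa : total_proper m e a.
  split=> // j w jw; apply/eqP => E; have := ap _ _ jw E.
  by move=> ajm; have := lt_am j; rewrite ajm ltnn.
rewrite addn_eq0 !eqb0 -leqNgt.
case: ifP => b; last first.
  set s2 := setr _ _ _; set s3 := sem p_copy s2.
  have cs2 : ctx s2 by case: cs1 => ? ? ? ?; split.
  have B3 : (fun j : 'I_n => col s3 aB j) = a.
    apply: functional_extensionality => j; apply: copyP => // j'.
    by rewrite -(cons_a co1 j').
  rewrite /best_inv /s3 !frame_r // /s2; exec; rewrite -/s2 -/s3 B3; split=> //.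
  move=> c' tau; rewrite ltnS leq_eqVlt => /predU1P[->|c'c] tp ag; first exact: amle.
  move: b best1; rewrite /best_inv; case: (rg s1 vBest == 0) => /= [_|b].
    by move/(_ _ _ c'c tp).
  case=> _ valb /(_ _ _ c'c tp ag); apply: mle_trans => //.
  apply: value_mle val valb _.
  by apply: ltnW; rewrite ltnNge b.
case/andP: b => /negbTE b0 le; apply: (@best_inv_eq _ s1); exec => //.
move: best1; rewrite /best_inv b0; case=> tpb valb H; split=> //.
move=> c' tau; rewrite ltnS leq_eqVlt => /predU1P[->|c'c] tp ag; last exact: H tp ag.
apply: mle_trans (amle _ tp ag) => //; exact: value_mle valb val le.
Qed.

Lemma caseP c s : ctx s -> flags s -> rg s vNM = n + m -> rg s vC = c ->
  best_inv c s -> best_inv c.+1 (sem p_case s).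
Proof.
move=> cs fs nm sc best; rewrite /p_case; exec.
have [co1 V1 ok1] := prepareP cs fs; rewrite sc in co1 ok1.
set s1 := sem p_prepare s in co1 V1 ok1 *.
have cs1 : ctx s1 by apply: ctx_sem.
have fs1 : flags s1 by exact: (flags_same (semP p_prepare s) isT fs).
have best1 : best_inv c s1.
  by apply: best_inv_eq best; rewrite /s1 ?(frame_r, frame_c).
have nm1 : rg s1 vNM = n + m by rewrite /s1 frame_r.
clearbody s1.
set a := fun j : 'I_n => place c j in co1 ok1.
have placeF (j : 'I_n) : place c j <> m -> F j.
  by rewrite /place -(FnE j); case: (Fn j).
have S2 : proper_upto m e a ->
    exists a', solve_inv c (sem p_solve s1) a' /\ all_dead (sem p_solve s1).
  move=> ap; apply: (@solveP c s1 a) nm1 _.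
    split=> //.
    - by move=> j; apply: place_le.
    - by rewrite V1.
    - by move=> j x _ /andP[xm]; rewrite V1 // ltnW.
    (* At the start the machines hold only jobs of [F], which [tau] puts in the same places; each
       machine is its own witness. *)
    - move=> tau tp ag x xm; exists x => //; apply: leq_mul => //.
      apply: leq_sum => j _; case: (altP (a j =P x)) => // E.
      have Fj : F j by apply: placeF => E'; move: xm; rewrite -E /a E' ltnn.
      by rewrite -(ag j Fj) (E : place c j = x) eqxx.
  rewrite /measure addnC leq_add //.
    by rewrite /jload -[X in _ <= X]card_ord -sum1_card leq_sum // => j _; case: (_ == _).
  by rewrite -[X in _ <= X]card_ord -sum1_card leq_sum // => j _; case: (_ == _).
set s2 := sem p_solve s1 in S2 *.
have ok2 : rg s2 vOk = rg s1 vOk by rewrite /s2 frame_r.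
have best2 : best_inv c s2.
  by apply: best_inv_eq best1; rewrite /s2 ?(frame_r, frame_c).
clearbody s2; rewrite -ok2 in ok1.
have [ok|ok] := eqVneq (rg s2 vOk) 0.
  rewrite /p_record sem_if; exec; rewrite ok mul0n /=.
  apply: best_skip; first by apply: best_inv_eq best2; exec.
  (* Two adjacent jobs on one machine are both in [F] at this stage, so an agreeing [tau] would
     inherit their conflict. *)
  move=> tau [tm tp] ag.
  suff : rg s2 vOk != 0 by rewrite ok.
  apply/ok1 => j w jw E; apply/eqP; apply: contraT => /eqP nj.
  have Fj := placeF j nj.
  have Fw : F w by apply: placeF => Ew; apply: nj; rewrite E.
  by case/eqP: (tp _ _ jw); rewrite -(ag j Fj) -(ag w Fw).
have /ok1/S2[a' [S2' D2]] := ok.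
exact: recordP S2' D2 ok best2.
Qed.

(** * Every schedule belongs to some case *)

(** The case number is built along the jobs: the machine of each further flagged job becomes a new
    leading digit in base [m]. *)
Lemma agrees_ex (tau : 'I_n -> nat) : (forall j, tau j < m) ->
  exists2 c, c < m ^ #|F| & agrees c tau.
Proof.
move=> tm; pose tN j := if insub j is Some i then tau i else 0.
have tNm j : tN j < m by rewrite /tN; case: insubP.
suff [c cm H] : exists2 c, c < m ^ Fcount n & forall j, j < n -> Fn j ->
    (c %/ m ^ Fcount j) %% m = tN j.
  exists c; first by rewrite -Fcount_card.
  move=> j Fj; rewrite /place FnE Fj H ?FnE //; by rewrite /tN valK.
elim: (n) => [|k [c ck IH]].
  by exists 0 => //; rewrite expn_gt0 m_gt0.
rewrite FcountS; case Fk: (Fn k); last first.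
  exists c; first by rewrite addn0.
  move=> j; rewrite ltnS leq_eqVlt => /predU1P[->|jk]; first by rewrite Fk.
  exact: IH.
have mk0 : 0 < m ^ Fcount k by rewrite expn_gt0 m_gt0.
exists (tN k * m ^ Fcount k + c).
  rewrite addn1 expnS; apply: (@leq_trans ((tN k).+1 * m ^ Fcount k)).
    by rewrite mulSn addnC ltn_add2r.
  by rewrite leq_mul2r tNm orbT.
move=> j; rewrite ltnS leq_eqVlt => /predU1P[-> _|jk Fj].
  by rewrite divnMDl // divn_small // addn0 modn_small.
have lt : Fcount j < Fcount k.
  have mono i l : i <= l -> Fcount i <= Fcount l.
    by move/subnK <-; elim: (l - i) => // d IHd; rewrite addSn FcountS (leq_trans IHd) ?leq_addr.
  by have := mono _ _ jk; rewrite FcountS Fj addn1.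
(* Shifted down to the digit of [j], the new leading term is still a multiple of [m], so it vanishes
   modulo [m]. *)
have -> : m ^ Fcount k = m ^ (Fcount k - (Fcount j).+1) * m * m ^ Fcount j.
  by rewrite -expnSr -expnD; congr (m ^ _); lia.
rewrite mulnA divnMDl ?expn_gt0 ?m_gt0 // mulnA modnMDl; exact: IH.
Qed.

Lemma casesP s : ctx s -> flags s -> rg s vNM = n + m -> rg s vTot = m ^ #|F| ->
  let s' := sem p_cases s in
  if rg s' vBest == 0 then forall tau, ~ total_proper m e tau
  else let b := fun j : 'I_n => col s' aB j in
    total_proper m e b /\ forall tau, total_proper m e tau -> mle m sp b tau.
Proof.
move=> cs fs nm tot; rewrite /p_cases; exec; set s1 := setr _ _ _.
have cs1 : ctx s1 by apply: ctx_setr.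
pose I k s' := best_inv k s'.
have : I (rg s1 vTot) (sem (For vC vTot p_case) s1).
  apply: (@for_ind I vC vTot p_case s1 isT).
    by rewrite /I /best_inv /s1; exec.
  move=> k s' kt s'k sm Is'.
  apply: (@best_inv_eq _ (sem p_case s')) _ _ _ _ (caseP _ _ _ s'k Is').
  1-4: by exec.
  - by apply: ctx_same sm _ _ _ cs1.
  - by apply: flags_same sm _ _.
  - by rewrite (proj1 sm).
have -> : rg s1 vTot = m ^ #|F| by rewrite /s1; exec.
rewrite /I /best_inv; case: ifP => _.
  move=> H tau tp; case: (tp) => tm _.
  by have [c cm ag] := agrees_ex tm; apply: H cm tp ag.
case=> tpb _ H; split=> // tau tp; case: (tp) => tm _.
by have [c cm ag] := agrees_ex tm; apply: H cm tp ag.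
Qed.

(** The two values after [p_init] are loop limits of [p_cases]; the time bound needs them. *)
Theorem algorithmP s : ctx s ->
  let s' := sem (Seq p_init p_cases) s in
  [/\ rg (sem p_init s) vTot = m ^ #|F|, rg (sem p_init s) vNM = n + m &
  if rg s' vBest == 0 then forall tau, ~ total_proper m e tau
  else let b := fun j : 'I_n => col s' aB j in
    total_proper m e b /\ forall tau, total_proper m e tau -> mle m sp b tau].
Proof.
move=> cs s'; rewrite {}/s' sem_seq /p_init sem_seq sem_set.
set s1 := setr _ _ _; have cs1 : ctx s1 by apply: ctx_setr.
have [fs2 tot2] := flagsP cs1; set s2 := sem p_flags s1 in fs2 tot2 *.
have nm2 : rg s2 vNM = n + m.
  by rewrite /s2 frame_r // /s1; exec; rewrite (ctx_n cs) (ctx_m cs).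
have cs2 : ctx s2 by apply: ctx_sem.
by split=> //; apply: casesP.
Qed.

End Algorithm.

(** * Running time *)

(** For each loop, the limits of the loops around it and its own, outermost first. Up to a constant
    the running time is at most the largest product over such a list. *)
Fixpoint paths (c : prog) : seq (seq nat) :=
  match c with
  | Set_ _ _ | Put _ _ _ _ => [::]
  | Seq c1 c2 | If _ c1 c2 => paths c1 ++ paths c2
  | For _ lim c => [:: lim] :: [seq lim :: l | l <- paths c]
  end.

(** [acc] is the product of the limits of the loops already entered. The constant factor is the cost
    of the program with every limit set to 1. *)
Lemma tbound_paths rho X c d acc : acc <= X ->
  {in paths c, forall l, acc * \prod_(i <- l) rho i <= X} ->
  acc * tbound rho d c <= tbound (fun=> 1) d c * X.
Proof.
elim: c d acc => [v e|q a b e|c1 IH1 c2 IH2|e c1 IH1 c2 IH2|v lim c IH] d acc aX H /=.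
- by rewrite mulnC leq_mul2l aX orbT.
- by rewrite mulnC leq_mul2l aX orbT.
- rewrite mulnDr mulnDl leq_add ?IH1 ?IH2 // => l lc; apply: H;
    by rewrite mem_cat lc ?orbT.
- rewrite !mulnDr !mulnDl; repeat apply: leq_add.
  + by rewrite mulnC leq_mul2l aX orbT.
  + by apply: IH1 => // l lc; apply: H; rewrite mem_cat lc.
  + by apply: IH2 => // l lc; apply: H; rewrite mem_cat lc orbT.
  + by rewrite mulnC leq_mul2l aX orbT.
have aX' : acc * rho lim <= X.
  by have := H [:: lim] (mem_head _ _); rewrite big_seq1.
have := IH d.+1 (acc * rho lim) aX' => /(_ _) lt.
rewrite mulnDr mul1n mulnA mulnDr !mulnDl; repeat apply: leq_add.
- apply: lt => l lc; have := H (lim :: l); rewrite big_cons mulnA; apply.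
  by rewrite inE map_f ?orbT.
- by rewrite mulnC leq_mul2l aX' orbT.
- by rewrite mulnC leq_mul2l aX orbT.
Qed.

Definition init_cost := tbound (fun=> 1) nv.+1 p_init.
Definition cases_cost := tbound (fun=> 1) nv.+1 p_cases.

Lemma init_time rho : 0 < rho vN ->
  tbound rho nv.+1 p_init <= init_cost * rho vN ^ 2.
Proof.
move=> n0; rewrite -[tbound _ _ _]mul1n; apply: tbound_paths.
  by rewrite expn_gt0 n0.
move=> l; rewrite -mem_undup.
have -> : undup (paths p_init) = [:: [:: vN]; [:: vN; vN]] by vm_compute.
rewrite !inE mul1n => /orP[] /eqP->; rewrite !big_cons big_nil; nia.
Qed.

Lemma cases_time rho : 0 < rho vN -> 0 < rho vM -> 0 < rho vTot ->
  rho vNM = rho vN + rho vM ->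
  tbound rho nv.+1 p_cases <=
    cases_cost * (2 * (rho vTot * rho vM ^ 2 * rho vN ^ 2)).
Proof.
move=> n0 m0 t0 nm; rewrite -[tbound _ _ _]mul1n.
apply: tbound_paths; first by rewrite !muln_gt0 n0 m0 t0.
move=> l; rewrite -mem_undup.
have -> : undup (paths p_cases) =
  [:: [:: vTot]; [:: vTot; vN; vM]; [:: vTot; vN; vN]; [:: vTot; vNM];
      [:: vTot; vNM; vM; vN]; [:: vTot; vNM; vM]; [:: vTot; vM]; [:: vTot; vN]].
  by vm_compute.
rewrite mul1n => l_in.
(* The factor 2 comes from the searches: [n + m] rounds with [m] scans of [n] jobs, and
   [(n + m) m n <= 2 (m n)^2]. *)
have [y -> ly] : exists2 y, \prod_(i <- l) rho i = rho vTot * y &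
    y <= 2 * (rho vM ^ 2 * rho vN ^ 2); last first.
  by rewrite -mulnA mulnCA leq_mul2l ly orbT.
move: l_in; rewrite !inE.
have mn_n : rho vN <= rho vM * rho vN by rewrite leq_pmull.
have mn_m : rho vM <= rho vM * rho vN by rewrite leq_pmulr.
rewrite -expnMn; set x := rho vM * rho vN in mn_n mn_m *.
have x0 : 0 < x by rewrite muln_gt0 m0.
have xx : x <= x ^ 2 by rewrite -mulnn leq_pmull.
have xn y : y <= x -> y * rho vN <= x ^ 2 by rewrite -mulnn => yx; apply: leq_mul.
have xm y : y <= x -> y * rho vM <= x ^ 2 by rewrite -mulnn => yx; apply: leq_mul.
have dn : rho vN * rho vM * rho vN <= x ^ 2 by rewrite -mulnA -/x mulnC; apply: xn.
have dm : rho vM * rho vM * rho vN <= x ^ 2 by rewrite -mulnA -/x mulnC; apply: xm.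
have := xn _ mn_n; have := xm _ mn_m; have := xn _ mn_m; have := xm _ mn_n.
move=> h1 h2 h3 h4.
repeat (case/orP; [move/eqP-> | ]); last move/eqP->;
  rewrite !big_cons big_nil ?muln1 ?nm.
- by exists 1; lia.
- by exists (rho vN * rho vM) => //; lia.
- by exists (rho vN * rho vN) => //; lia.
- by exists (rho vN + rho vM) => //; lia.
- by exists ((rho vN + rho vM) * (rho vM * rho vN)) => //; lia.
- by exists ((rho vN + rho vM) * rho vM) => //; lia.
- by exists (rho vM) => //; lia.
- by exists (rho vN) => //; lia.
Qed.

(** * Moving the input out of the way of the registers *)

Lemma evb_if r c1 c2 M T Q :
  (M r != 0 -> evb c1 M T Q) -> (M r = 0 -> evb c2 M T Q) ->
  evb (CIf r c1 c2) M T.+2 Q.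
Proof.
move=> H1 H2; case: (eqVneq (M r) 0) => [r0|r0].
  have [t [M' [E l q]]] := H2 r0.
  by exists t.+1, M'; split=> //; [apply: EvIfF|lia].
have [t [M' [E l q]]] := H1 r0.
by exists t.+2, M'; split=> //; apply: EvIfT.
Qed.

(* Cell 0 := A = (m + 1) n^2 + nr n, a value beyond the input from which [m]
   can be recovered with the help of [n], so that no cell is lost. *)
Definition base_code : seq instr :=
  [:: IMul 0 0 1; IAdd 0 0 1; IMul 0 0 1] ++ nseq nr (IAdd 0 0 1).

(** Cell 2 is the address register, so its own content is parked in cell [A] first; it reaches
    [A + 2] at the end, when cell 3 is saved and free for the transfer. *)
Definition save_cell r : seq instr := [:: IConst 2 r; IAdd 2 2 0; IStore 2 r].

(* Cell [r < nr] goes to cell [A + r]; then cell 0 becomes the base [A + nr] of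
   the arrays. *)
Definition save_code : seq instr :=
  [:: IStore 0 2] ++ flatten [seq save_cell r | r <- iota 3 (nr - 3)] ++
  [:: IConst 2 2; IAdd 2 2 0; ILoad 3 0; IStore 2 3; IConst 2 nr; IAdd 0 0 2].

(* Copies cells [M 3], [M 3 + 1], ... ([M 2] of them) to the entries [M 4],
   [M 4 + 1], ... of array [aI]. *)
Definition copy_loop : cmd :=
  CWhile 2 (Ops ([:: IConst 10 0; IAdd 10 10 4; IConst 11 0] ++ addr_code aI 10 ++
    [:: ILoad 12 3; IStore 10 12; IConst 5 1; IAdd 3 3 5; IAdd 4 4 5; ISub 2 2 5])).

(** The cells below [nr] are copied from their saved versions at [A], the others directly from the
    input. *)
Definition copy_low : seq instr :=
  [:: IConst 2 nr; IConst 3 0; IAdd 3 3 0; ISub 3 3 2; IConst 4 0].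
Definition copy_high : seq instr :=
  [:: IConst 3 nr; ISub 2 0 3; ISub 2 2 3; IConst 4 0; IAdd 4 4 3].
(** Inverts [input_end]: [m] is the quotient of [A - nr n] by [n^2], minus 1. *)
Definition recover_m : seq instr :=
  [:: IConst 3 nr; ISub 2 0 3; IMul 3 3 1; ISub 2 2 3; IDiv 2 2 1; IDiv 2 2 1;
      IConst 3 1; ISub 2 2 3].

Definition prologue : cmd :=
  CSeq (Ops (base_code ++ save_code ++ copy_low))
    (CSeq copy_loop (CSeq (Ops copy_high) (CSeq copy_loop (Ops recover_m)))).

Lemma exec_nil M : exec_ops [::] M = M. Proof. by []. Qed.
Lemma exec_const M r c l :
  exec_ops (IConst r c :: l) M = exec_ops l (upd M r c). Proof. by []. Qed.
Lemma exec_add M r a b l :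
  exec_ops (IAdd r a b :: l) M = exec_ops l (upd M r (M a + M b)). Proof. by []. Qed.
Lemma exec_sub M r a b l :
  exec_ops (ISub r a b :: l) M = exec_ops l (upd M r (M a - M b)). Proof. by []. Qed.
Lemma exec_mul M r a b l :
  exec_ops (IMul r a b :: l) M = exec_ops l (upd M r (M a * M b)). Proof. by []. Qed.
Lemma exec_div M r a b l :
  exec_ops (IDiv r a b :: l) M = exec_ops l (upd M r (M a %/ M b)). Proof. by []. Qed.
Lemma exec_load M r a l :
  exec_ops (ILoad r a :: l) M = exec_ops l (upd M r (M (M a))). Proof. by []. Qed.
Lemma exec_store M a r l :
  exec_ops (IStore a r :: l) M = exec_ops l (upd M (M a) (M r)). Proof. by []. Qed.
Lemma upd_hit (M : memory) a v b : b = a -> upd M a v b = v.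
Proof. by move=> ->; exact: updx. Qed.

(* Values are simplified after every instruction: a memory occurs up to three
   times in the next one. *)
Ltac lookup :=
  repeat match goal with
  | |- context [upd ?M ?a ?v ?b] =>
      first [ rewrite (@updn M a v b); [|lia] | rewrite (@upd_hit M a v b); [|lia] ]
  end.
Ltac step :=
  first [ rewrite exec_const | rewrite exec_add | rewrite exec_sub
        | rewrite exec_mul | rewrite exec_div | rewrite exec_load
        | rewrite exec_store | rewrite exec_nil ]; lookup.

(** For [n > 0] this is at least [nr], so the saved copies avoid the low cells, and at least
    [2 + m + n * n], so they avoid the input. *)
Definition input_end m n := m.+1 * n ^ 2 + nr * n.

Lemma base_codeP M : let M' := exec_ops base_code M in
  M' 0 = input_end (M 0) (M 1) /\ forall a, a != 0 -> M' a = M a.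
Proof.
rewrite /base_code exec_cat; set M1 := exec_ops _ M.
have E1 : M1 0 = (M 0).+1 * M 1 ^ 2 /\ forall a, a != 0 -> M1 a = M a.
  split=> [|a a0]; rewrite /M1 /= /exec1 /= /upd /= ?(negbTE a0) //.
  by rewrite /upd /=; nia.
rewrite /input_end; case: E1 => <- E1.
suff H k M2 : let M' := exec_ops (nseq k (IAdd 0 0 1)) M2 in
   M' 0 = M2 0 + k * M2 1 /\ forall a, a != 0 -> M' a = M2 a.
  by have [-> E2] := H nr M1; rewrite (E1 1) //; split=> // a a0; rewrite E2 ?E1.
elim: k M2 => [|k IH] M2 /=; first by rewrite addn0.
have [-> E2] := IH (exec1 M2 (IAdd 0 0 1)); split=> [|a a0].
  by rewrite /exec1 /= /upd /= mulSn addnA.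
by rewrite E2 // /exec1 /= /upd (negbTE a0).
Qed.

Lemma save_cellsP A r0 k M : M 0 = A -> nr <= A -> 2 < r0 -> r0 + k <= nr ->
  let M' := exec_ops (flatten [seq save_cell r | r <- iota r0 k]) M in
  (forall r, r0 <= r < r0 + k -> M' (A + r) = M r) /\
  (forall a, a != 2 -> ~~ (A + r0 <= a < A + (r0 + k)) -> M' a = M a).
Proof.
elim: k r0 M => [|k IH] r0 M M0 nA r2 kn; first by split=> // r; lia.
have -> : flatten [seq save_cell r | r <- iota r0 k.+1] =
  save_cell r0 ++ flatten [seq save_cell r | r <- iota r0.+1 k] by [].
rewrite exec_cat.
set M1 := exec_ops (save_cell r0) M.
have E1 : M1 = upd (upd (upd M 2 r0) 2 (r0 + A)) (r0 + A) (M r0).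
  by rewrite /M1 /save_cell; do 2 step; rewrite M0; do 2 step.
have M10 : M1 0 = A by rewrite E1 /upd ifF ?M0 //; lia.
have [] := IH r0.+1 M1 M10 nA; [lia|lia|].
set M' := exec_ops _ _ => H1 H2; split=> [r Hr|a a2 Ha].
  have [->|nr0] := eqVneq r r0.
    by rewrite H2 ?E1; [rewrite addnC /upd eqxx|lia|lia].
  by rewrite H1 ?E1 /upd ?ifF //; lia.
by rewrite H2 ?E1 /upd ?ifF //; lia.
Qed.

Lemma save_codeP A M : M 0 = A -> nr <= A ->
  let M' := exec_ops save_code M in
  [/\ M' 0 = A + nr, M' 1 = M 1, (forall r, 2 <= r < nr -> M' (A + r) = M r) &
      forall a, nr <= a < A -> M' a = M a].
Proof.
move=> M0 nA; rewrite /save_code; set l := flatten _.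
rewrite (exec_cat [:: IStore 0 2]) (exec_cat l).
set M1 := exec_ops [:: IStore 0 2] M.
have E1 : M1 = upd M A (M 2) by rewrite /M1 /= /exec1 /= M0.
have n64 : nr = 64 by [].
have M10 : M1 0 = A by rewrite E1 /upd ifF ?M0 //; lia.
clearbody M1.
have [] : (forall r, 3 <= r < 3 + (nr - 3) -> exec_ops l M1 (A + r) = M1 r) /\
  (forall a, a != 2 -> ~~ (A + 3 <= a < A + (3 + (nr - 3))) -> exec_ops l M1 a = M1 a).
  by apply: save_cellsP.
move: (exec_ops l M1) => M2 H1 H2.
have n3 : 3 + (nr - 3) = nr by [].
rewrite n3 in H1 H2.
have M20 : M2 0 = A by rewrite H2 ?M10 //; lia.
set M3 := exec_ops _ _.
have E3 : M3 = upd (upd (upd (upd (upd (upd M2 2 2) 2 (2 + A)) 3 (M2 A)) (2 + A) (M2 A)) 2 nr) 0 (A + nr).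
  by rewrite /M3; do 2 step; rewrite M20; do 5 step; rewrite M20.
have M2A : M2 A = M 2 by rewrite H2 ?E1 /upd ?eqxx //; lia.
rewrite E3 M2A; split; [by lookup|lookup|move=> r Hr|move=> a Ha; lookup].
- by rewrite H2 ?E1; [lookup|lia|lia].
- have [->|r2] := eqVneq r 2; first by lookup.
  by lookup; rewrite H1 ?E1; [lookup|lia].
- by rewrite H2 ?E1; [lookup|lia|lia].
Qed.

Lemma exec_addr base q d M l : M 0 = base -> 0 < d -> d.+1 < nr ->
  exists M', [/\ exec_ops (addr_code q d ++ l) M = exec_ops l M',
    M' d = (base + cell q (M d) (M d.+1)).+1 &
    forall a, a != d -> a != d.+1 -> M' a = M a].
Proof.
move=> M0 d0 dn; exists (exec_ops (addr_code q d) M); rewrite exec_cat.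
have [t [v u]] := addr_codeP q M0 d0 dn; split=> // a ad ad1.
by case: (ltnP d.+1 a) => [/u//|ad2]; apply: t; lia.
Qed.

(* The state of [copy_loop] with [k] of [N] cells still to copy. *)
Record copy_inv (base src a0 N : nat) (M0 : memory) (k : nat) (M : memory) : Prop :=
  CopyInv {
    cp_le : k <= N;
    cp_base : M 0 = base;
    cp_one : M 1 = M0 1;
    cp_cnt : M 2 = k;
    cp_src : M 3 = src + (N - k);
    cp_dst : M 4 = a0 + (N - k);
    cp_low : forall x, nr <= x <= base -> M x = M0 x;
    cp_done : forall i, i < N - k -> M (base + cell aI (a0 + i) 0).+1 = M0 (src + i);
    cp_rest : forall a, a < a0 -> M (base + cell aI a 0).+1 = M0 (base + cell aI a 0).+1
  }.

Lemma copy_loopP base src a0 N M : M 0 = base -> M 2 = N -> M 3 = src -> M 4 = a0 ->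
  nr <= src -> src + N <= base ->
  evb copy_loop M (N * 21).+1 (copy_inv base src a0 N M 0).
Proof.
move=> M0 M2 M3 M4 ns sb; have n64 : nr = 64 by [].
have I0 : copy_inv base src a0 N M N M.
  by split=> //; rewrite subnn ?addn0 // => i; rewrite ltn0.
apply: (evb_weaken (evb_while (I := copy_inv base src a0 N M) (T := 19) _ _ I0)) => //.
  by move=> k M' /cp_cnt.
move=> k M1 [kN b1 o1 c1 s1 d1 l1 f1 r1]; apply: evb_ops => //.
rewrite (exec_cat [:: IConst 10 0; IAdd 10 10 4; IConst 11 0]).
have -> : exec_ops [:: IConst 10 0; IAdd 10 10 4; IConst 11 0] M1 =
    upd (upd (upd M1 10 0) 10 (a0 + (N - k.+1))) 11 0.
  by do 4 step; rewrite d1.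
set Ma := upd _ 11 0.
have Ma0 : Ma 0 = base by rewrite /Ma; lookup.
have [M5 [-> v5 u5]] := exec_addr aI [:: ILoad 12 3; IStore 10 12; IConst 5 1;
   IAdd 3 3 5; IAdd 4 4 5; ISub 2 2 5] Ma0 (isT : 0 < 10) isT.
have e10 : M5 10 = (base + cell aI (a0 + (N - k.+1)) 0).+1.
  by rewrite v5 /Ma; lookup.
have u5' a : a != 10 -> a != 11 -> M5 a = M1 a.
  by move=> a10 a11; rewrite u5 // /Ma; lookup.
move: (M5) e10 u5' => {Ma Ma0 v5 u5} {}M5 e10 u5.
set dst := (base + _).+1 in e10.
have dst_base : base < dst by rewrite /dst; lia.
step; rewrite (u5 3) // s1 (u5 (src + _)); [|lia|lia].
rewrite l1; last lia.
step; rewrite e10; step; step; rewrite (u5 3) // s1; step; rewrite (u5 4) // d1; step.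
rewrite (u5 2) // c1; step.
have Nk : (N - k.+1).+1 = N - k by lia.
split.
- exact: ltnW.
- by lookup; rewrite u5.
- by lookup; rewrite u5.
- by lookup; lia.
- by lookup; lia.
- by lookup; lia.
- by move=> x Hx; lookup; rewrite u5 ?l1 //; lia.
- move=> i; rewrite -Nk ltnS leq_eqVlt => /predU1P[->|iN]; first by lookup.
  have ne : (base + cell aI (a0 + i) 0).+1 <> dst.
    by rewrite /dst => -[/addnI/cell_inj[_ E _]]; lia.
  by lookup; rewrite u5 ?f1 //; lia.
- move=> a aa0; have ne : (base + cell aI a 0).+1 <> dst.
    by rewrite /dst => -[/addnI/cell_inj[_ E _]]; lia.
  by lookup; rewrite u5 ?r1 //; lia.
Qed.

Lemma prologueP M : 0 < M 1 ->
  let A := input_end (M 0) (M 1) in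
  evb prologue M (A * 21 + 2000) (fun M' =>
    [/\ M' 0 = A + nr, M' 1 = M 1, M' 2 = M 0 &
        forall a, 2 <= a < A -> M' (A + nr + cell aI a 0).+1 = M a]).
Proof.
move=> n0 A; have n64 : nr = 64 by [].
have nA : nr <= A.
  by rewrite /A /input_end (leq_trans _ (leq_addl _ _)) // leq_pmulr.
(* 300 bounds the straight code up to [copy_low] and 5 is the length of [copy_high]; a loop round
   takes 19 instructions and 2 jumps. *)
have -> : A * 21 + 2000 = 300 + ((nr * 21).+1 + (5 + (((A - nr) * 21).+1 + (2000 - 307 + nr * 0)))).
  by lia.
apply: (evb_seq (Q1 := fun M1 =>
  [/\ M1 0 = A + nr, M1 1 = M 1, M1 2 = nr, M1 3 = A & M1 4 = 0] /\
  (forall r, 2 <= r < nr -> M1 (A + r) = M r) /\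
  forall a, nr <= a < A -> M1 a = M a)).
  apply: evb_ops; [by vm_compute|by vm_compute|].
  rewrite (exec_cat base_code) (exec_cat save_code).
  have [B0 B1] := base_codeP M; move: (exec_ops base_code M) B0 B1 => Mb B0 B1.
  have [S0 S1 S2 S3] := save_codeP B0 nA.
  move: (exec_ops save_code Mb) S0 S1 S2 S3 => Ms S0 S1 S2 S3.
  do 2 step; do 4 step.
  split; first split.
  - by lookup.
  - by lookup; rewrite S1 B1.
  - by lookup.
  - by lookup; rewrite S0; lia.
  - by lookup.
  split=> [r Hr|a Ha]; lookup; first by rewrite S2 // B1 //; lia.
  by rewrite S3 // B1 //; lia.
move=> M1 [[a0 a1 a2 a3 a4] [low high]].
apply: evb_seq (copy_loopP a0 a2 a3 a4 nA _) _; first by [].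
move=> M2 [_ b0 b1 b2 b3 b4 bl bd _].
apply: (evb_seq (Q1 := fun M3 => [/\ M3 0 = A + nr, M3 1 = M 1, M3 2 = A - nr, M3 3 = nr & M3 4 = nr] /\
   forall a, nr <= a -> M3 a = M2 a)).
  apply: evb_ops => //; rewrite /copy_high; do 6 step; split; last by move=> a Ha; lookup.
  split; lookup; rewrite ?b0 ?b1 ?a1 //; lia.
move=> M3 [[c0 c1 c2 c3 c4] cr].
have srcN : nr + (A - nr) <= A + nr by lia.
apply: evb_seq (copy_loopP c0 c2 c3 c4 (leqnn _) srcN) _.
move=> M4 [_ d0 d1 d2 d3 d4 dl dd dr].
apply: evb_ops => //; rewrite /recover_m; do 9 step.
split.
- by lookup.
- by lookup; rewrite d1 c1.
- lookup; rewrite d0 d1 c1 /A /input_end !addnK.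
  by rewrite -mulnn mulnA !mulnK // subn1.
move=> a /andP[a2' aA]; lookup.
have [an|an] := ltnP a nr.
  rewrite dr // cr; last by lia.
  have := bd a; rewrite subn0 add0n => -> //.
  by rewrite low // a2'.
have := dd (a - nr); rewrite subn0 subnKC // => ->; last by lia.
rewrite cr // bl; last by lia.
by rewrite high // an.
Qed.

(** * Writing the output over the registers *)

Definition out_loop : cmd :=
  CWhile 2 (Ops ([:: IConst 10 0; IAdd 10 10 4; IConst 11 0] ++ addr_code aB 10 ++
    [:: ILoad 10 10; IStore 3 10; IConst 5 1; IAdd 3 3 5; IAdd 4 4 5; ISub 2 2 5])).
(** The address is computed in the target cell itself, so that no scratch cell destroys an answer
    already written. *)
Definition out_cell r : seq instr :=
  [:: IConst r (cell aB r.-1 0).+1; IAdd r r 0; ILoad r r].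
Definition out_low : seq instr := flatten [seq out_cell r | r <- iota 1 11].

(* The first eleven answers go to cells used by the loop, hence come last. *)
Definition epilogue : cmd :=
  CIf 20
    (CSeq (Ops [:: IConst 3 11; ISub 2 1 3; IConst 4 11; IConst 3 12])
      (CSeq out_loop (Ops (out_low ++ [:: IConst 0 1]))))
    (Ops [:: IConst 0 0]).

Record out_inv (base N : nat) (M0 : memory) (k : nat) (M : memory) : Prop := OutInv {
  op_le : k <= N;
  op_base : M 0 = base;
  op_cnt : M 2 = k;
  op_dst : M 3 = 12 + (N - k);
  op_src : M 4 = 11 + (N - k);
  op_high : forall a, base < a -> M a = M0 a;
  op_done : forall i, i < N - k ->
    M (12 + i) = M0 (base + cell aB (11 + i) 0).+1
}.

(** All targets are at most [base] and all sources lie above it, so writing never spoils a later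
    read. *)
Lemma out_loopP base N M : M 0 = base -> M 2 = N -> M 3 = 12 -> M 4 = 11 ->
  11 + N <= base -> evb out_loop M (N * 21).+1 (out_inv base N M 0).
Proof.
move=> M0 M2 M3 M4 nb.
have I0 : out_inv base N M N M.
  by split=> //; rewrite subnn ?addn0 // => i; rewrite ltn0.
apply: (evb_weaken (evb_while (I := out_inv base N M) (T := 19) _ _ I0)) => //.
  by move=> k M' /op_cnt.
move=> k M1 [kN b1 c1 d1 s1 h1 f1]; apply: evb_ops => //.
rewrite (exec_cat [:: IConst 10 0; IAdd 10 10 4; IConst 11 0]).
have -> : exec_ops [:: IConst 10 0; IAdd 10 10 4; IConst 11 0] M1 =
    upd (upd (upd M1 10 0) 10 (11 + (N - k.+1))) 11 0.
  by do 4 step; rewrite s1.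
set Ma := upd _ 11 0.
have Ma0 : Ma 0 = base by rewrite /Ma; lookup.
have [M5 [-> v5 u5]] := exec_addr aB [:: ILoad 10 10; IStore 3 10; IConst 5 1;
   IAdd 3 3 5; IAdd 4 4 5; ISub 2 2 5] Ma0 (isT : 0 < 10) isT.
have e10 : M5 10 = (base + cell aB (11 + (N - k.+1)) 0).+1.
  by rewrite v5 /Ma; lookup.
have u5' a : a != 10 -> a != 11 -> M5 a = M1 a.
  by move=> a10 a11; rewrite u5 // /Ma; lookup.
move: (M5) e10 u5' => {Ma Ma0 v5 u5} {}M5 e10 u5.
set src := (base + _).+1 in e10.
have src_base : base < src by rewrite /src; lia.
step; rewrite e10 (u5 src); [|lia|lia].
rewrite h1 //; step; rewrite (u5 3) // d1; step; step; rewrite (u5 3) // d1.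
step; rewrite (u5 4) // s1; step; rewrite (u5 2) // c1; step.
have Nk : (N - k.+1).+1 = N - k by lia.
split.
- exact: ltnW.
- by lookup; rewrite u5.
- by lookup; lia.
- by lookup; lia.
- by lookup; lia.
- by move=> a Ha; lookup; rewrite u5 ?h1 //; lia.
- move=> i; rewrite -Nk ltnS leq_eqVlt => /predU1P[->|iN]; first by lookup.
  by lookup; rewrite u5 ?f1 //; lia.
Qed.

Lemma out_cellsP base r0 k M : M 0 = base -> 0 < r0 -> r0 + k <= base ->
  let M' := exec_ops (flatten [seq out_cell r | r <- iota r0 k]) M in
  (forall r, r0 <= r < r0 + k -> M' r = M (base + cell aB r.-1 0).+1) /\
  (forall a, ~~ (r0 <= a < r0 + k) -> M' a = M a).
Proof.
elim: k r0 M => [|k IH] r0 M M0 r00 rb; first by split=> // r; lia.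
have -> : flatten [seq out_cell r | r <- iota r0 k.+1] =
  out_cell r0 ++ flatten [seq out_cell r | r <- iota r0.+1 k] by [].
rewrite exec_cat; set c := (cell aB r0.-1 0).+1.
have E1 : exec_ops (out_cell r0) M =
    upd (upd (upd M r0 c) r0 (c + base)) r0 (M (base + cell aB r0.-1 0).+1).
  rewrite /out_cell -/c; do 2 step; rewrite M0; step.
  have -> : c + base = (base + cell aB r0.-1 0).+1 by rewrite /c; lia.
  by lookup; rewrite exec_nil.
rewrite E1; set M1 := upd _ _ _.
have M10 : M1 0 = base by rewrite /M1; lookup.
have [] := IH r0.+1 M1 M10 isT; first lia.
set M' := exec_ops _ _ => H1 H2; split=> [r Hr|a Ha].
  have [->|nr0] := eqVneq r r0; first by rewrite H2 /M1; [lookup|lia].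
  by rewrite H1 /M1; [lookup|lia].
by rewrite H2 /M1; [lookup|lia].
Qed.

(** Cell 20 holds the variable [vBest]. Cell 0 keeps the base address until the last instruction
    turns it into the success flag. *)
Lemma epilogueP base n M : M 0 = base -> M 1 = n -> nr <= base -> n <= base ->
  evb epilogue M (n * 21 + 100) (fun M' =>
    if M 20 == 0 then M' 0 = 0
    else M' 0 = 1 /\ forall j, j < n -> M' j.+1 = M (base + cell aB j 0).+1).
Proof.
move=> M0 M1 nb n_b; have n64 : nr = 64 by [].
have -> : n * 21 + 100 = (4 + (n * 21 + 1 + 93)).+2 by lia.
apply: evb_if => r20; last first.
  by rewrite r20; apply: evb_ops; rewrite //= addSn.
rewrite (negbTE r20).
apply: (evb_seq (Q1 := fun M2 => [/\ M2 0 = base, M2 2 = n - 11, M2 3 = 12 & M2 4 = 11] /\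
   forall a, base < a -> M2 a = M a)).
  apply: evb_ops => //; do 5 step; split; last by move=> a Ha; lookup.
  by split; lookup; rewrite ?M1.
move=> M2 [[a0 a2 a3 a4] ah].
have le : 11 + (n - 11) <= base by lia.
apply: evb_seq (evb_weaken (out_loopP a0 a2 a3 a4 le) _ (fun M' H => H)) _.
  by lia.
move=> M3 [_ b0 _ _ _ bh bd].
apply: evb_ops; [by vm_compute|by vm_compute|].
rewrite (exec_cat out_low) exec_const exec_nil; split; first by rewrite updx.
have [] := @out_cellsP base 1 11 M3 b0 isT; first lia.
rewrite -/out_low; move: (exec_ops out_low M3) => M4 H1 H2 j jn; lookup.
have [j11|j11] := ltnP j 11.
  by rewrite H1 ?bh ?ah //=; lia.
rewrite H2; last by lia.
have := bd (j - 11); rewrite subn0 addSn subnKC // => ->; last by lia.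
by rewrite ah //; lia.
Qed.

(** * The theorem *)

Definition nonsimplicial (n : nat) (e : rel 'I_n) : pred 'I_n :=
  fun v => [exists a, exists b, [&& e v a, e v b, a != b & ~~ e a b]].

Section Nonsimplicial.
Variables (n : nat) (e : rel 'I_n).
Hypotheses (sg : simple_graph e) (bg : block_graph e).

Lemma nonsimplicialN v : ~~ nonsimplicial e v -> simplicial e v.
Proof.
move=> nv a b va vb ab; apply: contraNT nv => eab.
by apply/existsP; exists a; apply/existsP; exists b; rewrite va vb ab.
Qed.

(** If [a] and [b] are non-adjacent neighbours of [v], then [diamond] forbids [u] to be adjacent to
    both, so any neighbour [u] exposes the defect. *)
Lemma nonsimplicial_nbr v u : e v u ->
  nonsimplicial e v = [exists w, [&& e v w, u != w & ~~ e u w]].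
Proof.
move=> vu; apply/idP/idP; last first.
  case/existsP=> w /and3P[vw uw euw].
  by apply/existsP; exists u; apply/existsP; exists w; rewrite vu vw uw.
case/existsP=> a /existsP[b /and4P[va vb ab eab]].
have [[e_sym _] diam] := (sg, @diamond _ _ sg bg u v a b va vb vu).
have [ua|ua] := eqVneq u a.
  by apply/existsP; exists b; rewrite ua vb ab.
have [ub|ub] := eqVneq u b.
  by apply/existsP; exists a; rewrite ub va eq_sym ab e_sym.
case eua: (e u a); last by apply/existsP; exists a; rewrite va ua eua.
case eub: (e u b); last by apply/existsP; exists b; rewrite vb ub eub.
by rewrite diam in eab.
Qed.

Lemma nonsimplicial_iso v : (forall u, ~~ e v u) -> ~~ nonsimplicial e v.
Proof.
move=> iso; apply/existsPn => a; apply/existsPn => b.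
by rewrite (negbTE (iso a)).
Qed.

Lemma card_nonsimplicial : #|nonsimplicial e| <= cut e.
Proof.
apply: subset_leq_card; apply/subsetP => v.
case/existsP=> a /existsP[b /and4P[va vb ab eab]].
exact: nonsimplicial_cut va vb ab eab.
Qed.

End Nonsimplicial.

(** For [n = 0] the empty schedule is reported; for [m = 0 < n] cell 0 already contains 0, the
    answer for infeasibility. *)
Definition main_cmd : cmd :=
  CIf 1
    (CIf 0
      (CSeq prologue
        (CSeq (tr nv.+1 p_init) (CSeq (tr nv.+1 p_cases) epilogue)))
      (Ops [::]))
    (Ops [:: IConst 0 1]).

(** The 66 is 1 + 1 + [nr], from [m n^2 + n^2 + nr n] with each of [m n^2], [n^2] and [n] at most
    [m^(k+2) n^2]; the prologue spends 21 steps per cell. *)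
Definition main_const : nat := 66 * 21 + 2000 + init_cost + cases_cost * 2 + 200.

Lemma time_arith A X Y N n : A <= 66 * X -> Y <= X -> N <= X -> n <= X ->
  A * 21 + 2000 + (init_cost * N + (cases_cost * (2 * Y) + (n * 21 + 100))) <=
  main_const * X + main_const.
Proof.
rewrite /main_const; move: init_cost cases_cost => i c AX YX NX nX.
have h1 : i * N <= i * X by rewrite leq_mul2l NX orbT.
have h2 : c * Y <= c * X by rewrite leq_mul2l YX orbT.
rewrite (mulnCA c) !(mulnDl _ _ X) mulnAC; lia.
Qed.

Definition speed_at (m : nat) (s : 'I_m -> nat) (x : nat) : nat :=
  if insub x is Some i then s i else 0.

Section Encoding.
Variables (m n : nat) (s : 'I_m -> nat) (e : rel 'I_n).

Lemma encode_speed x : x < m -> encode_input s e (2 + x) = speed_at s x.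
Proof. by move=> xm; rewrite /encode_input /= ltn_add2l xm /speed_at addKn. Qed.

Lemma encode_edge (j w : 'I_n) : encode_input s e (2 + m + j * n + w) = e j w.
Proof.
have n0 : 0 < n by apply: leq_ltn_trans (ltn_ord j).
have lt : j * n + w < n * n.
  apply: (@leq_trans (j.+1 * n)); first by rewrite mulSn addnC ltn_add2r.
  by rewrite leq_mul2r ltn_ord orbT.
rewrite /encode_input -!addnA /= addnA.
rewrite [in X in if X then _ else _]ltnNge leq_addr /=.
rewrite ltn_add2l lt addKn divnMDl // divn_small // addn0 valK.
by rewrite modnMDl modn_small // valK.
Qed.

End Encoding.

Lemma total_proper_schedule m n (e : rel 'I_n) (tau : 'I_n -> 'I_m) :
  proper_schedule e tau -> total_proper m e (fun j => tau j).
Proof. by move=> tp; split=> [j|j w /tp]; rewrite ?ltn_ord. Qed.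

Lemma mainP k m n (s : 'I_m -> nat) (e : rel 'I_n) :
  (forall i, 0 < s i) -> simple_graph e -> block_graph e -> cut e <= k ->
  0 < m -> 0 < n ->
  evb (CSeq prologue (CSeq (tr nv.+1 p_init) (CSeq (tr nv.+1 p_cases) epilogue)))
    (encode_input s e)
    (main_const * (m ^ (k + 2) * n ^ 2) + main_const) (correct_output s e).
Proof.
move=> s0 sg bg ck m0 n0; have [e_sym e_irr] := sg.
pose M0 := encode_input s e; pose A := input_end m n.
pose F := nonsimplicial e.
have n64 : nr = 64 by [].
have nA : nr <= A by rewrite /A /input_end (leq_trans _ (leq_addl _ _)) // leq_pmulr.
have big : 2 + m + n * n <= A.
  have : m <= m * (n * n) by rewrite leq_pmulr // muln_gt0 n0.
  by rewrite /A /input_end n64 mulSn -mulnn; lia.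
pose X := m ^ (k + 2) * n ^ 2.
have X_m2 : m ^ #|F| * m ^ 2 * n ^ 2 <= X.
  rewrite /X expnD leq_mul // leq_mul // leq_pexp2l //.
  exact: leq_trans (card_nonsimplicial sg bg) ck.
have T0 : 0 < m ^ #|F| by rewrite expn_gt0 m0.
have X_A : A <= 66 * X.
  apply: leq_trans (leq_mul (leqnn 66) X_m2); rewrite /A /input_end n64.
  have h1 : m * n ^ 2 <= m ^ #|F| * m ^ 2 * n ^ 2.
    by rewrite leq_mul // -mulnn mulnA leq_pmull // muln_gt0 T0.
  have h2 : n ^ 2 <= m * n ^ 2 by rewrite leq_pmull.
  have h3 : n <= n ^ 2 by rewrite -mulnn leq_pmulr.
  by move: h1 h2 h3; rewrite mulSn; move: (m ^ #|F| * _ * _) => Y; lia.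
have X_n : n ^ 2 <= X.
  by apply: leq_trans X_m2; rewrite leq_pmull // muln_gt0 T0 expn_gt0 m0.
have X_n1 : n <= X by apply: leq_trans X_n; rewrite -mulnn leq_pmulr.
apply: (@evb_weaken _ _ ((A * 21 + 2000) + (init_cost * n ^ 2 +
   (cases_cost * (2 * (m ^ #|F| * m ^ 2 * n ^ 2)) + (n * 21 + 100)))) _ (correct_output s e)).
- have n1 : M0 1 = n by [].
  have n1' : 0 < M0 1 by rewrite n1.
  apply: evb_seq (prologueP n1') _ => M1 [b1 c1 d1 in1].
  have {}in1 a : 2 + a < 2 + m + n * n -> M1 (A + nr + cell aI (2 + a) 0).+1 = M0 (2 + a).
    by move=> lt; apply: in1; rewrite leq_addr /= (leq_trans lt big).
  (* The initial state is read off the memory; [ctx] fixes only [m], [n] and the input, so all other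
     contents may be arbitrary. *)
  pose st0 := St (fun v => M1 v.+1) (fun q x y => M1 (A + nr + cell q x y).+1).
  have R0 : rep (A + nr) st0 M1 by split=> //; rewrite leq_addl.
  have cs : ctx m e (speed_at s) st0.
    split=> //.
    - move=> j w; rewrite /col /=.
      have := in1 (m + j * n + w); rewrite !addnA => -> //; first exact: encode_edge.
      have lt : j * n + w < n * n.
        apply: (@leq_trans (j.+1 * n)); first by rewrite mulSn addnC ltn_add2r.
        by rewrite leq_mul2r ltn_ord orbT.
      by rewrite -!addnA !ltn_add2l.
    - move=> x xm; rewrite /col /= in1; first exact: encode_speed.
      by rewrite -addnA ltn_add2l ltn_addr.
  have sp0 x : x < m -> 0 < speed_at s x.
    by move=> xm; rewrite /speed_at insubT.
  have [tot nm res] := algorithmP m0 n0 e_sym e_irr sp0 (nonsimplicial_nbr sg bg)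
    (@nonsimplicial_iso _ e) (@nonsimplicialN _ e) cs.
  rewrite sem_seq in res; set st1 := sem p_init st0 in tot nm res.
  have ni : rg st0 vN = n by [].
  have init_le := @init_time (rg st0); rewrite ni in init_le.
  apply: evb_seq (evb_weaken (trP (rho := rg st0) (W := wvars p_init) _ _ R0 _ _)
      (init_le n0) (fun M' H => H)) _ => //.
    have H : all (fun l => l \notin wvars p_init) (limits p_init) by vm_compute.
    by move=> l /(allP H).
  move=> M2 [R2 _].
  have [st2n [st2m [st2t st2nm]]] : rg st1 vN = n /\ rg st1 vM = m /\
      rg st1 vTot = m ^ #|F| /\ rg st1 vNM = n + m.
    split; first by rewrite /st1 frame_r.
    by split; first by rewrite /st1 frame_r.
  rewrite -/st1 in R2; clearbody st1.
  have cases_le := @cases_time (rg st1); rewrite st2n st2m st2t st2nm in cases_le.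
  apply: evb_seq (evb_weaken (trP (rho := rg st1) (W := wvars p_cases) _ _ R2 _ _)
      (cases_le n0 m0 T0 erefl) (fun M' H => H)) _ => //.
    have H : all (fun l => l \notin wvars p_cases) (limits p_cases) by vm_compute.
    by move=> l /(allP H).
  move=> M3 [R3 _].
  have [b3 _ v3 a3] := R3.
  have n3 : M3 1 = n by rewrite (v3 vN) // frame_r.
  move: (sem p_cases st1) res v3 a3 {R3} => st2 res v3 a3.
  have n_A : n <= A + nr.
    by rewrite /A /input_end -addnA (leq_trans _ (leq_addl _ _)) // (leq_trans _ (leq_addr _ _)) // leq_pmull.
  apply: evb_weaken (epilogueP b3 n3 (leq_addl _ _) n_A) (leqnn _) _ => M4.
  rewrite (v3 vBest) // /correct_output; case: ifP res => best res.
    by move=> ->; rewrite eqxx => sigma /total_proper_schedule; apply: res.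
  case=> -> out; case: res => -[tm tp] opt.
  pose sigma j := Ordinal (tm j); exists sigma; split; last split.
  - by move=> j; rewrite out // a3.
  - by move=> j w jw; rewrite -val_eqE /=; apply: tp.
  move=> tau /total_proper_schedule tpt; apply: (@mle_makespan _ _ s (speed_at s) sigma tau s0 _ (opt _ tpt)).
  by move=> i; rewrite /speed_at valK.
- rewrite -/X; move: X_m2; set Y := _ * m ^ 2 * _ => X_m2.
  exact: time_arith.
- by [].
Qed.

Theorem theorem4 :
  forall k : nat, exists (P : seq instr) (C : nat),
    forall (m n : nat) (s : 'I_m -> nat) (e : rel 'I_n),
      (forall i, 0 < s i) ->
      simple_graph e -> block_graph e -> cut e <= k ->
      exists M : memory,
        run P (time_bound k C m n) 0 (encode_input s e) = Some M /\
        correct_output s e M.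
Proof.
move=> k; exists (assemble 0 main_cmd), (main_const + 4) => m n s e s0 sg bg ck.
suff [t [M [evM le out]]] : evb main_cmd (encode_input s e)
    (time_bound k (main_const + 4) m n) (correct_output s e).
  by exists M; split=> //; apply: run_cmd evM le.
pose T := main_const * (m ^ (k + 2) * n ^ 2) + main_const.
(* Two steps for each of the two nested tests, absorbed by the 4 in the constant; the logarithmic
   factor is at least 1. *)
apply: (@evb_weaken _ _ T.+4 _ (correct_output s e)) => //; last first.
  have : m ^ (k + 2) * n ^ 2 <= m ^ (k + 2) * n ^ 2 * (trunc_log 2 (m * n)).+1.
    by rewrite leq_pmulr.
  rewrite /time_bound /T; move: (_ * _ ^ 2) (_ * _.+1) main_const => x y c xy.
  have : c * x <= c * y by rewrite leq_mul2l xy orbT.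
  by rewrite mulnDl; lia.
apply: evb_if => n0; last first.
  apply: evb_ops => //; rewrite exec_const exec_nil /correct_output updx /=.
  have no (j : 'I_n) : False by case: j => j; rewrite [n]n0.
  exists (fun j => False_rect _ (no j)); split=> [j|]; first by case: (no j).
  split=> [j|tau _]; first by case: (no j).
  (* Without jobs all schedules coincide. *)
  rewrite (_ : (fun j => _) = tau) ?Order.POrderTheory.lexx //.
  by apply: functional_extensionality => j; case: (no j).
have {}n0 : 0 < n by rewrite lt0n.
apply: evb_if => m0; last first.
  apply: evb_ops => //; rewrite exec_nil /correct_output m0 /= => sigma _.
  by have := ltn_ord (sigma (Ordinal n0)); rewrite [X in _ < X](m0 : m = 0).
by apply: mainP; rewrite // lt0n.
Qed.
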